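(* (i) Two diagonalizable $(n-1)$-dimensional subgroups of the group $\mathrm{Aut}\,\mathbf A^n$ are conjugate in $\mathrm{Cr}_n$ if and only if they are isomorphic. (ii) Every $(n-1)$-dimensional diagonalizable subgroup of the group $\mathrm{Aut}\,\mathbf A^n$ is conjugate in $\mathrm{Cr}_n$ to a unique closed subgroup of $D_n$ of the form $\ker\varepsilon_n^d$, $d\in\mathbf Z$.
   Context: $k$ is an algebraically closed field of characteristic $0$; $\mathbf A^n$ is affine space over $k$ with standard coordinate functions $x_1,\ldots,x_n$. $\mathrm{Cr}_n=\mathrm{Bir}\,\mathbf A^n$ is the group of birational self-maps of $\mathbf A^n$, and $\mathrm{Aut}\,\mathbf A^n\subset\mathrm{Cr}_n$ is the group of polynomial automorphisms; an element $g$ is written $(g_1,\ldots,g_n)$ with $g_i=g^*(x_i)$. A subgroup of $\mathrm{Aut}\,\mathbf A^n$ is called algebraic if it is the image of an algebraic group under a homomorphism to $\mathrm{Aut}\,\mathbf A^n$ for which the action map on $\mathbf A^n$ is a morphism; a diagonalizable subgroup is an algebraic subgroup that is a diagonalizable algebraic group (not necessarily connected). ''Isomorphic'' means isomorphic as algebraic groups. $D_n=\{(t_1x_1,\ldots,t_nx_n)\mid t_i\in k\setminus\{0\}\}$ and $\varepsilon_n\colon D_n\to\mathbf G_{\rm m}$ is the character $(t_1x_1,\ldots,t_nx_n)\mapsto t_n$. *)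

(* Defs.v *)
From HB Require Import structures.
From mathcomp Require Import all_boot all_order all_algebra.
From mathcomp Require Export fraction mpoly.

Set Implicit Arguments.
Unset Strict Implicit.
Unset Printing Implicit Defensive.

Import GRing.Theory.
Local Open Scope ring_scope.

Section Cremona.
Variables (k : closedFieldType) (n : nat).

Definition ratfun := {fraction {mpoly k[n]}}.

(* A polynomial map A^n -> A^n, resp. a rational map A^n --> A^n, is given by
   its components g_i = g^*(x_i). *)
Definition polymap := n.-tuple {mpoly k[n]}.
Definition ratmap := n.-tuple ratfun.

Definition polymap_id : polymap := [tuple 'X_i | i < n].

(* (g o h)(x) = g (h x) *)
Definition polymap_comp (g h : polymap) : polymap :=
  [tuple tnth g i \mPo h | i < n].

Definition poly_aut (g : polymap) : Prop :=
  exists h : polymap,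
    polymap_comp g h = polymap_id /\ polymap_comp h g = polymap_id.

(* The pullback p |-> p(h_1, ..., h_n) of polynomials. *)
Definition poly_pullback (h : ratmap) (p : {mpoly k[n]}) : ratfun :=
  mmap (fun c : k => FracField.tofrac (c%:MP : {mpoly k[n]})) (tnth h) p.

(* The image of h lies in no hypersurface, i.e. it is Zariski dense. *)
Definition dominant (h : ratmap) : Prop :=
  forall p, poly_pullback h p = 0 -> p = 0.

(* h^* on rational functions; for dominant h the value does not depend on the
   chosen representative, for other h it is meaningless. *)
Definition pullback (h : ratmap) (f : ratfun) : ratfun :=
  poly_pullback h (\n_(repr f)) / poly_pullback h (\d_(repr f)).

Definition ratmap_comp (g h : ratmap) : ratmap :=
  [tuple pullback h (tnth g i) | i < n].

(* The inclusion of polynomial maps into rational maps; it sends Aut A^n into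
   Cr_n. *)
Definition ratmap_of (g : polymap) : ratmap :=
  [tuple FracField.tofrac (tnth g i) | i < n].

Definition ratmap_id : ratmap := ratmap_of polymap_id.

(* g belongs to Cr_n = Bir A^n and h is its inverse there. *)
Definition cremona_inverse (g h : ratmap) : Prop :=
  [/\ dominant g, dominant h,
      ratmap_comp g h = ratmap_id & ratmap_comp h g = ratmap_id].

(* H2 = g H1 g^-1 inside Cr_n for some g in Cr_n, for H1, H2 in Aut A^n. *)
Definition cremona_conj (H1 H2 : polymap -> Prop) : Prop :=
  exists g h : ratmap, cremona_inverse g h /\
    forall f : ratmap,
      (exists2 a, H1 a & f = ratmap_comp (ratmap_comp g (ratmap_of a)) h) <->
      (exists2 b, H2 b & f = ratmap_of b).

End Cremona.

Section DiagonalTorus.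
Variables (k : closedFieldType) (n : nat).

(* The torus D_(n+1) in Aut A^(n+1). *)
Definition diag_torus (a : polymap k n.+1) : Prop :=
  exists2 t : 'I_n.+1 -> k,
    (forall i, t i != 0) & a = [tuple t i *: 'X_i | i < n.+1].

(* The character (t_1 x_1, ..., t_(n+1) x_(n+1)) |-> t_(n+1). *)
Definition eps (a : polymap k n.+1) : k := (tnth a ord_max)@_U_(ord_max).

Definition ker_eps_pow (d : int) (a : polymap k n.+1) : Prop :=
  diag_torus a /\ eps a ^ d = 1.

End DiagonalTorus.

Section AlgebraicGroups.
Variable k : closedFieldType.

(* A linear algebraic group: a Zariski-closed subgroup of some GL_m(k). *)
Record alg_group := AlgGroup {
  ag_size : nat;
  ag_set :> 'M[k]_ag_size -> Prop;
  ag_unit : forall g, ag_set g -> g \in unitmx;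
  ag_1 : ag_set 1%:M;
  ag_mul : forall g h, ag_set g -> ag_set h -> ag_set (g *m h);
  ag_inv : forall g, ag_set g -> ag_set (invmx g);
  ag_closed : exists S : {mpoly k[ag_size * ag_size]} -> Prop,
    forall g, g \in unitmx ->
      (ag_set g <-> forall p, S p -> p.@[mxvec g ord0] = 0)
}.

(* The closed embedding g |-> (entries of g, 1 / det g) of GL_m in
   A^(m * m + 1): the regular functions on a closed subset G of GL_m are the
   restrictions to G of polynomials in these coordinates. *)
Definition gl_coords m (g : 'M[k]_m) : 'rV[k]_(m * m + 1) :=
  row_mx (mxvec g) ((\det g)^-1)%:M.

Definition alg_morphism (G1 G2 : alg_group)
    (f : 'M[k]_(ag_size G1) -> 'M[k]_(ag_size G2)) : Prop :=
  [/\ forall g, G1 g -> G2 (f g),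
      forall g h, G1 g -> G1 h -> f (g *m h) = f g *m f h &
      forall i j, exists p : {mpoly k[_]},
        forall g, G1 g -> f g i j = p.@[gl_coords g ord0]].

Definition alg_isomorphic (G1 G2 : alg_group) : Prop :=
  exists (f : 'M_(ag_size G1) -> 'M_(ag_size G2))
         (f' : 'M_(ag_size G2) -> 'M_(ag_size G1)),
    [/\ alg_morphism f, alg_morphism f',
        forall g, G1 g -> f' (f g) = g & forall g, G2 g -> f (f' g) = g].

(* Isomorphic to a closed subgroup of a group of diagonal matrices. *)
Definition diagonalizable_group (G : alg_group) : Prop :=
  exists2 T : alg_group,
    (forall g, T g -> is_diag_mx g) & alg_isomorphic G T.

(* The regular functions f_1, ..., f_d on G are algebraically independent
   over k. *)
Definition alg_independent (G : alg_group) d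
    (f : d.-tuple {mpoly k[ag_size G * ag_size G + 1]}) : Prop :=
  forall P : {mpoly k[d]},
    (forall g, G g -> P.@[fun i => (tnth f i).@[gl_coords g ord0]] = 0) ->
    P = 0.

(* dim G = d, as the transcendence degree of the coordinate ring k[G] (for
   reducible G, the maximum over the components). *)
Definition alg_dim (G : alg_group) (d : nat) : Prop :=
  (exists f : d.-tuple {mpoly k[ag_size G * ag_size G + 1]},
     alg_independent f) /\
  (forall e (f : e.-tuple {mpoly k[ag_size G * ag_size G + 1]}),
     alg_independent f -> (e <= d)%N).

(* An algebraic subgroup of Aut A^n together with its structure of algebraic
   group: the image of a faithful action of as_group for which
   as_group x A^n -> A^n is a morphism. *)
Record alg_subgroup (n : nat) := AlgSubgroup {
  as_group : alg_group;
  as_act : 'M[k]_(ag_size as_group) -> polymap k n;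
  as_aut : forall g, as_group g -> poly_aut (as_act g);
  as_mul : forall g h, as_group g -> as_group h ->
    as_act (g *m h) = polymap_comp (as_act g) (as_act h);
  as_inj : forall g h, as_group g -> as_group h ->
    as_act g = as_act h -> g = h;
  as_morph : forall i : 'I_n,
    exists F : {mpoly k[ag_size as_group * ag_size as_group + 1 + n]},
    forall g (x : 'rV[k]_n), as_group g ->
      (tnth (as_act g) i).@[x ord0] = F.@[row_mx (gl_coords g) x ord0]
}.

Definition as_set n (H : alg_subgroup n) (a : polymap k n) : Prop :=
  exists2 g, as_group H g & a = @as_act n H g.

Definition diagonalizable_of_dim n (H : alg_subgroup n) (d : nat) : Prop :=
  diagonalizable_group (as_group H) /\ alg_dim (as_group H) d.

End AlgebraicGroups.

(* Main.v *)
(* A diagonalizable group H of dimension n is a product of n copies of G_m and of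
   finite cyclic groups; it acts on polynomials through characters, and the weights
   generate the character group because the action is faithful.  Counting monomials
   shows that some weight space of the connected component H0 has dimension at least
   2, so there is a pencil <f, g> of semi-invariants of equal H0-weight; take one of
   minimal degree.  By unique factorization all but finitely many of its members are
   irreducible: otherwise their factors would give a pencil of smaller degree.  Hence
   f / g generates the field of H0-invariants, and the pencil is H-stable, so it has a
   basis of H-semi-invariants, whose ratio s still generates that field.  Adjoining
   to s ratios of semi-invariants whose weights are the n coordinate characters of the
   torus part gives generators of k(x_1, ..., x_(n+1)), in which H acts diagonally; H0
   acts trivially on s, so H acts on it through a character of finite order e, and
   faithfulness identifies the image of H with the kernel of the e-th power of the last
   coordinate.  Finally e is determined by the number of N-torsion points for all N. *)

Require Import Defs.
From HB Require Import structures.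
From mathcomp Require Import all_boot all_order all_algebra.
From mathcomp Require Import generic_quotient cyclic separable.
From mathcomp Require Import boolp ring zify.

Set Implicit Arguments.
Unset Strict Implicit.
Unset Printing Implicit Defensive.

Import Order.TTheory GRing.Theory Num.Theory.
Local Open Scope ring_scope.

(** The group enters only through a parametrization by tuples [t] with [t i ^+ d i = 1], where
    [d i = 0] stands for a factor G_m; characters are integer exponent vectors, determined only
    modulo the [d i]. Transcendence arguments are replaced by counting: monomials of bounded
    exponent are compared with a space that grows with a smaller power, because n+1 variables face
    only n free parameters. Two difficulties shape the middle. A disconnected group may permute the
    factors of a semi-invariant, so factorization is studied for the identity component, and the
    full group returns only through the stability of the minimal pencil. Moreover, what is proved of
    members of the pencil holds off finitely many parameters, so the exceptional sets are carried
    along as explicit lists. At the end e is recovered from abstract torsion, which serves both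
    isomorphisms of algebraic groups and conjugacy in the Cremona group, where only the group law is
    preserved a priori. *)

Local Notation "p %:F" := (FracField.tofrac p).

(** * Unique factorization *)

Definition divides (R : comNzRingType) (a b : R) : Prop := exists c, b = c * a.

Definition irreducible_elt (R : idomainType) (p : R) : Prop :=
  [/\ p != 0, p \isn't a GRing.unit &
      forall a b, p = a * b -> a \is a GRing.unit \/ b \is a GRing.unit].

Definition prime_elt (R : idomainType) (p : R) : Prop :=
  forall a b, divides p (a * b) -> divides p a \/ divides p b.

(** Factoriality without multisets of factors: the additive length [nu], zero exactly on units,
    makes factorizations terminate, and primality of irreducibles gives uniqueness. Both clauses
    pass from [R] to [{poly R}]. *)
Definition factorial_dom (R : idomainType) : Prop :=
  (exists nu : R -> nat,
     (forall a b, a != 0 -> b != 0 -> nu (a * b) = (nu a + nu b)%N) /\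
     (forall a, a != 0 -> (nu a == 0%N) = (a \is a GRing.unit))) /\
  (forall p : R, irreducible_elt p -> prime_elt p).

Section Divides.
Variable R : comNzRingType.
Implicit Types a b c : R.

Lemma dividesMl a b c : divides a b -> divides a (c * b).
Proof. by case=> d ->; exists (c * d); rewrite mulrA. Qed.

Lemma dividesMr a b c : divides a b -> divides a (b * c).
Proof. by rewrite mulrC; apply: dividesMl. Qed.

Lemma dividesD a b c : divides a b -> divides a c -> divides a (b + c).
Proof. by case=> d -> [e ->]; exists (d + e); rewrite mulrDl. Qed.

Lemma dividesB a b c : divides a b -> divides a c -> divides a (b - c).
Proof. by case=> d -> [e ->]; exists (d - e); rewrite mulrBl. Qed.

Lemma divides_refl a : divides a a.
Proof. by exists 1; rewrite mul1r. Qed.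

Lemma divides_trans a b c : divides a b -> divides b c -> divides a c.
Proof. by case=> d -> [e ->]; exists (e * d); rewrite mulrA. Qed.

End Divides.

Section GaussLemma.
Variable R : idomainType.

(** Gauss: if [c] divides a product, it divides the product of the leading coefficients, hence one
    of them; that leading term is subtracted and the total size drops. *)
Lemma prime_polyC (c : R) : c != 0 -> prime_elt c -> prime_elt c%:P.
Proof.
move=> c0 pc a b; move: {2}(size a + size b)%N (leqnn (size a + size b)) => N.
elim: N a b => [|N IH] a b.
  rewrite leqn0 addn_eq0 size_poly_eq0 => /andP[/eqP -> _] _.
  by left; exists 0; rewrite mul0r.
move=> sN dab.
have [a0|a0] := eqVneq a 0; first by left; exists 0; rewrite a0 mul0r.
have [b0|b0] := eqVneq b 0; first by right; exists 0; rewrite b0 mul0r.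
have trunc (f : {poly R}) : f != 0 -> (size (take_poly (size f).-1 f) < size f)%N.
  move=> f0; apply: leq_ltn_trans (size_take_poly _ _) _.
  by rewrite prednK // lt0n size_poly_eq0.
have decomp (f : {poly R}) : f != 0 ->
    f = take_poly (size f).-1 f + (lead_coef f)%:P * 'X^((size f).-1).
  move=> f0; apply/polyP=> i; rewrite coefD coef_take_poly coefCM coefXn lead_coefE.
  case: ltngtP => hi; rewrite ?mulr0 ?mulr1 ?addr0 ?add0r ?hi //.
  by rewrite nth_default // (leq_trans (leqSpred _)).
have step (f g : {poly R}) : f != 0 -> (size f + size g <= N.+1)%N ->
    divides c%:P (f * g) -> divides c (lead_coef f) ->
    divides c%:P f \/ divides c%:P g.
  move=> f0 sfg dfg [e le].
  have dl : divides c%:P ((lead_coef f)%:P * 'X^((size f).-1)).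
    by apply: dividesMr; exists e%:P; rewrite le polyCM.
  have [] := IH (take_poly (size f).-1 f) g.
  - by rewrite -ltnS; apply: leq_trans _ sfg; rewrite ltn_add2r trunc.
  - rewrite -[take_poly _ _](addrK ((lead_coef f)%:P * 'X^((size f).-1))).
    rewrite -(decomp f f0) mulrBl.
    by apply: dividesB => //; apply: dividesMr.
  - by move=> d1; left; rewrite (decomp f f0); apply: dividesD.
  - by right.
have [e he] := dab.
have : divides c (lead_coef a * lead_coef b).
  by exists (lead_coef e); rewrite -lead_coefM he lead_coefM lead_coefC.
case/pc => dl; first exact: step.
have [] := step b a b0 _ _ dl; rewrite 1?addnC 1?mulrC //; by [right|left].
Qed.

Lemma irreducible_divisor (nu : R -> nat) :
  (forall a b, a != 0 -> b != 0 -> nu (a * b) = (nu a + nu b)%N) ->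
  (forall a, a != 0 -> (nu a == 0%N) = (a \is a GRing.unit)) ->
  forall c, c != 0 -> c \isn't a GRing.unit ->
  exists2 p, irreducible_elt p & exists2 d, c = p * d & (nu d < nu c)%N.
Proof.
move=> nuM nu0 c; move: {2}(nu c) (leqnn (nu c)) => N.
elim: N c => [|N IH] c; first by rewrite leqn0 => + c0; rewrite nu0 // => ->.
move=> cN c0 cU; have [ic|nic] := EM (irreducible_elt c).
  exists c => //; exists 1; first by rewrite mulr1.
  have /eqP -> : nu 1 == 0%N by rewrite nu0 ?oner_neq0 ?unitr1.
  by rewrite lt0n nu0.
have [a [b [cab aU bU]]] :
    exists a b, [/\ c = a * b, a \isn't a GRing.unit & b \isn't a GRing.unit].
  apply: contrapT => nab; apply: nic; split=> // a b cab.
  have [|aU] := boolP (a \is a GRing.unit); first by left.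
  have [|bU] := boolP (b \is a GRing.unit); first by right.
  by case: nab; exists a, b.
have [a0 b0] : a != 0 /\ b != 0.
  by move: c0; rewrite cab mulf_eq0 negb_or => /andP[].
have na : (0 < nu a)%N by rewrite lt0n nu0.
have nb : (0 < nu b)%N by rewrite lt0n nu0.
have nc : nu c = (nu a + nu b)%N by rewrite cab nuM.
have [|p ip [d ad nd]] := IH a _ a0 aU; first by lia.
exists p => //; exists (d * b); first by rewrite cab ad mulrA.
have d0 : d != 0 by move: a0; rewrite ad mulf_eq0 negb_or => /andP[].
by rewrite nuM // nc ltn_add2r.
Qed.

Hypothesis facR : factorial_dom R.

(** The irreducible factors of [c] are removed one by one: each divides [w * p], hence [w], for it
    cannot divide [p], which is irreducible of positive degree. *)
Lemma gauss_strip (p : {poly R}) (c : R) b :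
  irreducible_elt p -> (1 < size p)%N -> c != 0 ->
  divides p (c%:P * b) -> divides p b.
Proof.
move=> [p0 pU pI] sp; have [[nu [nuM nu0]] irrp] := facR.
move: {2}(nu c) (leqnn (nu c)) => N.
elim: N c => [|N IH] c.
  rewrite leqn0 => + c0 [w hw]; rewrite nu0 // => cU.
  exists (c^-1%:P * w); rewrite -mulrA -hw mulrA -polyCM mulVr //.
  by rewrite mul1r.
move=> cN c0 [w hw]; have [cU|cU] := boolP (c \is a GRing.unit).
  exists (c^-1%:P * w); rewrite -mulrA -hw mulrA -polyCM mulVr //.
  by rewrite mul1r.
have [q iq [d cqd nd]] := irreducible_divisor nuM nu0 c0 cU.
have [q0 qU _] := iq.
have d0 : d != 0 by move: c0; rewrite cqd mulf_eq0 negb_or => /andP[].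
have : divides q%:P (w * p).
  by rewrite -hw cqd polyCM; exists (d%:P * b); ring.
case/(prime_polyC q0 (irrp q iq)) => [[w' hw']|[p' hp']].
  apply: (IH d) => //; first by rewrite -ltnS; apply: leq_trans nd _.
  exists w'; apply: (mulfI (_ : q%:P != 0)); first by rewrite polyC_eq0.
  have -> : q%:P * (d%:P * b) = c%:P * b by rewrite cqd polyCM; ring.
  by rewrite hw hw'; ring.
case: (pI _ _ hp'); rewrite poly_unitE => /andP[/eqP sU uU].
  move: sp p0; rewrite hp' => sp p0.
  have q'0 : p' != 0 by move: p0; rewrite mulf_eq0 negb_or => /andP[].
  by move: sp; rewrite mulrC size_Cmul // sU.
by move: uU; rewrite coefC eqxx (negbTE qU).
Qed.

(** Bezout over the fraction field with denominators cleared. A generator [d] of the ideal of [p]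
    and [a] is either a constant, and then [p] divides [b], or a multiple of [p], and then [p]
    divides [a]. *)
Lemma irreducible_poly_prime (p : {poly R}) : irreducible_elt p -> prime_elt p.
Proof.
move=> ip; have [p0 pU pI] := ip; have [[nu [nuM nu0]] irrp] := facR.
have [sp|sp] := leqP (size p) 1.
  have pC := size1_polyC sp; rewrite pC; set c := p`_0.
  have c0 : c != 0 by rewrite -polyC_eq0 -pC.
  apply: prime_polyC => //; apply: irrp; split=> //.
    by apply: contra pU => cU; rewrite pC poly_unitE coefC eqxx size_polyC c0.
  move=> a b cab; case: (pI a%:P b%:P); rewrite ?poly_unitE ?coefC ?eqxx.
  - by rewrite pC -polyCM -cab.
  - by case/andP; left.
  - by case/andP; right.
move=> a b dab.
(* An element of least size in the ideal generated by [p] and [a]: by pseudo-division it divides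
   every element of the ideal up to a nonzero constant. *)
pose I d := d != 0 /\ exists u v, d = u * p + v * a.
have [d [[d0 [u [v duv]]] dmin]] :
    exists d, I d /\ forall d', I d' -> (size d <= size d')%N.
  have exI : exists N, `[< exists2 d, I d & size d = N >].
    by exists (size p); apply/asboolP; exists p => //; split=> //; exists 1, 0; ring.
  case: (ex_minnP exI) => N /asboolP[d Id dN] Nmin; exists d; split=> // d' Id'.
  by rewrite dN; apply: Nmin; apply/asboolP; exists d'.
have red w : (exists u v, w = u * p + v * a) ->
    exists2 c, c != 0 & divides d (c%:P * w).
  case=> u' [v' wuv]; exists (lead_coef d ^+ scalp w d).
    by rewrite expf_neq0 ?lead_coef_eq0.
  have e := Pdiv.Idomain.divp_eq w d.
  have [m0|m0] := eqVneq (w %% d) 0; first by exists (w %/ d); rewrite mul_polyC e m0 addr0.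
  suff /dmin : I (w %% d) by rewrite leqNgt ltn_modp d0.
  split=> //; pose c := (lead_coef d ^+ scalp w d)%:P.
  exists (c * u' - (w %/ d) * u), (c * v' - (w %/ d) * v).
  have -> : w %% d = c * w - w %/ d * d by rewrite mul_polyC e addrC addKr.
  by rewrite {1}wuv {2}duv; ring.
(* Irreducible factors of [c] are cancelled against [q] or [d] until [c] is a unit; then
   irreducibility of [p] decides between its two factors. *)
have strip q c : c != 0 -> c%:P * p = q * d -> (size d <= 1)%N \/ divides p d.
  have d0' := d0; clear -d0' ip sp nuM nu0 irrp pI p0.
  move: {2}(nu c) (leqnn (nu c)) => N; elim: N c q d d0' => [|N IH] c q d d0.
    rewrite leqn0 => + c0; rewrite nu0 // => cU e.
    have {}e : p = (c^-1%:P * q) * d.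
      by rewrite -mulrA -e mulrA -polyCM mulVr // mul1r.
    case: (pI _ _ e) => [U|]; last by rewrite poly_unitE => /andP[/eqP -> _]; left.
    by right; exists (c^-1%:P * q)^-1; rewrite e mulrA mulVr // mul1r.
  move=> cN c0 e; have [cU|cU] := boolP (c \is a GRing.unit).
    apply: (IH c q) => //; have /eqP -> // : nu c == 0%N by rewrite nu0.
  have [r ir [c' cr nc']] := irreducible_divisor nuM nu0 c0 cU.
  have [r0 rU _] := ir.
  have c'0 : c' != 0 by move: c0; rewrite cr mulf_eq0 negb_or => /andP[].
  have rP0 : r%:P != 0 by rewrite polyC_eq0.
  have lN : (nu c' <= N)%N by rewrite -ltnS; apply: leq_trans nc' _.
  have : divides r%:P (q * d) by rewrite -e cr polyCM; exists (c'%:P * p); ring.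
  case/(prime_polyC r0 (irrp r ir)) => [[w hw]|[w hw]].
    apply: (IH c' w) => //; apply: (mulfI rP0).
    by rewrite mulrA -polyCM -cr e hw; ring.
  have w0 : w != 0 by move: d0; rewrite hw mulf_eq0 negb_or => /andP[].
  have [|sw|[z dw]] := IH c' q w w0 lN c'0.
  - by apply: (mulfI rP0); rewrite mulrA -polyCM -cr e hw; ring.
  - left; rewrite hw mulrC; apply: leq_trans (size_polyMleq _ _) _.
    by rewrite size_polyC r0 add1n.
  - by right; rewrite hw dw; exists (z * r%:P); ring.
have [c c0 [q e]] : exists2 c, c != 0 & divides d (c%:P * p).
  by apply: red; exists 1, 0; ring.
case: (strip _ _ c0 e) => [sd|pd].
  right; have dC := size1_polyC sd.
  apply: (@gauss_strip p d`_0) => //; first by rewrite -polyC_eq0 -dC.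
  rewrite -dC duv mulrDl; apply: dividesD; first by exists (u * b); ring.
  by rewrite -mulrA; apply: dividesMl.
left; have [c' c'0 da] : exists2 c, c != 0 & divides d (c%:P * a).
  by apply: red; exists 0, 1; ring.
by apply: (gauss_strip ip sp c'0); apply: divides_trans pd da.
Qed.

Lemma factorial_poly : factorial_dom {poly R}.
Proof.
split; last exact: irreducible_poly_prime.
have [[nu [nuM nu0]] irrp] := facR.
(* Degree plus length of the leading coefficient: both summands are additive, and they vanish
   together only on units. *)
exists (fun p : {poly R} => (size p).-1 + nu (lead_coef p))%N; split=> [a b a0 b0|a a0].
  rewrite size_mul // lead_coefM nuM ?lead_coef_eq0 //.
  by move: a0 b0; rewrite -!size_poly_gt0; lia.
rewrite addn_eq0 nu0 ?lead_coef_eq0 // poly_unitE.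
have -> : ((size a).-1 == 0%N) = (size a == 1%N).
  by move: a0; rewrite -size_poly_gt0; lia.
by case: eqP => // sa; rewrite lead_coefE sa.
Qed.

End GaussLemma.

Lemma factorial_iso (R S : idomainType) (f : {rmorphism R -> S}) :
  injective f -> (forall y, exists x, y = f x) ->
  factorial_dom S -> factorial_dom R.
Proof.
move=> fI fS [[nu [nuM nu0]] irrp].
have fU x : (f x \is a GRing.unit) = (x \is a GRing.unit).
  apply/idP/idP => [fxU|]; last exact: rmorph_unit.
  have /unitrP[y [h1 _]] := fxU; have [z hz] := fS y.
  apply/unitrP; exists z; rewrite [x * z]mulrC.
  by split; apply: fI; rewrite rmorphM rmorph1 -hz.
have f0 x : (f x != 0) = (x != 0) by rewrite -(rmorph0 f) (inj_eq fI).
split.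
  exists (nu \o f); split=> [a b a0 b0 /=|a a0 /=]; first by rewrite rmorphM nuM ?f0.
  by rewrite nu0 ?f0 ?fU.
move=> p [p0 pU pI] a b [c hc].
have : divides (f p) (f a * f b) by exists (f c); rewrite -!rmorphM hc.
have /irrp ip : irreducible_elt (f p).
  split; rewrite ?f0 ?fU // => x y; have [u ->] := fS x; have [v ->] := fS y.
  by rewrite -rmorphM => /fI/pI; rewrite !fU.
case/ip => -[y]; have [z ->] := fS y; rewrite -rmorphM => /fI e; by [left; exists z|right; exists z].
Qed.

Lemma rmorph_mpoly n (R : comNzRingType) (S : comNzRingType)
    (f g : {rmorphism {mpoly R[n]} -> S}) :
  (forall c, f c%:MP = g c%:MP) -> (forall i, f 'X_i = g 'X_i) -> f =1 g.
Proof.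
move=> fgC fgX p; rewrite (mpolyE p) !rmorph_sum; apply: eq_bigr => m _.
rewrite -mul_mpolyC !rmorphM fgC; congr (_ * _).
rewrite mpolyXE_id !rmorph_prod; apply: eq_bigr => i _.
by rewrite !rmorphXn fgX.
Qed.

Lemma factorial_mpoly (k : fieldType) n : factorial_dom {mpoly k[n]}.
Proof.
elim: n => [|n IH].
  have mC (p : {mpoly k[0]}) : p = (p@_0)%:MP.
    apply/mpolyP=> m; rewrite mcoeffC; have -> : m = 0%MM by apply/mnmP=> -[].
    by rewrite eqxx mulr1.
  have aU (a : {mpoly k[0]}) : a != 0 -> a \is a GRing.unit.
    move=> a0; apply/unitrP; exists ((a@_0)^-1)%:MP.
    have c0 : a@_0 != 0 by rewrite -(mpolyC_eq0 0) -mC.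
    by rewrite {2 3}(mC a) -!mpolyCM mulVf // mulfV.
  split=> [|p [p0 pU _]]; last by rewrite aU in pU.
  by exists (fun=> 0%N); split=> // a /aU ->.
(* The inverse of [muni], evaluating the outer variable at the last variable; it serves to prove
   [muni] injective. *)
pose psi : {rmorphism {poly {mpoly k[n]}} -> {mpoly k[n.+1]}} :=
  horner_morph (fun x => mulrC 'X_ord_max (@mwiden n k x)).
have mX : muni ('X_ord_max : {mpoly k[n.+1]}) = 'X.
  rewrite muniE msuppX big_seq1 mcoeffX eqxx scale1r mnm1E eqxx expr1.
  have -> : [multinom U_(ord_max)%MM (widen_ord (leqnSn n) i) | i < n] = 0%MM.
    by apply/mnmP=> i; rewrite mnmE mnm1E mnm0E -val_eqE /= gtn_eqF.
  by rewrite mpolyX0 scale1r.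
have mwX (i : 'I_n) : muni ('X_(widen_ord (leqnSn n) i) : {mpoly k[n.+1]}) = ('X_i)%:P.
  rewrite muniE msuppX big_seq1 mcoeffX eqxx scale1r mnm1E -val_eqE /=.
  rewrite ltn_eqF // expr0 alg_polyC; congr ('X_[_])%:P.
  by apply/mnmP=> j; rewrite mnmE !mnm1E.
have mw c : muni (mwiden c) = c%:P :> {poly {mpoly k[n]}}.
  apply: (@rmorph_mpoly n k {poly {mpoly k[n]}} (@muni n k \o @mwiden n k) polyC) => [d|i] /=.
    by rewrite mwidenC muniC.
  by rewrite mwidenX mnmwiden1 mwX.
have psiX : psi 'X = 'X_ord_max by rewrite /psi /= /horner_morph map_polyX hornerX.
have psiC c : psi c%:P = mwiden c by rewrite /psi /= /horner_morph map_polyC hornerC.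
have K : forall p, psi (muni p) = p.
  apply: (@rmorph_mpoly n.+1 k {mpoly k[n.+1]} (psi \o @muni n k) idfun) => [c|i] /=.
    by rewrite muniC psiC mwidenC.
  have [lt_in|] := ltnP i n.
    have -> : i = widen_ord (leqnSn n) (Ordinal lt_in) by apply: val_inj.
    by rewrite mwX psiC mwidenX mnmwiden1.
  move=> le_ni; have -> : i = ord_max by apply: val_inj => /=; have := ltn_ord i; lia.
  by rewrite mX psiX.
apply: (@factorial_iso {mpoly k[n.+1]} {poly {mpoly k[n]}} (@muni n k)).
- exact: can_inj K.
- elim/poly_ind => [|p c [q hq]]; first by exists 0; rewrite /= muni0.
  by exists (q * 'X_ord_max + mwiden c); rewrite /= muniD muniM mX mw -hq.
- exact: factorial_poly.
Qed.

(** * Integer lattices and characters *)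

Section IntegerLattices.

Definition is_lattice m (L : 'rV[int]_m -> Prop) : Prop :=
  L 0 /\ forall a b, L a -> L b -> L (a - b).

Lemma lattice_opp m (L : 'rV[int]_m -> Prop) a : is_lattice L -> L a -> L (- a).
Proof. by case=> L0 LB La; rewrite -[- a]add0r; apply: LB. Qed.

Lemma lattice_add m (L : 'rV[int]_m -> Prop) a b :
  is_lattice L -> L a -> L b -> L (a + b).
Proof.
by move=> LL La Lb; rewrite -[b]opprK; apply: LL.2 => //; apply: lattice_opp.
Qed.

Lemma lattice_muln m (L : 'rV[int]_m -> Prop) a (n : nat) :
  is_lattice L -> L a -> L (a *+ n).
Proof.
move=> LL La; elim: n => [|n IH]; first by rewrite mulr0n; apply: LL.1.
by rewrite mulrS; apply: lattice_add.
Qed.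

Lemma lattice_scale m (L : 'rV[int]_m -> Prop) (c : int) a :
  is_lattice L -> L a -> L (c *: a).
Proof.
move=> LL La; case: c => n; first by rewrite -[Posz n]natz scaler_nat; apply: lattice_muln.
rewrite NegzE scaleNr -[Posz _]natz scaler_nat.
apply: lattice_opp => //; exact: lattice_muln.
Qed.

(** The matrix is square, zero rows being allowed, so that no rank has to be tracked. Induction on
    [m]: the first coordinates form an ideal of the integers, generated by that of some [w], and
    what remains has first coordinate zero. *)
Lemma lattice_basis m (L : 'rV[int]_m -> Prop) : is_lattice L ->
  exists M : 'M[int]_m, forall a, L a <-> exists u, a = u *m M.
Proof.
elim: m L => [|m IH] L LL.
  exists 0 => a; split=> _; first by exists 0; apply/rowP; case.
  have -> : a = 0 by apply/rowP; case.
  exact: LL.1.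
move: L LL; rewrite -[m.+1]/(1 + m)%N => L LL.
pose h (a : 'rV[int]_(1 + m)) : int := a 0 (lshift m 0).
have [w Lw wmin] : exists2 w, L w & forall a, L a -> (h w %| h a)%Z.
  have [all0|nall0] := EM (forall a, L a -> h a = 0).
    by exists 0; [exact: LL.1 | move=> a /all0 ->; rewrite dvdz0].
  have exN : exists N, `[< exists a, [/\ L a, h a != 0 & `|h a|%N = N] >].
    have [a /not_implyP[La /eqP a0]] := (iffRL (existsNP _)) nall0.
    by exists `|h a|%N; apply/asboolP; exists a.
  case: (ex_minnP exN) => N /asboolP[w [Lw w0 wN]] Nmin; exists w => // a La.
  apply/dvdz_mod0P; apply: contrapT => /eqP r0; pose b := a - (h a %/ h w)%Z *: w.
  have b0 : h b = (h a %% h w)%Z by rewrite /b /h !mxE /modz.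
  have : (N <= `|h b|)%N.
    apply: Nmin; apply/asboolP; exists b; split=> //; last by rewrite b0.
    by apply: LL.2 => //; apply: lattice_scale.
  rewrite b0 leqNgt -wN; have := ltz_mod (h a) w0; have := modz_ge0 (h a) w0.
  lia.
pose L' (b : 'rV_m) := L (row_mx 0 b).
have LL' : is_lattice L'.
  split; first by rewrite /L' row_mx0; exact: LL.1.
  move=> a b La Lb; rewrite /L'.
  have -> : row_mx 0 (a - b) = row_mx 0 a - row_mx 0 b :> 'rV_(1 + m).
    by rewrite opp_row_mx add_row_mx oppr0 addr0.
  exact: LL.2.
have [M' hM'] := IH L' LL'.
exists (col_mx w (row_mx 0 M')) => a; split.
  move=> La; have /dvdzP[q hq] := wmin a La.
  pose b := a - q *: w.
  have Lb : L b by apply: LL.2 => //; apply: lattice_scale.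
  have bE : b = row_mx 0 (rsubmx b).
    rewrite -{1}[b]hsubmxK; congr row_mx; apply/rowP=> i; rewrite ord1 !mxE.
    by rewrite -/(h a) hq subrr.
  have /hM'[u hu] : L' (rsubmx b) by rewrite /L' -bE.
  exists (row_mx q%:M u); rewrite mul_row_col mul_scalar_mx mul_mx_row mulmx0 -hu.
  by rewrite -bE addrC subrK.
case=> u ->; rewrite -[u]hsubmxK mul_row_col mul_mx_row mulmx0.
apply: lattice_add => //; last by apply/hM'; exists (rsubmx u).
rewrite [lsubmx u]mx11_scalar mul_scalar_mx; exact: lattice_scale.
Qed.

(** An elementary divisor [d i = 0] forces the i-th new coordinate to vanish, as only 0 is a
    multiple of 0. The convention that exponent 0 marks a factor G_m starts here. *)
Lemma lattice_smith m (L : 'rV[int]_m -> Prop) : is_lattice L ->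
  exists2 U : 'M[int]_m, U \in unitmx & exists d : 'I_m -> nat,
  forall a, L a <-> forall i, ((d i)%:Z %| (a *m U) 0%R i)%Z.
Proof.
move=> LL; have [M hM] := lattice_basis LL.
have [A Au [R Ru [d _ hd]]] := int_Smith_normal_form M.
exists (invmx R); rewrite ?unitmx_inv //; exists (fun i => absz d`_i) => a.
set D := \matrix_(i, j) _ in hd.
have uD (u : 'rV_m) i : (u *m D) 0 i = u 0 i * d`_i.
  rewrite mxE (bigD1 i) //= big1 ?addr0 => [|j ji]; rewrite mxE ?eqxx ?mulr1n //.
  by rewrite val_eqE (negbTE ji) mulr0n mulr0.
rewrite hM; split.
  case=> u -> i; rewrite hd -!mulmxA mulmxV // mulmx1 mulmxA uD.
  by rewrite dvdzE absz_id abszM dvdn_mull.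
move=> H.
have q i : {q | (a *m invmx R) 0 i = q * d`_i}.
  by apply: cid; apply/dvdzP; have := H i; rewrite !dvdzE absz_id.
exists ((\row_i sval (q i)) *m invmx A); rewrite hd !mulmxA mulmxKV //.
have Ru' : invmx R \in unitmx by rewrite unitmx_inv.
apply: (can_inj (mulmxK Ru')).
rewrite mulmxK //; apply/rowP=> i; rewrite uD mxE; exact: (svalP (q i)).
Qed.

End IntegerLattices.

Section RootsOfUnity.
Variables (k : closedFieldType) (char_k : [pchar k] =i pred0).

Lemma natr_neq0 n : (0 < n)%N -> n%:R != 0 :> k.
Proof. by move=> n0; rewrite ((iffLR (@pcharf0P k)) char_k) -lt0n. Qed.

Lemma natr_inj (x y : nat) : x%:R = y%:R :> k -> x = y.
Proof.
have lt_neq (a b : nat) : (a < b)%N -> a%:R != b%:R :> k.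
  move=> ab; rewrite eq_sym -subr_eq0 -natrB; last exact: ltnW.
  by apply: natr_neq0; rewrite subn_gt0.
move=> e; have [xy|yx|//] := ltngtP x y.
  by have := lt_neq _ _ xy; rewrite e eqxx.
by have := lt_neq _ _ yx; rewrite e eqxx.
Qed.

Lemma prim_root_exists n : (0 < n)%N -> exists z : k, n.-primitive_root z.
Proof.
move=> n0; pose p : {poly k} := 'X^n - 1.
have [r hr] := closed_field_poly_normal p.
have pm : p \is monic by rewrite monicE lead_coefDl ?lead_coefXn // size_polyXn size_polyN size_poly1.
have p0 : p != 0 by apply: monic_neq0.
move: hr; rewrite (monicP pm) scale1r => hr.
have sr : size r = n.
  have : size p = n.+1 by rewrite size_polyDl ?size_polyXn // size_polyN size_poly1.
  by rewrite hr size_prod_XsubC => -[].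
have ur : uniq r.
  rewrite -separable_prod_XsubC -hr unlock derivB derivXn derivC subr0.
  (* [X ^ n - 1] is coprime to its derivative: [X / n] times the derivative, minus [X ^ n - 1],
     equals 1. *)
  apply/Bezout_coprimepP; exists (-1, n%:R^-1 *: 'X) => /=.
  rewrite -scaler_nat -scalerAl -scalerAr scalerA mulVf ?natr_neq0 // scale1r.
  by rewrite -exprS prednK // mulN1r opprB subrK eqpxx.
have : has n.-primitive_root r.
  apply: has_prim_root => //; last by rewrite sr.
  apply/allP=> z zr; have : root p z by rewrite hr root_prod_XsubC.
  by [].
by case/hasP => z _; exists z.
Qed.

(** The exponent 0 is included: there every nonzero [t] solves the equation, and 2 serves. *)
Lemma root_of_unity_neq1 n : n != 1%N -> exists2 t : k, t != 0 & t ^+ n = 1 /\ t != 1.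
Proof.
case: n => [|[|n]] // _.
  exists 2%:R; first exact: natr_neq0.
  split; rewrite ?expr0 // -subr_eq0; have -> : 2%:R - 1 = 1 :> k by ring.
  exact: oner_neq0.
have [z zp] := @prim_root_exists n.+2 isT.
exists z; first by rewrite (prim_root_eq0 zp).
split; first exact: prim_expr_order zp.
by have := prim_order_dvd zp 1; rewrite expr1 => <-.
Qed.

End RootsOfUnity.

(** * Independence of characters *)

Definition is_subspace (k : fieldType) (V : lmodType k) (W : V -> Prop) : Prop :=
  [/\ W 0, forall x y, W x -> W y -> W (x + y) & forall c x, W x -> W (c *: x)].

Lemma subspace_opp (k : fieldType) (V : lmodType k) (W : V -> Prop) x :
  is_subspace W -> W x -> W (- x).
Proof. by case=> _ _ WZ Wx; rewrite -scaleN1r; apply: WZ. Qed.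

Lemma subspace_sum (k : fieldType) (V : lmodType k) (W : V -> Prop)
    (I : eqType) (r : seq I) (F : I -> V) :
  is_subspace W -> {in r, forall i, W (F i)} -> W (\sum_(i <- r) F i).
Proof.
case=> W0 WD _ WF; rewrite big_seq; apply: (big_ind W) => //.
Qed.

Section Dedekind.
Variables (k : fieldType) (V : lmodType k) (W : V -> Prop) (Pt : Type) (op : Pt -> Pt -> Pt).
Variables (S : Pt -> Prop) (e : Pt) (I : eqType) (chi : I -> Pt -> k).
Hypothesis subW : is_subspace W.
Hypothesis Sop : forall t u, S t -> S u -> S (op t u).
Hypothesis Se : S e.
Hypothesis chi_op : forall i t u, S t -> S u -> chi i (op t u) = chi i t * chi i u.
Hypothesis chi_e : forall i, chi i e = 1.

(** Dedekind's argument modulo a subspace [W]: subtracting [chi i u] times the relation at [t] from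
    the relation at the product removes the term of [i]. With [W] zero this is the usual
    independence; a larger [W] shows that weight components of a vector stay in a stable
    subspace. *)
Lemma dedekind_independence (s : seq I) (v : I -> V) :
  uniq s ->
  {in s &, forall i j, i != j -> exists2 t, S t & chi i t != chi j t} ->
  (forall t, S t -> W (\sum_(i <- s) chi i t *: v i)) ->
  {in s, forall i, W (v i)}.
Proof.
have [W0 WD WZ] := subW.
elim: s v => [|i s IH] v //= /andP[ni us] dist sumW.
have vsW : {in s, forall j, W (v j)}.
  move=> j js; have ij : i != j by apply: contraNneq ni => ->.
  have [u Su uij] := dist i j (mem_head _ _) (mem_behead (s := i :: s) js) ij.
  suff /(_ _ js)/(WZ (chi j u - chi i u)^-1) :
      {in s, forall j, W ((chi j u - chi i u) *: v j)}.
    by rewrite scalerA mulVf ?scale1r // subr_eq0 eq_sym.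
  apply: (IH (fun j => (chi j u - chi i u) *: v j)) => //.
    by move=> a b a_s b_s; apply: dist; rewrite inE ?a_s ?b_s orbT.
  move=> t St; have := WD _ _ (sumW _ (Sop St Su)) (WZ (- chi i u) _ (sumW _ St)).
  rewrite !big_cons chi_op // scalerDr scalerA addrACA -scalerDl.
  have -> : chi i t * chi i u + - chi i u * chi i t = 0 by ring.
  rewrite scale0r add0r scaler_sumr -big_split /=; congr W.
  by apply: eq_bigr => l _; rewrite chi_op // !scalerA -scalerDl; congr (_ *: _); ring.
move=> j; rewrite inE => /orP[/eqP ->|]; last exact: vsW.
have := WD _ _ (sumW _ Se) (subspace_opp subW (subspace_sum subW vsW)).
rewrite big_cons chi_e scale1r.
by under eq_bigr do rewrite chi_e scale1r; rewrite addrK.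
Qed.

End Dedekind.

Lemma zero_subspace (k : fieldType) (V : lmodType k) : is_subspace (fun x : V => x = 0).
Proof. by split=> // [x y -> ->|c x ->]; rewrite ?addr0 ?scaler0. Qed.

Section LaurentCharacters.
Variables (k : fieldType) (m : nat).
Implicit Types (t u : 'I_m -> k) (a b : 'rV[int]_m).

Definition chr t a : k := \prod_i t i ^ a 0 i.

Definition torus_pt t : Prop := forall i, t i != 0.

Lemma chr_neq0 t a : torus_pt t -> chr t a != 0.
Proof. by move=> nz; apply/prodf_neq0 => i _; rewrite expfz_neq0. Qed.

Lemma chr0 t : chr t 0 = 1.
Proof. by rewrite /chr big1 // => i _; rewrite mxE expr0z. Qed.

Lemma chrD t a b : torus_pt t -> chr t (a + b) = chr t a * chr t b.
Proof.
move=> nz; rewrite /chr -big_split; apply: eq_bigr => i _.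
by rewrite mxE expfzDr.
Qed.

Lemma chrN t a : chr t (- a) = (chr t a)^-1.
Proof. by rewrite /chr -prodfV; apply: eq_bigr => i _; rewrite mxE invr_expz. Qed.

Lemma chrB t a b : torus_pt t -> chr t (a - b) = chr t a / chr t b.
Proof. by move=> nz; rewrite chrD // chrN. Qed.

Lemma chrZ t c a : torus_pt t -> chr t (c *: a) = chr t a ^ c.
Proof.
move=> nz; rewrite /chr; elim/big_rec2: _ => [|i y x _ ->]; first by rewrite exp1rz.
by rewrite mxE expfzMl exprz_exp [c * _]mulrC.
Qed.

Lemma chr_sum t I (r : seq I) (P : pred I) F : torus_pt t ->
  chr t (\sum_(i <- r | P i) F i) = \prod_(i <- r | P i) chr t (F i).
Proof.
by move=> nz; apply: (big_morph (chr t)) => [a b|]; [exact: chrD | exact: chr0].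
Qed.

Lemma chr1 a : chr (fun=> 1) a = 1.
Proof. by rewrite /chr big1 // => i _; rewrite exp1rz. Qed.

Lemma chrM t u a : chr (fun i => t i * u i) a = chr t a * chr u a.
Proof. by rewrite /chr -big_split; apply: eq_bigr => i _; rewrite expfzMl. Qed.

Lemma chr_delta t i : chr t (delta_mx 0 i) = t i.
Proof.
rewrite /chr (bigD1 i) //= mxE !eqxx expr1z big1 ?mulr1 // => j ji.
by rewrite mxE (negbTE ji) andbF expr0z.
Qed.

Lemma torus_pt1 : torus_pt (fun=> 1).
Proof. by move=> i; apply: oner_neq0. Qed.

Lemma torus_ptM t u : torus_pt t -> torus_pt u -> torus_pt (fun i => t i * u i).
Proof. by move=> nt nu i; rewrite mulf_neq0. Qed.

Lemma eq_chr t u a : t =1 u -> chr t a = chr u a.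
Proof. by move=> tu; apply: eq_bigr => i _; rewrite tu. Qed.

(* Collecting the exponents that define the same character on [S]; the
   identity persists at every point where these characters still agree. *)
Lemma merge_characters (V : lmodType k) (S : ('I_m -> k) -> Prop)
    (l : seq ('rV[int]_m * V)) :
  exists s v, [/\ uniq s, {subset s <= map fst l},
    {in s &, forall a b, a != b -> exists2 t, S t & chr t a != chr t b} &
    forall t, (forall a b, (forall u, S u -> chr u a = chr u b) -> chr t a = chr t b) ->
      \sum_(x <- l) chr t x.1 *: x.2 = \sum_(a <- s) chr t a *: v a].
Proof.
elim: l => [|[a x] l [s [v [us ss dist hs]]]].
  by exists [::], (fun=> 0); split=> // t _; rewrite !big_nil.
have [[b bs ab]|nex] := EM (exists2 b, b \in s & forall u, S u -> chr u a = chr u b).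
  exists s, (fun c => if c == b then v c + x else v c); split=> //.
    by move=> c cs; rewrite inE ss ?orbT.
  move=> t ht; rewrite big_cons hs //= (ht _ _ ab) !(bigD1_seq b) //= eqxx.
  rewrite scalerDr addrA [chr t b *: x + _]addrC; congr (_ + _).
  by apply: eq_bigr => c /negbTE ->.
have as_ : a \notin s by apply/negP => as_; apply: nex; exists a.
have dista b : b \in s -> exists2 t, S t & chr t a != chr t b.
  move=> bs; apply: contrapT => nt; apply: nex; exists b => // u Su.
  by apply/eqP; apply: contrapT => /negP ne; apply: nt; exists u.
exists (a :: s), (fun c => if c == a then x else v c); split.
- by rewrite /= as_ us.
- by move=> c; rewrite !inE => /orP[->//|/ss ->]; rewrite orbT.
- move=> b c; rewrite !inE => /orP[/eqP ->|bs] /orP[/eqP ->|cs].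
  + by rewrite eqxx.
  + by move=> _; apply: dista.
  + by move=> _; have [t St] := dista b bs; exists t => //; rewrite eq_sym.
  + exact: dist.
- move=> t ht; rewrite !big_cons eqxx /= hs //; congr (_ + _).
  rewrite big_seq [RHS]big_seq; apply: eq_bigr => c cs.
  by case: eqP as_ => // <-; rewrite cs.
Qed.

Lemma chr_independence_mod (V : lmodType k) (W : V -> Prop) (S : ('I_m -> k) -> Prop)
    (s : seq 'rV[int]_m) (v : 'rV[int]_m -> V) :
  is_subspace W -> S (fun=> 1) -> (forall t u, S t -> S u -> S (fun i => t i * u i)) ->
  uniq s ->
  {in s &, forall a b, a != b -> exists2 t, S t & chr t a != chr t b} ->
  (forall t, S t -> W (\sum_(a <- s) chr t a *: v a)) ->
  {in s, forall a, W (v a)}.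
Proof.
move=> subW S1 SM us dist; apply: (@dedekind_independence _ _ W _
   (fun t u i => t i * u i) S (fun=> 1) _ (fun a t => chr t a)) => //.
- by move=> a t u _ _; rewrite chrM.
- by move=> a; rewrite chr1.
Qed.

Lemma chr_independence (V : lmodType k) (S : ('I_m -> k) -> Prop)
    (s : seq 'rV[int]_m) (v : 'rV[int]_m -> V) :
  S (fun=> 1) -> (forall t u, S t -> S u -> S (fun i => t i * u i)) ->
  uniq s ->
  {in s &, forall a b, a != b -> exists2 t, S t & chr t a != chr t b} ->
  (forall t, S t -> \sum_(a <- s) chr t a *: v a = 0) ->
  {in s, forall a, v a = 0}.
Proof. exact: (chr_independence_mod (@zero_subspace k V)). Qed.

End LaurentCharacters.

Section CharZero.
Variables (k : closedFieldType) (char_k : [pchar k] =i pred0).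

Lemma expr2_inj (a b : nat) : 2%:R ^+ a = 2%:R ^+ b :> k -> a = b.
Proof.
rewrite -!natrX => /(natr_inj char_k)/eqP.
by rewrite eqn_exp2l // => /eqP.
Qed.

(** The element 2 has infinite order because the characteristic is 0, so evaluation at 2 separates
    integer exponents; it is the test value in the comparisons of weights below. *)
Lemma exprz2_inj (a b : int) : 2%:R ^ a = 2%:R ^ b :> k -> a = b.
Proof.
have n2 : 2%:R != 0 :> k by apply: natr_neq0.
move=> e; pose c : int := (`|a| + `|b|)%:Z.
have : 2%:R ^ (a + c) = 2%:R ^ (b + c) :> k by rewrite !expfzDr // e.
have [x hx] : exists n : nat, a + c = n%:Z by exists (absz (a + c)); rewrite /c; lia.
have [y hy] : exists n : nat, b + c = n%:Z by exists (absz (b + c)); rewrite /c; lia.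
by rewrite hx hy -!exprnP => /expr2_inj xy; apply: (addIr c); rewrite hx hy xy.
Qed.

(** Distinct monomials are distinct characters of the torus of points with nonzero coordinates, so
    Dedekind independence annihilates every coefficient. *)
Lemma mpoly_vanish n (p : {mpoly k[n]}) :
  (forall x : 'I_n -> k, (forall i, x i != 0) -> p.@[x] = 0) -> p = 0.
Proof.
move=> p0; apply/mpolyP => m; rewrite mcoeff0.
have [ms|] := boolP (m \in msupp p); last by move/memN_msupp_eq0.
have := @dedekind_independence k k^o (fun x => x = 0) ('I_n -> k) (fun t u i => t i * u i)
   (fun x => forall i, x i != 0) (fun=> 1) _
   (fun (g : 'X_{1..n}) x => \prod_i x i ^+ g i) _ _ _ _ _ (msupp p) (fun g => p@_g).
apply=> //.
- exact: zero_subspace.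
- by move=> t u t0 u0 i; rewrite mulf_neq0.
- by move=> i; apply: oner_neq0.
- by move=> g t u _ _; rewrite -big_split; apply: eq_bigr => i _; rewrite exprMn.
- by move=> g; rewrite big1 // => i _; rewrite expr1n.
- move=> g h _ _ gh.
  have [i gi] : exists i, g i != h i.
    apply: contrapT => nex; move/eqP: gh; apply; apply/mnmP => i.
    by apply/eqP; apply: contrapT => /negP ne; apply: nex; exists i.
  have n2 : 2%:R != 0 :> k by apply: natr_neq0.
  exists (fun j => if j == i then 2%:R else 1).
    by move=> j; case: ifP => // _; apply: oner_neq0.
  have ev (f : 'X_{1..n}) : \prod_j (if j == i then 2%:R else 1 : k) ^+ f j = 2%:R ^+ f i.
    rewrite (bigD1 i) //= eqxx big1 ?mulr1 // => j /negbTE ->.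
    by rewrite expr1n.
  by rewrite !ev; apply: contra gi => /eqP/expr2_inj ->.
- by move=> x x0; rewrite -[RHS](p0 x) // mevalE; apply: eq_bigr => g _; rewrite /GRing.scale /= mulrC.
Qed.

End CharZero.

(** * Coordinates of diagonalizable groups *)

Section Laurent.
Variables (k : fieldType) (V : comAlgType k).

(** Coefficients are taken in an algebra [V] so that one notion serves scalar functions on the group
    and the polynomials through which it acts. *)
Definition laurent m (S : ('I_m -> k) -> Prop) (f : ('I_m -> k) -> V) : Prop :=
  exists l : seq ('rV[int]_m * V),
    forall t, S t -> f t = \sum_(x <- l) chr t x.1 *: x.2.

Variables (m : nat) (S : ('I_m -> k) -> Prop).
Hypothesis S_torus : forall t, S t -> torus_pt t.

Lemma eq_laurent f g : (forall t, S t -> f t = g t) -> laurent S f -> laurent S g.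
Proof. by move=> fg [l hl]; exists l => t St; rewrite -fg // hl. Qed.

Lemma laurent_const c : laurent S (fun=> c).
Proof. by exists [:: (0, c)] => t _; rewrite big_seq1 chr0 scale1r. Qed.

Lemma laurent_chr a c : laurent S (fun t => chr t a *: c).
Proof. by exists [:: (a, c)] => t _; rewrite big_seq1. Qed.

Lemma laurentD f g : laurent S f -> laurent S g -> laurent S (fun t => f t + g t).
Proof.
move=> [l hl] [l' hl']; exists (l ++ l') => t St.
by rewrite big_cat hl // hl'.
Qed.

Lemma laurentM f g : laurent S f -> laurent S g -> laurent S (fun t => f t * g t).
Proof.
move=> [l hl] [l' hl']; exists [seq (x.1 + y.1, x.2 * y.2) | x <- l, y <- l'] => t St.
rewrite hl // hl' // big_allpairs_dep mulr_suml; apply: eq_bigr => x _.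
rewrite mulr_sumr; apply: eq_bigr => y _ /=.
by rewrite chrD -1?scalerAl -1?scalerAr ?scalerA //; apply: S_torus.
Qed.

Lemma laurent_sum I (r : seq I) (P : pred I) (F : I -> ('I_m -> k) -> V) :
  (forall i, P i -> laurent S (F i)) -> laurent S (fun t => \sum_(i <- r | P i) F i t).
Proof.
move=> LF; elim: r => [|i r IH].
  by apply: eq_laurent (laurent_const 0) => t _; rewrite big_nil.
have [Pi|nPi] := boolP (P i).
  by apply: eq_laurent (laurentD (LF i Pi) IH) => t _; rewrite big_cons Pi.
by apply: eq_laurent IH => t _; rewrite big_cons (negbTE nPi).
Qed.

Lemma laurent_prod I (r : seq I) (P : pred I) (F : I -> ('I_m -> k) -> V) :
  (forall i, P i -> laurent S (F i)) -> laurent S (fun t => \prod_(i <- r | P i) F i t).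
Proof.
move=> LF; elim: r => [|i r IH].
  by apply: eq_laurent (laurent_const 1) => t _; rewrite big_nil.
have [Pi|nPi] := boolP (P i).
  by apply: eq_laurent (laurentM (LF i Pi) IH) => t _; rewrite big_cons Pi.
by apply: eq_laurent IH => t _; rewrite big_cons (negbTE nPi).
Qed.

Lemma laurentX f n : laurent S f -> laurent S (fun t => f t ^+ n).
Proof.
move=> Lf; apply: eq_laurent (laurent_prod (index_enum 'I_n) (P := xpredT) (fun _ _ => Lf)).
by move=> t _; rewrite prodr_const card_ord.
Qed.

Lemma laurent_mmap n (f : {rmorphism k -> V}) (h : ('I_m -> k) -> 'I_n -> V) (p : {mpoly k[n]}) :
  (forall i, laurent S (fun t => h t i)) -> laurent S (fun t => mmap f (h t) p).
Proof.
move=> Lh; apply: laurent_sum => g _; apply: laurentM; first exact: laurent_const.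
by apply: laurent_prod => i _; apply: laurentX.
Qed.

Lemma laurent_det n (A : ('I_m -> k) -> 'M[V]_n) :
  (forall i j, laurent S (fun t => A t i j)) -> laurent S (fun t => \det (A t)).
Proof.
move=> LA; apply: laurent_sum => s _; apply: laurentM; first exact: laurent_const.
by apply: laurent_prod => i _.
Qed.

Lemma laurent_subst r (S' : ('I_r -> k) -> Prop) (W : 'M[int]_(m, r)) f :
  (forall t, S' t -> torus_pt t) ->
  (forall t, S' t -> S (fun j => chr t (row j W))) ->
  laurent S f -> laurent S' (fun t => f (fun j => chr t (row j W))).
Proof.
move=> tS' S'S [l hl]; exists [seq (x.1 *m W, x.2) | x <- l] => t St.
rewrite hl ?big_map; last exact: S'S.
apply: eq_bigr => x _ /=; congr (_ *: _).
rewrite mulmx_sum_row chr_sum; last exact: tS'.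
by apply: eq_bigr => i _; rewrite chrZ //; apply: tS'.
Qed.

End Laurent.

Lemma chr_mulmx (k : fieldType) m r (t : 'I_r -> k) a (W : 'M[int]_(m, r)) : torus_pt t ->
  chr (fun j => chr t (row j W)) a = chr t (a *m W).
Proof.
move=> nt; rewrite mulmx_sum_row chr_sum //.
by apply: eq_bigr => i _; rewrite chrZ.
Qed.

Section RegularFunctions.
Variables (k : closedFieldType) (G : alg_group k).

Definition regular (h : 'M[k]_(ag_size G) -> k) : Prop :=
  exists p : {mpoly k[_]}, forall g, G g -> h g = p.@[gl_coords g ord0].

Lemma eq_regular f h : (forall g, G g -> f g = h g) -> regular f -> regular h.
Proof. by move=> fh [p hp]; exists p => g Gg; rewrite -fh // hp. Qed.

Lemma regular_const c : regular (fun=> c).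
Proof. by exists c%:MP => g _; rewrite mevalC. Qed.

Lemma regular_coord j : regular (fun g => gl_coords g ord0 j).
Proof. by exists 'X_j => g _; rewrite mevalXU. Qed.

Lemma regular_entry i j : regular (fun g => g i j).
Proof.
apply: eq_regular (regular_coord (lshift 1 (mxvec_index i j))) => g _.
by rewrite /gl_coords row_mxEl mxvecE.
Qed.

Lemma regular_invdet : regular (fun g => (\det g)^-1).
Proof.
apply: eq_regular (regular_coord (rshift _ ord0)) => g _.
by rewrite /gl_coords row_mxEr mxE eqxx mulr1n.
Qed.

Lemma regularD f h : regular f -> regular h -> regular (fun g => f g + h g).
Proof. by move=> [p hp] [q hq]; exists (p + q) => g Gg; rewrite mevalD hp // hq. Qed.

Lemma regularM f h : regular f -> regular h -> regular (fun g => f g * h g).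
Proof. by move=> [p hp] [q hq]; exists (p * q) => g Gg; rewrite mevalM hp // hq. Qed.

Lemma regular_sum I (r : seq I) (P : pred I) F :
  (forall i, P i -> regular (F i)) -> regular (fun g => \sum_(i <- r | P i) F i g).
Proof.
move=> LF; elim: r => [|i r IH].
  by apply: eq_regular (regular_const 0) => t _; rewrite big_nil.
have [Pi|nPi] := boolP (P i).
  by apply: eq_regular (regularD (LF i Pi) IH) => t _; rewrite big_cons Pi.
by apply: eq_regular IH => t _; rewrite big_cons (negbTE nPi).
Qed.

Lemma regular_prod I (r : seq I) (P : pred I) F :
  (forall i, P i -> regular (F i)) -> regular (fun g => \prod_(i <- r | P i) F i g).
Proof.
move=> LF; elim: r => [|i r IH].
  by apply: eq_regular (regular_const 1) => t _; rewrite big_nil.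
have [Pi|nPi] := boolP (P i).
  by apply: eq_regular (regularM (LF i Pi) IH) => t _; rewrite big_cons Pi.
by apply: eq_regular IH => t _; rewrite big_cons (negbTE nPi).
Qed.

Lemma regularX f n : regular f -> regular (fun g => f g ^+ n).
Proof.
move=> Lf; apply: eq_regular (regular_prod (index_enum 'I_n) (P := xpredT) (fun _ _ => Lf)).
by move=> t _; rewrite prodr_const card_ord.
Qed.

Lemma regular_det n (A : 'M[k]_(ag_size G) -> 'M[k]_n) :
  (forall i j, regular (fun g => A g i j)) -> regular (fun g => \det (A g)).
Proof.
move=> LA; apply: regular_sum => s _; apply: regularM; first exact: regular_const.
by apply: regular_prod => i _.
Qed.

Lemma regular_meval n (h : 'M[k]_(ag_size G) -> 'I_n -> k) (p : {mpoly k[n]}) :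
  (forall i, regular (fun g => h g i)) -> regular (fun g => p.@[h g]).
Proof.
move=> Lh; apply: regular_sum => e _; apply: regularM; first exact: regular_const.
by apply: regular_prod => i _; apply: regularX.
Qed.

Lemma regular_inv_coords j : regular (fun g => gl_coords (invmx g) ord0 j).
Proof.
rewrite -[j]splitK; case: (split j) => i /=.
  case/mxvec_indexP: i => a b.
  have : regular (fun g => (\det g)^-1 * cofactor g b a).
    apply: regularM; first exact: regular_invdet.
    apply: regularM; first exact: regular_const.
    by apply: regular_det => x y; apply: eq_regular (regular_entry (lift b x) (lift a y)) => g _; rewrite !mxE.
  apply: eq_regular => g Gg; rewrite /gl_coords row_mxEl mxvecE /invmx.
  by rewrite (ag_unit Gg) !mxE.
have : regular (fun g => \det g) by apply: regular_det => *; apply: regular_entry.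
apply: eq_regular => g Gg.
by rewrite /gl_coords row_mxEr (ord1 i) det_inv invrK [RHS]mxE eqxx mulr1n.
Qed.

End RegularFunctions.

Section Coordinates.
Variable k : closedFieldType.

(** The product over [i] of the groups of [d i]-th roots of unity, where [d i = 0] gives a factor
    G_m. *)
Definition adm m (d : 'I_m -> nat) (t : 'I_m -> k) : Prop :=
  forall i, t i != 0 /\ t i ^+ d i = 1.

Lemma adm_torus m (d : 'I_m -> nat) t : adm d t -> torus_pt t.
Proof. by move=> h i; case: (h i). Qed.

Lemma adm1 m (d : 'I_m -> nat) : adm d (fun=> 1).
Proof. by move=> i; rewrite oner_neq0 expr1n. Qed.

Lemma admM m (d : 'I_m -> nat) t u : adm d t -> adm d u -> adm d (fun i => t i * u i).
Proof.
move=> ht hu i; have [t0 t1] := ht i; have [u0 u1] := hu i.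
by rewrite mulf_neq0 // exprMn t1 u1 mulr1.
Qed.

(** An isomorphism of algebraic groups from [adm d] onto [G]. Regularity of [phi] is expressed by
    Laurent sums in the parameters, which spares a matrix model of [adm d]. *)
Record coordinates (G : alg_group k) m (d : 'I_m -> nat)
    (phi : ('I_m -> k) -> 'M[k]_(ag_size G)) (psi : 'M[k]_(ag_size G) -> 'I_m -> k) : Prop := {
  coord_phi : forall t, adm d t -> G (phi t);
  coord_psi : forall g, G g -> adm d (psi g);
  coord_phiK : forall t, adm d t -> psi (phi t) = t;
  coord_psiK : forall g, G g -> phi (psi g) = g;
  coord_phiM : forall t u, adm d t -> adm d u -> phi (fun i => t i * u i) = phi t *m phi u;
  coord_laurent : forall j, laurent (V := k^o) (adm d) (fun t => gl_coords (phi t) ord0 j);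
  coord_regular : forall i, regular (G := G) (fun g => psi g i) }.

Definition diag_pt m (t : 'I_m -> k) : 'M[k]_m := diag_mx (\row_i t i).

Lemma diag_ptE m (t : 'I_m -> k) i j : diag_pt t i j = t i *+ (i == j).
Proof. by rewrite !mxE. Qed.

Lemma det_diag_pt m (t : 'I_m -> k) : \det (diag_pt t) = \prod_i t i.
Proof. by rewrite det_diag; apply: eq_bigr => i _; rewrite mxE. Qed.

Lemma diag_pt_unit m (t : 'I_m -> k) : torus_pt t -> diag_pt t \in unitmx.
Proof. by move=> nt; rewrite unitmxE unitfE det_diag_pt; apply/prodf_neq0. Qed.

Lemma diag_ptM m (t u : 'I_m -> k) : diag_pt (fun i => t i * u i) = diag_pt t *m diag_pt u.
Proof.
rewrite /diag_pt mulmx_diag; congr diag_mx; apply/rowP => i.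
by rewrite !mxE.
Qed.

Lemma diag_ptK m (g : 'M[k]_m) : is_diag_mx g -> diag_pt (fun i => g i i) = g.
Proof.
move=> dg; apply/matrixP => i j; rewrite diag_ptE; case: eqP => [<-//|/eqP ij].
by rewrite mulr0n (is_diag_mxP dg).
Qed.

Lemma diag_unit_torus m (g : 'M[k]_m) :
  is_diag_mx g -> g \in unitmx -> torus_pt (fun i => g i i).
Proof.
move=> dg; rewrite -{1}(diag_ptK dg) unitmxE unitfE det_diag_pt.
by move/prodf_neq0 => h i; apply: h.
Qed.

Lemma laurent_diag_coords m j :
  laurent (V := k^o) (@torus_pt k m) (fun t => gl_coords (diag_pt t) ord0 j).
Proof.
have L i : laurent (V := k^o) (@torus_pt k m) (fun t => t i).
  apply: eq_laurent (laurent_chr (V := k^o) (@torus_pt k m) (delta_mx 0 i) 1) => t _.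
  by rewrite chr_delta /GRing.scale /= mulr1.
rewrite -[j]splitK; case: (split j) => i /=.
  case/mxvec_indexP: i => a b.
  have [ab|ab] := eqVneq a b.
    apply: eq_laurent (L a) => t _.
    by rewrite /gl_coords row_mxEl mxvecE diag_ptE ab eqxx.
  apply: eq_laurent (laurent_const (V := k^o) (@torus_pt k m) 0) => t _.
  by rewrite /gl_coords row_mxEl mxvecE diag_ptE (negbTE ab).
apply: eq_laurent (laurent_chr (V := k^o) (@torus_pt k m) (- const_mx 1) 1) => t nt.
rewrite /gl_coords row_mxEr (ord1 i) [RHS]mxE eqxx mulr1n det_diag_pt chrN.
rewrite /GRing.scale /= mulr1; congr (_^-1).
by apply: eq_bigr => l _; rewrite mxE expr1z.
Qed.

Lemma laurent_meval m n (S : ('I_m -> k) -> Prop) (p : {mpoly k[n]}) h :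
  (forall t, S t -> torus_pt t) ->
  (forall i, laurent (V := k^o) S (fun t => h t i)) -> laurent (V := k^o) S (fun t => p.@[h t]).
Proof. by move=> S_torus Lh; apply: (@laurent_mmap k k^o m S S_torus n idfun h p). Qed.

(** A closed diagonal group is cut out by characters. On the torus a defining polynomial is a sum of
    characters; once these are grouped by their values on [T], the coefficients vanish by
    independence on [T], and the grouping is still valid at [t]. *)
Lemma diag_group_closed (T : alg_group k) (t : 'I_(ag_size T) -> k) :
  (forall g, T g -> is_diag_mx g) -> torus_pt t ->
  (forall a, (forall g, T g -> chr (fun i => g i i) a = 1) -> chr t a = 1) ->
  T (diag_pt t).
Proof.
move=> Tdiag nt Ht; have [I hI] := ag_closed T.
apply/(hI _ (diag_pt_unit nt)) => p Ip.
pose S u := torus_pt u /\ T (diag_pt u).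
have [l hl] : laurent (V := k^o) (@torus_pt k _) (fun u => p.@[mxvec (diag_pt u) ord0]).
  apply: (@laurent_meval _ _ _ p (fun u => mxvec (diag_pt u) ord0)) => // i.
  apply: eq_laurent (laurent_diag_coords (lshift 1 i)) => u _.
  by rewrite /gl_coords row_mxEl.
have [s [v [us _ dist hs]]] := merge_characters S l.
have Sdiag g : T g -> S (fun i => g i i).
  move=> Tg; split; last by rewrite diag_ptK //; apply: Tdiag.
  by apply: diag_unit_torus; [exact: Tdiag | exact: ag_unit].
have v0 : {in s, forall a, v a = 0}.
  apply: (chr_independence (S := S)) => //.
  - split; first exact: torus_pt1.
    have -> : diag_pt (fun=> 1) = 1%:M :> 'M_(ag_size T) by apply/matrixP => a b; rewrite diag_ptE mxE.
    exact: ag_1.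
  - move=> x y [nx Tx] [ny Ty]; split; first exact: torus_ptM.
    by rewrite diag_ptM; apply: ag_mul.
  - move=> u Su; rewrite -hs; last by move=> a b; exact.
    rewrite -hl; last exact: Su.1.
    exact: ((hI _ (diag_pt_unit Su.1)).1 Su.2 _ Ip).
rewrite hl // hs; last first.
  move=> a b hab; apply: (mulIf (chr_neq0 (- b) nt)).
  rewrite -!chrD // subrr chr0; apply: Ht => g /Sdiag Sg.
  by rewrite chrD ?chrN ?(hab _ Sg) ?mulfV ?chr_neq0 //; apply: Sg.1.
by rewrite big_seq big1 // => a /v0 ->; rewrite scaler0.
Qed.

Lemma alg_morphism1 (G1 G2 : alg_group k) (f : 'M[k]_(ag_size G1) -> 'M[k]_(ag_size G2)) :
  alg_morphism f -> f 1%:M = 1%:M.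
Proof.
case=> fG fM _; have := fM _ _ (ag_1 G1) (ag_1 G1); rewrite mulmx1 => e.
have U := ag_unit (fG _ (ag_1 G1)).
by apply: (can_inj (mulKmx U)); rewrite mulmx1 -e.
Qed.

Lemma alg_morphismV (G1 G2 : alg_group k) (f : 'M[k]_(ag_size G1) -> 'M[k]_(ag_size G2)) g :
  alg_morphism f -> G1 g -> f (invmx g) = invmx (f g).
Proof.
move=> mf; have [fG fM _] := mf => Gg; have U := ag_unit (fG _ Gg).
have e : f g *m f (invmx g) = 1%:M.
  by rewrite -fM ?mulmxV ?alg_morphism1 ?(ag_unit Gg) //; apply: ag_inv.
by rewrite -[LHS]mul1mx -(mulVmx U) -mulmxA e mulmx1.
Qed.

Lemma diagonalizable_coordinates (G : alg_group k) : diagonalizable_group G ->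
  exists m (d : 'I_m -> nat) phi psi, coordinates (G := G) d phi psi.
Proof.
case=> T Tdiag [f [f' [mf mf' f'K fK]]].
have [fG fM freg] := mf; have [fG' fM' freg'] := mf'.
pose m := ag_size T.
(* The characters trivial on [T]; the Smith form of this lattice turns [T] into [adm d]. *)
pose R (a : 'rV[int]_m) := forall g, T g -> chr (fun i => g i i) a = 1.
have Tnz g : T g -> torus_pt (fun i => g i i).
  by move=> Tg; apply: diag_unit_torus; [exact: Tdiag | exact: ag_unit].
have LR : is_lattice R.
  split=> [g _|a b Ra Rb g Tg]; first by rewrite chr0.
  by rewrite chrB ?Ra ?Rb ?divr1 //; apply: Tnz.
have [U Uu [d hd]] := lattice_smith LR.
(* The monomial change of coordinates with exponent matrix [W]. *)
pose pt W (tau : 'I_m -> k) : 'I_m -> k := fun j => chr tau (row j W).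
have ptK W W' tau : W *m W' = 1%:M -> torus_pt tau -> pt W (pt W' tau) = tau.
  move=> WW nt; apply: funext => j; rewrite /pt chr_mulmx // -row_mul WW.
  by rewrite -[RHS]chr_delta rowE mulmx1.
have pt_nz W tau : torus_pt tau -> torus_pt (pt W tau).
  by move=> nt j; apply: chr_neq0.
have ptM W (t u : 'I_m -> k) : pt W (fun i => t i * u i) = fun i => pt W t i * pt W u i.
  by apply: funext => j; rewrite /pt chrM.
have pt_T tau : adm d tau -> T (diag_pt (pt U tau)).
  move=> At; have nt := adm_torus At; apply: diag_group_closed => //; first exact: pt_nz.
  move=> a /hd da; rewrite chr_mulmx // /chr big1 // => i _.
  have /dvdzP[q ->] := da i; have [_ e] := At i.
  by rewrite mulrC -exprz_exp -exprnP e exp1rz.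
have diag_inv g : T g -> invmx g = diag_pt (fun i => (g i i)^-1).
  move=> Tg; have gU := ag_unit Tg; apply: (can_inj (mulKmx gU)).
  rewrite mulmxV // -[X in X *m _](diag_ptK (Tdiag _ Tg)) -diag_ptM.
  by apply/matrixP => i j; rewrite diag_ptE mxE mulfV //; apply: Tnz.
exists m, d, (fun tau => f' (diag_pt (pt U tau))),
  (fun g => pt (invmx U) (fun i => f g i i)).
have adm_psi g : T g -> adm d (pt (invmx U) (fun i => g i i)).
  move=> Tg i; have ng := Tnz _ Tg; split; first exact: pt_nz.
  rewrite exprnP -chrZ //; suff /(_ g Tg) : R ((d i : int) *: row i (invmx U)) by [].
  apply/hd => j; rewrite -scalemxAl -row_mul mulVmx // !mxE.
  by case: eqP => [->|_]; rewrite ?mulr1 ?mulr0 ?dvdz0.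
split.
- by move=> t At; apply/fG'/pt_T.
- by move=> g Gg; apply/adm_psi/fG.
- move=> t At; rewrite fK; last exact: pt_T.
  rewrite -[RHS](ptK (invmx U) U) ?mulVmx //; last exact: adm_torus At.
  by congr pt; apply: funext => i; rewrite diag_ptE eqxx.
- move=> g Gg; have Tg := fG _ Gg; rewrite ptK ?mulmxV //; last exact: Tnz.
  by rewrite diag_ptK ?f'K //; apply: Tdiag.
- by move=> t u At Au; rewrite ptM diag_ptM fM' //; apply: pt_T.
(* Stated for any [W] because the inverse determinant is treated as the determinant at the inverse
   point, that is with [- U] instead of [U]. *)
- have Lentry W a b : (forall t, adm d t -> T (diag_pt (pt W t))) ->
      laurent (V := k^o) (adm d) (fun t => f' (diag_pt (pt W t)) a b).
    move=> WT; have [p hp] := freg' a b.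
    suff Lp : laurent (V := k^o) (adm d) (fun t => p.@[gl_coords (diag_pt (pt W t)) ord0]).
      by apply: eq_laurent Lp => t At; rewrite hp //; apply: WT.
    apply: (@laurent_meval _ _ _ p (fun t => gl_coords (diag_pt (pt W t)) ord0)).
      by move=> t; apply: adm_torus.
    move=> i; apply: (@laurent_subst k k^o m (@torus_pt k m) m (adm d) W (fun t => gl_coords (diag_pt t) ord0 i)).
    + by move=> t; apply: adm_torus.
    + by move=> t /adm_torus nt; apply: pt_nz.
    + exact: laurent_diag_coords.
  move=> j; rewrite -[j]splitK; case: (split j) => i /=.
    case/mxvec_indexP: i => a b.
    apply: eq_laurent (Lentry U a b pt_T) => t At.
    by rewrite /gl_coords row_mxEl mxvecE.
  have ptN t : adm d t -> diag_pt (pt (- U) t) = invmx (diag_pt (pt U t)).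
    move=> At; rewrite diag_inv; last exact: pt_T.
    congr diag_pt; apply: funext => l; rewrite diag_ptE eqxx /pt -chrN.
    by congr chr; apply/rowP => c; rewrite !mxE.
  have NT t : adm d t -> T (diag_pt (pt (- U) t)).
    by move=> At; rewrite ptN //; apply/ag_inv/pt_T.
  have Ld : laurent (V := k^o) (adm d) (fun t => \det (f' (diag_pt (pt (- U) t)))).
    apply: (laurent_det (V := k^o)); first by move=> t; apply: adm_torus.
    by move=> a b; apply: Lentry.
  apply: eq_laurent Ld => t At; rewrite ptN // (alg_morphismV mf'); last exact: pt_T.
  by rewrite /gl_coords row_mxEr (ord1 i) det_inv [RHS]mxE eqxx mulr1n.
- have fentry i j : regular (G := G) (fun g => f g i j) by exact: freg.
  have finv i : regular (G := G) (fun g => (f g i i)^-1).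
    have [p hp] := freg i i.
    apply: eq_regular (_ : regular (fun g => p.@[gl_coords (invmx g) ord0])).
      move=> g Gg; rewrite -hp; last exact: ag_inv.
      by rewrite (alg_morphismV mf) // diag_inv ?diag_ptE ?eqxx //; apply: fG.
    by apply: regular_meval => j; apply: regular_inv_coords.
  move=> i; apply: regular_prod => j _.
  case: (row i (invmx U) 0 j) => n; first exact: regularX.
  by apply: eq_regular (regularX n.+1 (finv j)) => g _; rewrite NegzE exprVn.
Qed.

End Coordinates.

(** * Growth of filtrations and dimension *)

Lemma linear_dependence (k : fieldType) (I J : finType) (c : I -> J -> k) :
  (#|J| < #|I|)%N ->
  exists2 a : I -> k, (exists i, a i != 0) & forall j, \sum_i a i * c i j = 0.
Proof.
move=> JI; pose A := \matrix_(i < #|I|, j < #|J|) c (enum_val i) (enum_val j).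
have : kermx A != 0.
  rewrite kermx_eq0 /row_free neq_ltn; apply/orP; left.
  exact: leq_ltn_trans (rank_leq_col A) JI.
case/rowV0Pn => u /sub_kermxP uA /rV0Pn[i0 ui0].
exists (fun i => u 0 (enum_rank i)); first by exists (enum_val i0); rewrite enum_valK.
move=> j; have := congr1 (fun M : 'rV_#|J| => M 0 (enum_rank j)) uA.
rewrite !mxE => e; rewrite -[RHS]e [RHS](reindex (@enum_rank I)) /=; last first.
  by exists enum_val => x _; rewrite ?enum_valK ?enum_rankK.
by apply: eq_bigr => i _; rewrite !mxE !enum_rankK.
Qed.

Definition box_monomial s M (g : {ffun 'I_s -> 'I_M.+1}) : 'X_{1..s} :=
  [multinom (g i : nat) | i < s].

Lemma box_monomial_inj s M : injective (@box_monomial s M).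
Proof.
move=> g h /mnmP e; apply/ffunP => i; apply: val_inj.
by have := e i; rewrite !mnmE.
Qed.

Lemma box_poly_coeff (k : fieldType) s M (a : {ffun 'I_s -> 'I_M.+1} -> k) h :
  (\sum_g a g *: 'X_[box_monomial g] : {mpoly k[s]})@_(box_monomial h) = a h.
Proof.
rewrite raddf_sum (bigD1 h) //= mcoeffZ mcoeffX eqxx mulr1 big1 ?addr0 // => g gh.
by rewrite mcoeffZ mcoeffX (inj_eq (@box_monomial_inj s M)) (negbTE gh) mulr0.
Qed.

Lemma card_box s M : #|{: {ffun 'I_s -> 'I_M.+1}}| = (M.+1 ^ s)%N.
Proof. by rewrite card_ffun !card_ord. Qed.

(* The box of exponents below [M] has [(M+1)^s] monomials, while the filtered
   piece containing their values grows at most like [M^r] with [r < s]. *)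
Lemma growth_dependence (k : fieldType) (Pt : Type) (S : Pt -> Prop) (R : comNzRingType)
    (iota : {rmorphism k -> R}) (Fil : nat -> (Pt -> R) -> Prop)
    (J : nat -> finType) (w : forall B, J B -> Pt -> R) (C r s : nat) (u : 'I_s -> Pt -> R) :
  Fil 0%N (fun=> 1) -> Fil 1%N (fun=> 1) ->
  (forall B B' f g, Fil B f -> Fil B' g -> Fil (B + B')%N (fun x => f x * g x)) ->
  (forall B f, Fil B f -> exists c : J B -> k,
     forall x, S x -> f x = \sum_j iota (c j) * w B j x) ->
  (forall B, (#|J B| <= C * B.+1 ^ r)%N) ->
  (forall i, Fil 1%N (u i)) -> (r < s)%N ->
  exists2 P : {mpoly k[s]}, P != 0 & forall x, S x -> mmap iota (u^~ x) P = 0.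
Proof.
move=> Fil0 Fil1 FilM span cardJ Filu rs.
(* With this [M], [C * (s * M + 1) ^ r <= C * s ^ r * (M + 1) ^ r = M * (M + 1) ^ r < (M + 1) ^ (r +
   1)], so the box of monomials outgrows the filtered piece of level [s * M]. *)
pose M := (C * s ^ r)%N.
(* Levels need not be nested, so lower powers are padded with the constant 1 of level 1. *)
have FilX i N e : (e <= N)%N -> Fil N (fun x => u i x ^+ e).
  elim: N e => [|N IH] [|e] // eN.
    have := FilM _ _ _ _ Fil1 (IH 0%N isT); rewrite add1n.
    by congr Fil; apply: funext => x; rewrite !expr0 mulr1.
  have := FilM _ _ _ _ (Filu i) (IH e eN); rewrite add1n.
  by congr Fil; apply: funext => x; rewrite exprS.
have Filmon (g : {ffun 'I_s -> 'I_M.+1}) :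
    Fil (s * M)%N (fun x => \prod_i u i x ^+ g i).
  have : forall l : seq 'I_s, Fil (size l * M)%N (fun x => \prod_(i <- l) u i x ^+ g i).
    elim=> [|i l IH]; first by have := Fil0; congr Fil; apply: funext => x; rewrite big_nil.
    have := FilM _ _ _ _ (FilX i M (g i) (ltn_ord (g i))) IH.
    by congr Fil; apply: funext => x; rewrite big_cons.
  move/(_ (enum 'I_s)); rewrite size_enum_ord.
  by congr Fil; apply: funext => x; rewrite big_enum.
have c_ g := cid (span _ _ (Filmon g)).
have [|a [g0 ag0] ha] := @linear_dependence k _ _ (fun g => sval (c_ g)).
  apply: leq_ltn_trans (cardJ _) _; rewrite card_box.
  apply: (@leq_trans (M.+1 ^ r.+1)); last by rewrite leq_pexp2l.
  rewrite expnS; apply: (@leq_ltn_trans (M * M.+1 ^ r)); last by rewrite ltn_pmul2r ?expn_gt0.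
  rewrite {2}/M -mulnA leq_mul2l; apply/orP; right; rewrite -expnMn.
  case: (r) => [|r']; first by rewrite !expn0.
  by rewrite leq_exp2r // mulnS; lia.
exists (\sum_g a g *: 'X_[box_monomial g]).
  apply: contraNneq ag0 => P0; have := box_poly_coeff a g0.
  by rewrite P0 mcoeff0 => <-.
move=> x Sx; rewrite rmorph_sum /=.
transitivity (\sum_g \sum_j iota (a g * sval (c_ g) j) * w _ j x).
  apply: eq_bigr => g _; rewrite mmapZ mmapX /mmap1.
  have -> : \prod_(i < s) u i x ^+ box_monomial g i = \prod_i u i x ^+ g i.
    by apply: eq_bigr => i _; rewrite mnmE.
  rewrite (svalP (c_ g)) // mulr_sumr; apply: eq_bigr => j _.
  by rewrite rmorphM mulrA.
rewrite exchange_big big1 // => j _ /=.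
by rewrite -mulr_suml -rmorph_sum /= ha rmorph0 mul0r.
Qed.

Section Dimension.
Variables (k : closedFieldType) (char_k : [pchar k] =i pred0).
Variables (G : alg_group k) (m : nat) (d : 'I_m -> nat).
Variables (phi : ('I_m -> k) -> 'M[k]_(ag_size G)) (psi : 'M[k]_(ag_size G) -> 'I_m -> k).
Hypothesis coordG : coordinates (G := G) d phi psi.

Local Notation free := [set i | d i == 0%N].

(** Free coordinates take arbitrary nonzero values independently of each other, so a polynomial
    relation between them vanishes on a whole torus. *)
Lemma free_coordinates_independent :
  exists f : #|free|.-tuple {mpoly k[ag_size G * ag_size G + 1]}, alg_independent (G := G) f.
Proof.
have [p hp] : exists p : 'I_m -> {mpoly k[ag_size G * ag_size G + 1]},
    forall i g, G g -> psi g i = (p i).@[gl_coords g ord0].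
  have h i := cid (coord_regular coordG i).
  by exists (fun i => sval (h i)) => i; apply: (svalP (h i)).
exists [tuple p (enum_val i) | i < #|free|] => P P0.
apply: (mpoly_vanish char_k) => x x0.
pose t i : k := if insub i is Some j then x (enum_rank_in (svalP j) (sval j)) else 1.
have tE j : t (enum_val j) = x j.
  by rewrite /t insubT => [|jf]; [exact: enum_valP | rewrite /= enum_valK_in].
have At : adm d t.
  move=> i; rewrite /t; case: insubP => [j ji|ni]; last by rewrite oner_neq0 expr1n.
  have : i \in free by exact: ji.
  by rewrite inE => /eqP ->; rewrite expr0 x0.
have := P0 _ (coord_phi coordG At); apply: etrans; apply: meval_eq => j.
by rewrite tnth_mktuple -hp ?(coord_phiK coordG At) ?tE //; apply: (coord_phi coordG).
Qed.

(** Exponents of torsion coordinates can be reduced modulo [d i], so the monomials with exponents up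
    to [D * B] span a space that grows with [B] to the number of free coordinates;
    [growth_dependence] then bounds the number of independent functions. *)
Lemma alg_independent_bound e (f : e.-tuple {mpoly k[ag_size G * ag_size G + 1]}) :
  alg_independent (G := G) f -> (e <= #|free|)%N.
Proof.
move=> indf; rewrite leqNgt; apply/negP => lt_e.
have [l hl] : exists l : 'I_e -> seq ('rV[int]_m * k^o), forall i t, adm d t ->
    (tnth f i).@[gl_coords (phi t) ord0] = \sum_(x <- l i) chr t x.1 *: x.2.
  have h i := cid (laurent_meval (tnth f i) (@adm_torus k m d) (coord_laurent coordG)).
  by exists (fun i => sval (h i)) => i; apply: (svalP (h i)).
pose D := (\sum_i \sum_(x <- l i) \sum_j `|x.1 0%R j|)%N.
have lD i x j : x \in l i -> (`|x.1 0%R j| <= D)%N.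
  move=> xl; rewrite /D (bigD1 i) //= (big_rem x) //= (bigD1 j) //=; lia.
pose Fil B (h : ('I_m -> k) -> k) := exists l : seq ('rV[int]_m * k),
  (forall x j, x \in l -> (`|x.1 0%R j| <= D * B)%N) /\
  forall t, adm d t -> h t = \sum_(x <- l) x.2 * chr t x.1.
(* [Q] exceeds every remainder modulo a nonzero [d i]. In [w] the exponents of free coordinates,
   between [- D * B] and [D * B], are indexed after a shift by [D * B]. *)
pose Q := (\sum_i d i).+1.
pose w B (y : {ffun 'I_#|free| -> 'I_(2 * (D * B)).+1} * {ffun 'I_m -> 'I_Q}) (t : 'I_m -> k) : k :=
  (\prod_i t (enum_val i) ^ ((y.1 i)%:Z - (D * B)%:Z)) *
  \prod_(i | d i != 0%N) t i ^+ y.2 i.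
have [||||||P P0 hP] := @growth_dependence k _ (adm d) k idfun Fil _ w
   ((2 * D).+1 ^ #|free| * Q ^ m)%N #|free| e
   (fun i t => (tnth f i).@[gl_coords (phi t) ord0]) _ _ _ _ _ _ lt_e.
- exists [:: (0, 1)]; split=> [x j|t _]; last by rewrite big_seq1 chr0 mulr1.
  by rewrite inE => /eqP ->; rewrite /= mxE.
- exists [:: (0, 1)]; split=> [x j|t _]; last by rewrite big_seq1 chr0 mulr1.
  by rewrite inE => /eqP ->; rewrite /= mxE.
- move=> B B' f1 f2 [l1 [b1 h1]] [l2 [b2 h2]].
  exists [seq (x.1 + y.1, x.2 * y.2) | x <- l1, y <- l2]; split.
    move=> z j /allpairsP[[x y] [xl yl ->]] /=; rewrite mxE.
    have := b1 _ j xl; have := b2 _ j yl; rewrite mulnDr /=; lia.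
  move=> t At; rewrite h1 // h2 // big_allpairs_dep mulr_suml; apply: eq_bigr => x _.
  rewrite mulr_sumr; apply: eq_bigr => y _ /=.
  by rewrite chrD; [ring | exact: adm_torus At].
- move=> B h [l' [bl hl']].
  have key (x : 'rV[int]_m) : (forall j, (`|x 0%R j| <= D * B)%N) ->
      exists y, forall t, adm d t -> chr t x = w B y t.
    move=> bx; pose y1 := [ffun i : 'I_#|free| =>
      inord (absz (x 0 (enum_val i) + (D * B)%:Z)) : 'I_(2 * (D * B)).+1].
    pose y2 := [ffun i : 'I_m => inord (absz (x 0%R i %% (d i))%Z) : 'I_Q].
    exists (y1, y2) => t At; rewrite /w /chr (bigID (mem free)) /=; congr (_ * _).
      rewrite [LHS](big_enum_val (A := mem free)) /=; apply: eq_bigr => i _.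
      rewrite ffunE inordK; last by move: (x 0 _) (bx (enum_val i)) => z hz; lia.
      congr (_ ^ _); move: (x 0 (enum_val i)) (bx (enum_val i)) => z hz; lia.
    apply: eq_big => [i|i]; first by rewrite inE.
    rewrite inE => di; have [_ t1] := At i; have ti := adm_torus At i.
    have dz : (d i)%:Z != 0 by [].
    have m0 := modz_ge0 (x 0 i) dz; have m1 := ltz_mod (x 0 i) dz.
    rewrite ffunE inordK; last first.
      by have : (d i <= \sum_i d i)%N by [rewrite (bigD1 i) //= leq_addr]; rewrite /Q; lia.
    have -> : t i ^ x 0 i = t i ^ (x 0%R i %% d i)%Z.
      rewrite {1}(divz_eq (x 0 i) (d i)) expfzDr // [_ * (d i)%:Z]mulrC -exprz_exp.
      by rewrite -exprnP t1 exp1rz mul1r.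
    by rewrite exprnP; congr (_ ^ _); lia.
  have sumc (l0 : seq ('rV[int]_m * k)) : {subset l0 <= l'} ->
      exists c, forall t, adm d t -> \sum_(x <- l0) x.2 * chr t x.1 = \sum_y c y * w B y t.
    elim: l0 => [|x l0 IH] sl.
      exists (fun=> 0) => t _; rewrite big_nil big1 // => y _; exact: mul0r.
    have [c hc] := IH (fun z zl => sl z (mem_behead (s := x :: l0) zl)).
    have [y hy] := key x.1 (fun j => bl x j (sl x (mem_head _ _))).
    exists (fun z => (if z == y then x.2 else 0) + c z) => t At.
    rewrite big_cons hc // hy //.
    under [RHS]eq_bigr do rewrite mulrDl.
    rewrite big_split /=; congr (_ + _).
    rewrite (bigD1 y) //= eqxx big1 ?addr0 // => z /negbTE ->; exact: mul0r.
  by have [c hc] := sumc l' (fun _ => id); exists c => t At; rewrite hl' // hc.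
- move=> B; rewrite card_prod !card_ffun !card_ord; set r := #|free|.
  rewrite [leqRHS]mulnAC leq_mul2r -expnMn; apply/orP; right.
  case: (r) => [|r']; first by rewrite !expn0.
  by rewrite leq_exp2r // mulSn mulnS; lia.
- move=> i; exists (l i); split=> [x j xl|t At]; first by rewrite muln1; apply: lD xl.
  by rewrite hl //; apply: eq_bigr => x _; rewrite /GRing.scale /= mulrC.
- move/eqP: P0; apply; apply: indf => g Gg.
  rewrite -[RHS](hP _ (coord_psi coordG Gg)) /=.
  by apply: meval_eq => i; rewrite (coord_psiK coordG Gg).
Qed.

Lemma alg_dim_coordinates D : alg_dim G D -> #|free| = D.
Proof.
case=> [[f indf] max]; apply/eqP; rewrite eqn_leq (alg_independent_bound indf) andbT.
by have [h indh] := free_coordinates_independent; apply: max indh.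
Qed.

End Dimension.

(** * Gradings by characters *)

Lemma comp_mpolyA (k : closedFieldType) n (p : {mpoly k[n]}) (g h : polymap k n) :
  p \mPo polymap_comp g h = (p \mPo g) \mPo h.
Proof.
apply: (@rmorph_mpoly n k {mpoly k[n]} (comp_mpoly (polymap_comp g h)) (comp_mpoly h \o comp_mpoly g)) => [c|i] /=.
  by rewrite !comp_mpolyC.
by rewrite !comp_mpolyXU -!tnth_nth tnth_mktuple.
Qed.

(** Powers of [X] are split off both factors; the cofactors have nonzero constant terms and their
    product is then [c], so both are constants. The coefficient is written [P.[1]], a value that is
    known in the application. *)
Lemma poly_monomial_factor (R : idomainType) (P Q : {poly R}) c e :
  c != 0 -> P * Q = c%:P * 'X^e -> exists b, P = P.[1]%:P * 'X^b.
Proof.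
move=> c0 PQ.
have split0 (F : {poly R}) : F != 0 -> exists i F', F = F' * 'X^i /\ F'.[0] != 0.
  move=> F0; have [i [F' rF' eF]] := multiplicity_XsubC F 0.
  exists i, F'; move: rF' eF; rewrite F0 subr0 => rF' ->; split=> //.
have cX0 : c%:P * 'X^e != 0 :> {poly R} by rewrite mulf_neq0 ?polyC_eq0 ?monic_neq0 ?monicXn.
have [P0 Q0] : P != 0 /\ Q != 0.
  by move: cX0; rewrite -PQ mulf_eq0 negb_or => /andP[].
have [i [P' [eP p0]]] := split0 P P0; have [j [Q' [eQ q0]]] := split0 Q Q0.
have X0 n : 'X^n != 0 :> {poly R} by rewrite monic_neq0 ?monicXn.
have e1 : P' * Q' * 'X^(i + j) = c%:P * 'X^e by rewrite -PQ eP eQ exprD; ring.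
have pq0 : (P' * Q').[0] != 0 by rewrite hornerM mulf_neq0.
have e2 : P' * Q' = c%:P.
  have [ije|eij|ije] := ltngtP (i + j)%N e.
  - have eX : P' * Q' * 'X^(i + j) = c%:P * 'X^(e - (i + j)) * 'X^(i + j).
      by rewrite e1 -mulrA -exprD subnK // ltnW.
    have h := mulIf (X0 _) eX.
    move: pq0; rewrite h hornerM hornerXn expr0n subn_eq0 leqNgt ije /= mulr0.
    by rewrite eqxx.
  - have eX : P' * Q' * 'X^(i + j - e) * 'X^e = c%:P * 'X^e.
      by rewrite -e1 -mulrA -exprD subnK // ltnW.
    have h := mulIf (X0 _) eX.
    have : (c%:P : {poly R}).[0] = 0.
      by rewrite -h hornerM hornerXn expr0n subn_eq0 leqNgt eij /= mulr0.
    by rewrite hornerC => h0; rewrite h0 eqxx in c0.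
  - by move: e1; rewrite ije; apply: mulIf.
have P'0 : P' != 0 by move: P0; rewrite eP mulf_eq0 negb_or => /andP[].
have Q'0 : Q' != 0 by move: Q0; rewrite eQ mulf_eq0 negb_or => /andP[].
have sP' : (size P' <= 1)%N.
  have : size (P' * Q') = 1%N by rewrite e2 size_polyC c0.
  rewrite size_mul //; move: P'0 Q'0; rewrite -!size_poly_gt0; lia.
exists i; rewrite {1}eP (size1_polyC sP'); congr (_%:P * _).
by rewrite eP (size1_polyC sP') hornerM hornerC hornerXn expr1n mulr1 coefC eqxx.
Qed.

Section Grading.
Variables (k : closedFieldType) (char_k : [pchar k] =i pred0).
Variables (N m : nat) (d : 'I_m -> nat) (act : ('I_m -> k) -> polymap k N).

Record torus_action : Prop := {
  act_mul : forall t u, adm d t -> adm d u ->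
    act (fun i => t i * u i) = polymap_comp (act t) (act u);
  act_one : act (fun=> 1) = polymap_id k N;
  act_faithful : forall t, adm d t -> act t = polymap_id k N -> t = fun=> 1;
  act_laurent : forall i, laurent (adm d) (fun t => tnth (act t) i) }.

Hypothesis actP : torus_action.
Implicit Types (t u : 'I_m -> k) (p q f g : {mpoly k[N]}) (a b : 'rV[int]_m).

Lemma act_comp t u p : adm d t -> adm d u ->
  (p \mPo act t) \mPo act u = p \mPo act (fun i => t i * u i).
Proof. by move=> At Au; rewrite (act_mul actP) // comp_mpolyA. Qed.

Lemma act_comp1 p : p \mPo act (fun=> 1) = p.
Proof. by rewrite (act_one actP) comp_mpoly_id. Qed.

Lemma admV t : adm d t -> adm d (fun i => (t i)^-1).
Proof. by move=> At i; have [t0 t1] := At i; rewrite invr_eq0 exprVn t1 invr1. Qed.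

Lemma act_compK t p : adm d t -> (p \mPo act t) \mPo act (fun i => (t i)^-1) = p.
Proof.
move=> At; rewrite act_comp //; last exact: admV.
rewrite -[RHS]act_comp1; congr (_ \mPo act _); apply: funext => i.
by rewrite mulfV //; have [] := At i.
Qed.

Lemma act_comp_eq0 t p : adm d t -> (p \mPo act t == 0) = (p == 0).
Proof.
move=> At; apply/eqP/eqP => [h|->]; last exact: comp_mpoly0.
by rewrite -(act_compK p At) h comp_mpoly0.
Qed.

(** [S] will be either the whole group or its identity component. *)
Definition homogeneous_on (S : ('I_m -> k) -> Prop) a p : Prop :=
  forall t, S t -> p \mPo act t = chr t a *: p.

Definition homogeneous a p : Prop := homogeneous_on (adm d) a p.

(** The identity component, a product of factors G_m. *)
Definition connected_pt t : Prop := adm d t /\ forall i, d i != 0%N -> t i = 1.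

Definition homogeneous0 a p : Prop := homogeneous_on connected_pt a p.

Lemma homogeneous_weak a p : homogeneous a p -> homogeneous0 a p.
Proof. by move=> h t [At _]; apply: h. Qed.

Lemma action_laurent p : laurent (adm d) (fun t => p \mPo act t).
Proof.
apply: (@laurent_mmap k _ m (adm d) (@adm_torus k m d) N (@mpolyC N k) (fun t => tnth (act t))).
exact: act_laurent.
Qed.

(** The last clause is independence of characters modulo a subspace [W] containing the orbit of [p];
    it later puts semi-invariants into the stable pencil. *)
Lemma homogeneous_decomposition p : exists s v,
  [/\ p = \sum_(a <- s) v a, {in s, forall a, homogeneous a (v a)} &
  forall W, is_subspace W -> (forall t, adm d t -> W (p \mPo act t)) ->
    {in s, forall a, W (v a)}].
Proof.
have [l hl] := action_laurent p.
have [s [v [us _ dist hs]]] := merge_characters (adm d) l.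
have pE t : adm d t -> p \mPo act t = \sum_(a <- s) chr t a *: v a.
  by move=> At; rewrite hl // hs // => a b; apply.
have A1 := @adm1 k m d; have AM := @admM k m d.
exists s, v; split.
- rewrite -[LHS]act_comp1 pE //; apply: eq_bigr => a _.
  by rewrite chr1 scale1r.
- move=> a a_s t At; apply/eqP; rewrite -subr_eq0; apply/eqP.
  (* Expanding [p] at [u] times [t] in two ways gives a relation between characters of [u], whose
     coefficients must vanish. *)
  apply: (chr_independence (S := adm d) (v := fun a => v a \mPo act t - chr t a *: v a) _ _ us dist) a_s => // u Au.
  under eq_bigr do rewrite scalerBr scalerA -chrM -comp_mpolyZ.
  rewrite sumrB -(raddf_sum (comp_mpoly (act t))) -(pE u Au).
  rewrite -(pE (fun i => u i * t i)); last exact: AM.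
  by rewrite /= act_comp // subrr.
- move=> W subW pW; apply: (chr_independence_mod (S := adm d)) => // t At.
  by rewrite -pE //; apply: pW.
Qed.

Lemma connected_pt1 : connected_pt (fun=> 1).
Proof. by split=> //; apply: adm1. Qed.

Lemma connected_ptM t u : connected_pt t -> connected_pt u -> connected_pt (fun i => t i * u i).
Proof.
move=> [At ct] [Au cu]; split; first exact: admM.
by move=> i di; rewrite ct // cu // mulr1.
Qed.

Definition one_param i (z : k) : 'I_m -> k := fun j => if j == i then z else 1.

Lemma chr_one_param i z a : chr (one_param i z) a = z ^ a 0 i.
Proof.
rewrite /chr (bigD1 i) //= /one_param eqxx big1 ?mulr1 // => j /negbTE ->.
exact: exp1rz.
Qed.

Lemma one_param_connected i z : d i = 0%N -> z != 0 -> connected_pt (one_param i z).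
Proof.
move=> di z0; split=> j; rewrite /one_param; case: (j =P i) => [->|_] //.
- by rewrite di expr0.
- by rewrite oner_neq0 expr1n.
- by rewrite di.
Qed.

(** A semi-invariant of the identity component determines only the free entries of its weight
    vector; such weights are therefore compared at free indices alone. *)
Lemma homogeneous0_weight a b p i : d i = 0%N ->
  homogeneous0 a p -> homogeneous0 b p -> p != 0 -> a 0 i = b 0 i.
Proof.
move=> di ha hb p0; apply: (exprz2_inj char_k).
have n2 : 2%:R != 0 :> k by apply: natr_neq0.
have T := one_param_connected di n2.
have : (2%:R ^ a 0 i - 2%:R ^ b 0 i) *: p = 0.
  by rewrite scalerBl -!(chr_one_param i) -ha // -hb // subrr.
by move/eqP; rewrite scaler_eq0 (negbTE p0) orbF subr_eq0 => /eqP.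
Qed.

Lemma connected_chr_eq t a b : (forall i, d i = 0%N -> a 0 i = b 0 i) ->
  connected_pt t -> chr t a = chr t b.
Proof.
move=> ab [_ ct]; apply: eq_bigr => i _.
have [di|di] := eqVneq (d i) 0%N; first by rewrite ab.
by rewrite ct // !exp1rz.
Qed.

Lemma homogeneous0_independence (I : eqType) (s : seq I) (w : I -> 'rV[int]_m)
    (v : I -> {mpoly k[N]}) :
  uniq s ->
  {in s &, forall x y, x != y -> exists2 i, d i = 0%N & w x 0 i != w y 0 i} ->
  {in s, forall x, homogeneous0 (w x) (v x)} ->
  \sum_(x <- s) v x = 0 -> {in s, forall x, v x = 0}.
Proof.
move=> us dist hv sum0.
apply: (@dedekind_independence k _ (fun p => p = 0) ('I_m -> k) (fun t u i => t i * u i)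
   connected_pt (fun=> 1) I (fun x t => chr t (w x))) => //.
- exact: zero_subspace.
- exact: connected_ptM.
- exact: connected_pt1.
- by move=> x t u _ _; apply: chrM.
- by move=> x; apply: chr1.
- move=> x y xs ys xy; have [i di wi] := dist x y xs ys xy.
  have n2 : 2%:R != 0 :> k by apply: natr_neq0.
  exists (one_param i 2%:R); first exact: one_param_connected.
  by rewrite !chr_one_param; apply: contra wi => /eqP/(exprz2_inj char_k) ->.
- move=> t Tt; have := congr1 (comp_mpoly (act t)) sum0; rewrite comp_mpoly0 => e.
  rewrite -[RHS]e raddf_sum.
  by rewrite big_seq [RHS]big_seq; apply: eq_bigr => x xs; rewrite /= hv.
Qed.

Section HomPred.
Variable S : ('I_m -> k) -> Prop.
Hypothesis S_adm : forall t, S t -> adm d t.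
Local Notation hom := (homogeneous_on S).

Lemma homogeneous_onM a b p q : hom a p -> hom b q -> hom (a + b) (p * q).
Proof.
move=> hp hq t St; rewrite rmorphM /= hp // hq //.
by rewrite chrD -?scalerAl -?scalerAr ?scalerA //; apply/adm_torus/S_adm.
Qed.

Lemma homogeneous_on1 : hom 0 1.
Proof. by move=> t St; rewrite comp_mpoly1 chr0 scale1r. Qed.

Lemma homogeneous_onX a p n : hom a p -> hom (a *+ n) (p ^+ n).
Proof.
move=> hp; elim: n => [|n IH]; first by rewrite mulr0n expr0; apply: homogeneous_on1.
by rewrite mulrS exprS; apply: homogeneous_onM.
Qed.

Lemma homogeneous_on_cancel a b p q : q != 0 -> hom a (p * q) -> hom b q -> hom (a - b) p.
Proof.
move=> q0 hpq hq t St; have nt : torus_pt t by apply/adm_torus/S_adm.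
have := hpq t St; rewrite rmorphM /= hq // => e.
have cb : chr t b != 0 by apply: chr_neq0.
apply: (mulIf q0); apply: (scalerI cb); rewrite scalerAr e chrB //.
by rewrite -scalerAl scalerA [chr t b * _]mulrC divfK.
Qed.

End HomPred.
End Grading.

(** * Factors of semi-invariants and the lattice of weights *)

Section Factors.
Variables (k : closedFieldType) (char_k : [pchar k] =i pred0).
Variables (N m : nat) (d : 'I_m -> nat) (act : ('I_m -> k) -> polymap k N).
Hypothesis actP : torus_action d act.
Implicit Types (t u : 'I_m -> k) (p q f g : {mpoly k[N]}) (a b : 'rV[int]_m).

Local Notation hom := (homogeneous d act).
Local Notation hom0 := (homogeneous0 d act).

Lemma hom0M a b p q : hom0 a p -> hom0 b q -> hom0 (a + b) (p * q).
Proof. exact: (homogeneous_onM (S := connected_pt d) (fun t => @proj1 _ _)). Qed.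

Lemma homM a b p q : hom a p -> hom b q -> hom (a + b) (p * q).
Proof. exact: (homogeneous_onM (S := adm d) (fun t => id)). Qed.

Lemma hom0_1 : hom0 0 1.
Proof. exact: homogeneous_on1. Qed.

Lemma hom_1 : hom 0 1.
Proof. exact: homogeneous_on1. Qed.

Lemma hom0X a p n : hom0 a p -> hom0 (a *+ n) (p ^+ n).
Proof. exact: (homogeneous_onX (S := connected_pt d) (fun t => @proj1 _ _)). Qed.

Lemma homX a p n : hom a p -> hom (a *+ n) (p ^+ n).
Proof. exact: (homogeneous_onX (S := adm d) (fun t => id)). Qed.

Lemma hom0_cancel a b p q : q != 0 -> hom0 a (p * q) -> hom0 b q -> hom0 (a - b) p.
Proof. exact: (homogeneous_on_cancel (S := connected_pt d) (fun t => @proj1 _ _)). Qed.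

Lemma hom0Z a p c : hom0 a p -> hom0 a (c *: p).
Proof. by move=> hp t Tt; rewrite comp_mpolyZ hp // !scalerA mulrC. Qed.

Lemma hom0D a p q : hom0 a p -> hom0 a q -> hom0 a (p + q).
Proof. by move=> hp hq t Tt; rewrite comp_mpolyD hp // hq // scalerDr. Qed.

Lemma hom0B a p q : hom0 a p -> hom0 a q -> hom0 a (p - q).
Proof. by move=> hp hq t Tt; rewrite comp_mpolyB hp // hq // scalerBr. Qed.

Lemma hom0_act a p t : hom0 a p -> adm d t -> hom0 a (p \mPo act t).
Proof.
move=> hp At u Tu; have [Au _] := Tu.
rewrite (act_comp actP) // -(comp_mpolyZ (chr u a)) -hp // (act_comp actP) //.
by congr (_ \mPo act _); apply: funext => i; rewrite mulrC.
Qed.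

Lemma hom0_eq a b p : (forall i, d i = 0%N -> a 0 i = b 0 i) -> hom0 a p -> hom0 b p.
Proof. by move=> ab hp t Tt; rewrite hp // (connected_chr_eq ab Tt). Qed.

(* Along a one-parameter subgroup [z], both [z ^ M p] and [z ^ M q] are
   polynomial in [z] for large [M], and their product is a monomial in [z]. *)
Lemma one_param_factor a p q i : d i = 0%N -> p != 0 -> q != 0 -> hom0 a (p * q) ->
  exists b : int, forall z, z != 0 -> p \mPo act (one_param i z) = z ^ b *: p.
Proof.
move=> di p0 q0 hpq.
have Laurent1 f : exists M : nat, forall M', (M <= M')%N -> exists F : {poly {mpoly k[N]}},
    forall z, z != 0 -> z ^+ M' *: (f \mPo act (one_param i z)) = F.[z%:MP].
  have [l hl] := action_laurent actP f.
  exists (\sum_(x <- l) `|x.1 0%R i|)%N => M' MM'.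
  exists (\sum_(x <- l) x.2%:P * 'X^(absz (x.1 0 i + M'%:Z))) => z z0.
  rewrite hl; last by case: (one_param_connected (k := k) di z0).
  rewrite horner_sum scaler_sumr !big_seq; apply: eq_bigr => x xl.
  rewrite hornerM hornerC hornerXn chr_one_param scalerA -rmorphXn /= [RHS]mulrC mul_mpolyC.
  congr (_ *: _).
  have : (`|x.1 0%R i| <= M')%N.
    by apply: leq_trans MM'; rewrite (big_rem x) //= leq_addr.
  move: (x.1 0 i) => y hy; rewrite !exprnP -expfzDr //; congr (_ ^ _); lia.
have [Mp hMp] := Laurent1 p; have [Mq hMq] := Laurent1 q.
(* The first two summands clear the negative exponents of [p] and [q]; the last one makes the
   exponent [e] of the product nonnegative. *)
pose M := (Mp + Mq + `|a 0%R i|)%N.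
have [|P hP] := hMp M; first by rewrite /M; lia.
have [|Q hQ] := hMq M; first by rewrite /M; lia.
pose e := absz (a 0 i + (M + M)%:Z).
have PQ : P * Q = (p * q)%:P * 'X^e.
  apply/eqP; rewrite -subr_eq0; apply/eqP.
  pose F := P * Q - (p * q)%:P * 'X^e.
  (* Both sides agree at all nonzero scalars; the scalars 1, ..., [size F] are already more roots
     than the degree of [F] allows. *)
  pose rs : seq {mpoly k[N]} := [seq (j.+1%:R : k)%:MP | j <- iota 0 (size F)].
  apply: (@roots_geq_poly_eq0 _ F rs).
  - apply/allP => _ /mapP[j _ ->]; have z0 : j.+1%:R != 0 :> k by apply: natr_neq0.
    rewrite /root hornerD hornerN subr_eq0 !hornerM hornerC hornerXn -hP // -hQ //.
    rewrite -[X in _ == _ * X]rmorphXn /= [X in _ == X]mulrC mul_mpolyC.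
    rewrite -scalerAl -scalerAr scalerA -rmorphM /= hpq; last exact: one_param_connected.
    rewrite chr_one_param scalerA; apply/eqP; congr (_ *: _).
    by rewrite !exprnP -!expfzDr //; congr (_ ^ _); rewrite /e /M; lia.
  - rewrite map_inj_uniq ?iota_uniq // => x y /(congr1 (mcoeff 0%MM)).
    by rewrite !mcoeffC eqxx !mulr1 => /(natr_inj char_k) [].
  - by rewrite size_map size_iota.
have [b Pb] := poly_monomial_factor (mulf_neq0 p0 q0) PQ.
have P1 : P.[1] = p.
  have := hP 1 (oner_neq0 _); rewrite expr1n scale1r mpolyC1 => <-.
  have -> : one_param i 1 = fun=> 1 by move=> n; apply: funext => j; rewrite /one_param; case: eqP.
  exact: (act_comp1 actP).
exists (b%:Z - M%:Z) => z z0; have zM : z ^+ M != 0 by rewrite expf_neq0.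
apply: (scalerI zM); rewrite hP // Pb hornerM hornerC hornerXn P1 scalerA.
by rewrite -rmorphXn /= [LHS]mulrC mul_mpolyC !exprnP -expfzDr // subrKC.
Qed.

(** The identity component is a product of one-parameter subgroups, so the exponents are found one
    free coordinate at a time. For the full group this fails: a disconnected group may permute the
    factors. *)
Lemma factor_homogeneous0 a p q : p != 0 -> q != 0 -> hom0 a (p * q) ->
  exists b, hom0 b p.
Proof.
move=> p0 q0 hpq.
have [b hb] : exists b : 'I_m -> int, forall i z, d i = 0%N -> z != 0 ->
    p \mPo act (one_param i z) = z ^ b i *: p.
  have h i : {b : int | d i = 0%N -> forall z, z != 0 -> p \mPo act (one_param i z) = z ^ b *: p}.
    apply: cid; have [di|di] := eqVneq (d i) 0%N; last by exists 0 => di0; rewrite di0 in di.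
    by have [b hb] := one_param_factor di p0 q0 hpq; exists b.
  by exists (fun i => sval (h i)) => i z di z0; apply: (svalP (h i)).
exists (\row_i b i) => t Tt; have [At ct] := Tt.
(* [t] truncated to the coordinates in [l], so that coordinates can be restored one by one. *)
pose tl (l : seq 'I_m) : 'I_m -> k := fun i => if i \in l then t i else 1.
have tl_adm l : adm d (tl l).
  by move=> i; rewrite /tl; case: ifP => // _; rewrite oner_neq0 expr1n.
have hl l : uniq l -> p \mPo act (tl l) = (\prod_(i <- l) t i ^ b i) *: p.
  elim: l => [_|i l IH /= /andP[il ul]].
    by rewrite big_nil scale1r; apply: (act_comp1 actP).
  have [di|di] := eqVneq (d i) 0%N; last first.
    rewrite big_cons ct // exp1rz mul1r -IH //; congr (_ \mPo act _).
    by apply: funext => j; rewrite /tl inE; case: eqP => // ->; rewrite (negbTE il) ct.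
  have z0 : t i != 0 by have [] := At i.
  have [Ao _] := one_param_connected (k := k) di z0.
  have -> : tl (i :: l) = fun j => tl l j * one_param i (t i) j.
    apply: funext => j; rewrite /tl /one_param inE.
    by case: eqP => [->|_]; rewrite ?(negbTE il) ?mul1r ?mulr1.
  rewrite -(act_comp actP) // IH // comp_mpolyZ hb // scalerA big_cons.
  by rewrite mulrC.
have -> : t = tl (enum 'I_m) by apply: funext => i; rewrite /tl mem_enum.
rewrite hl ?enum_uniq //; congr (_ *: _); rewrite big_enum.
by apply: eq_bigr => i _; rewrite mxE /tl mem_enum.
Qed.

(** Duality: if some elementary divisor [e i] of [L] were not 1, a scalar [z] other than 1 with
    [z ^+ e i = 1], placed in the i-th Smith coordinate, would give a nontrivial point killed by
    [L]; the multiples by [d j] in [L] place it in [adm d]. *)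
Lemma lattice_full (L : 'rV[int]_m -> Prop) : is_lattice L ->
  (forall j, L ((d j)%:Z *: delta_mx 0 j)) ->
  (forall t, adm d t -> (forall a, L a -> chr t a = 1) -> t = fun=> 1) ->
  forall c, L c.
Proof.
move=> LL Ld sep c; have [U Uu [e he]] := lattice_smith LL.
suff e1 i : e i = 1%N by apply/he => i; rewrite e1 dvd1z.
apply: contrapT => /eqP ei.
have [z z0 [ze z1]] := root_of_unity_neq1 char_k ei.
pose tau := one_param i z.
have ntau : torus_pt tau by move=> l; rewrite /tau /one_param; case: ifP; rewrite ?oner_neq0.
pose t l := chr tau (row l U).
have tL y : L y -> chr t y = 1.
  move=> /he/(_ i)/dvdzP[q hq]; rewrite /t chr_mulmx // chr_one_param hq mulrC.
  by rewrite -exprz_exp -exprnP ze exp1rz.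
have At : adm d t.
  move=> l; split; first exact: chr_neq0.
  rewrite exprnP -[t l]chr_delta -chrZ; last by move=> ?; apply: chr_neq0.
  exact: tL.
have t1 := sep t At tL.
move/negP: z1; apply; apply/eqP.
have : tau i = chr t (row i (invmx U)).
  by rewrite /t chr_mulmx // -row_mul mulVmx // rowE mulmx1 chr_delta.
by rewrite t1 chr1 /tau /one_param eqxx.
Qed.

Lemma act_trivial t : adm d t ->
  (forall a p, hom a p -> p != 0 -> chr t a = 1) -> t = fun=> 1.
Proof.
move=> At h; apply: (act_faithful actP At); apply: eq_from_tnth => l.
have [s [v [pE hv _]]] := homogeneous_decomposition actP 'X_l.
have -> : tnth (act t) l = 'X_l \mPo act t by rewrite comp_mpolyXU -tnth_nth.
rewrite /polymap_id tnth_mktuple pE raddf_sum big_seq [RHS]big_seq.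
apply: eq_bigr => a a_s /=; rewrite (hv a a_s t At).
have [->|va0] := eqVneq (v a) 0; first by rewrite scaler0.
by rewrite (h a (v a)) ?scale1r //; apply: hv.
Qed.

(** Differences of weights form a lattice. A point killed by it fixes all semi-invariants, hence
    every polynomial, and is trivial by faithfulness; so [lattice_full] applies. *)
Lemma weights_generate j : exists f g a b,
  [/\ f != 0, g != 0, hom a f, hom b g & forall t, adm d t -> chr t (a - b) = t j].
Proof.
pose W c := exists f g a b,
  [/\ f != 0, g != 0, hom a f, hom b g & forall t, adm d t -> chr t (a - b) = chr t c].
suff Wall c : W c.
  have [f [g [a [b [f0 g0 hf hg h]]]]] := Wall (delta_mx 0 j).
  by exists f, g, a, b; split=> // t At; rewrite h // chr_delta.
have LW : is_lattice W.
  split.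
    by exists 1, 1, 0, 0; rewrite oner_neq0; split=> // [||t _]; rewrite ?subr0 //; apply: hom_1.
  move=> x y [f [g [a [b [f0 g0 hf hg h]]]]] [f' [g' [a' [b' [f'0 g'0 hf' hg' h']]]]].
  exists (f * g'), (g * f'), (a + b'), (b + a'); rewrite !mulf_neq0 //; split=> //; try exact: homM.
  move=> t At; have nt := adm_torus At.
  rewrite (chrB _ y) // -h // -h' // -chrB //; congr chr; rewrite -matrixP => i l; rewrite !mxE; ring.
apply: lattice_full => // [l|t At tW].
  exists 1, 1, 0, 0; rewrite oner_neq0; split=> //; try exact: hom_1.
  move=> u Au; rewrite subr0 chr0 chrZ ?chr_delta; last exact: adm_torus Au.
  by rewrite -exprnP; have [_ ->] := Au l.
apply: act_trivial => // a p hp p0; apply: tW.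
exists p, 1, a, 0; rewrite oner_neq0.
by split=> //; [exact: hom_1 | move=> u _; rewrite subr0].
Qed.

End Factors.

(** * Pencils of semi-invariants of minimal degree *)

Section MpolySize.
Variables (k : fieldType) (N : nat).
Implicit Types p q : {mpoly k[N]}.

Lemma msize_mul_bound p q e e' : (msize p <= e.+1)%N -> (msize q <= e'.+1)%N ->
  (msize (p * q) <= (e + e').+1)%N.
Proof.
have [->|p0] := eqVneq p 0; first by rewrite mul0r msize0.
have [->|q0] := eqVneq q 0; first by rewrite mulr0 msize0.
by rewrite msizeM //; move: (msize p) (msize q) => x y hx hy; lia.
Qed.

Lemma msize_exp_bound p e n : (msize p <= e.+1)%N -> (msize (p ^+ n) <= (n * e).+1)%N.
Proof.
move=> pe; elim: n => [|n IH]; first by rewrite expr0 msize1.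
by rewrite exprS mulSn; apply: msize_mul_bound.
Qed.

Lemma msize_prod_bound (I : Type) (r : seq I) (F : I -> {mpoly k[N]}) e :
  (forall i, msize (F i) <= e.+1)%N -> (msize (\prod_(i <- r) F i) <= (size r * e).+1)%N.
Proof.
move=> Fe; elim: r => [|i r IH]; first by rewrite big_nil msize1.
by rewrite big_cons /= mulSn; apply: msize_mul_bound.
Qed.

Lemma msize_linear_bound p q (c : k) e : (msize p <= e)%N -> (msize q <= e)%N ->
  (msize (p - c *: q) <= e)%N.
Proof.
move=> pe qe; apply: leq_trans (msizeD_le _ _) _.
by rewrite geq_max pe msizeN; apply: leq_trans (msizeZ_le _ _) qe.
Qed.

Lemma msize_nonunit p : p != 0 -> p \isn't a GRing.unit -> (1 < msize p)%N.
Proof.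
move=> p0; apply: contraR; rewrite -leqNgt => /msize1_polyC pC.
have c0 : p@_0 != 0 by move: p0; rewrite {1}pC mpolyC_eq0.
by rewrite pC; apply: (rmorph_unit (@mpolyC N k)); rewrite unitfE.
Qed.

Lemma msize_cofactor p q z : p != 0 -> q != 0 -> q \isn't a GRing.unit ->
  (msize (p * q) <= z.+1)%N -> (msize p <= z)%N.
Proof.
move=> p0 q0 /(msize_nonunit q0); rewrite msizeM //; have := mpolySpred mdeg p0.
by move: (msize p) (msize q) => x y; lia.
Qed.

(** A monomial of total degree at most [B] has all exponents at most [B], so the coefficients
    indexed by the box determine the polynomial. *)
Lemma box_span (I : finType) (v : I -> {mpoly k[N]}) (a : I -> k) B :
  (forall i, msize (v i) <= B.+1)%N ->
  (forall y : {ffun 'I_N -> 'I_B.+1}, \sum_i a i * (v i)@_(box_monomial y) = 0) ->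
  \sum_i a i *: v i = 0.
Proof.
move=> vB h; apply/mpolyP => e; rewrite mcoeff0 raddf_sum /=.
have [eB|eB] := leqP (mdeg e) B.
  pose y : {ffun 'I_N -> 'I_B.+1} := [ffun i => inord (e i)].
  have -> : e = box_monomial y.
    apply/mnmP => i; rewrite mnmE ffunE inordK // ltnS; apply: leq_trans eB.
    by rewrite mdegE (bigD1 i) //= leq_addr.
  by rewrite -[RHS](h y); apply: eq_bigr => i _; rewrite mcoeffZ.
rewrite big1 // => i _; rewrite mcoeffZ memN_msupp_eq0 ?mulr0 //.
by apply: contraL eB => /msize_mdeg_lt h'; rewrite -leqNgt -ltnS; apply: leq_trans h' (vB i).
Qed.

Lemma box_dependence (I : finType) (v : I -> {mpoly k[N]}) B :
  (forall i, msize (v i) <= B.+1)%N -> (B.+1 ^ N < #|I|)%N ->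
  exists2 a : I -> k, (exists i, a i != 0) & \sum_i a i *: v i = 0.
Proof.
move=> vB cI.
have [|a a0 ha] := @linear_dependence k I {ffun 'I_N -> 'I_B.+1} (fun i y => (v i)@_(box_monomial y)).
  by rewrite card_box.
by exists a => //; apply: box_span vB ha.
Qed.

End MpolySize.

Section Pencil.
Variables (k : closedFieldType) (char_k : [pchar k] =i pred0).
Variables (n m : nat) (d : 'I_m -> nat) (act : ('I_m -> k) -> polymap k n.+1).
Hypothesis actP : torus_action d act.
Local Notation free := [set i | d i == 0%N].
Hypothesis card_free : #|free| = n.
Local Notation A := {mpoly k[n.+1]}.
Implicit Types (t u : 'I_m -> k) (p q f g : A) (a b : 'rV[int]_m).
Local Notation hom := (homogeneous d act).
Local Notation hom0 := (homogeneous0 d act).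

Definition indep f g : Prop := forall x y : k, x *: f + y *: g = 0 -> x = 0 /\ y = 0.

Definition pencil a f g : Prop := [/\ hom0 a f, hom0 a g & indep f g].

Lemma not_indep p q : p != 0 -> ~ indep p q -> exists c, q = c *: p.
Proof.
move=> p0 /existsNP[x /existsNP[y /not_implyP[e nxy]]].
have y0 : y != 0.
  apply: contra_notN nxy => /eqP y0; split=> //; move/eqP: e.
  by rewrite y0 scale0r addr0 scaler_eq0 (negbTE p0) orbF => /eqP.
exists (- (y^-1 * x)); apply: (scalerI y0).
by rewrite scalerA mulrN mulrA mulfV // mul1r scaleNr; apply/eqP; rewrite -addr_eq0 addrC e.
Qed.

Lemma indep_neq0 f g : indep f g -> f != 0 /\ g != 0.
Proof.
move=> ifg; split; apply/eqP => e.
  have [|/eqP] := ifg 1 0; last by rewrite oner_eq0.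
  by rewrite e scaler0 scale0r addr0.
have [|_ /eqP] := ifg 0 1; last by rewrite oner_eq0.
by rewrite e scaler0 scale0r addr0.
Qed.

Lemma indep_member f g (c : k) : indep f g -> f - c *: g != 0.
Proof.
move=> ifg; apply/eqP => e; have [|/eqP] := ifg 1 (- c); last by rewrite oner_eq0.
by rewrite scale1r scaleNr.
Qed.

Lemma free_weight a i : d i = 0%N -> (forall t, adm d t -> chr t a = t i) ->
  forall j, d j = 0%N -> a 0 j = (i == j)%:R.
Proof.
move=> di h j dj; apply: (exprz2_inj char_k).
have n2 : 2%:R != 0 :> k by apply: natr_neq0.
have [At _] := one_param_connected (k := k) dj n2.
rewrite -(chr_one_param j) h // /one_param; case: eqP => _; last by rewrite expr0z.
by rewrite expr1z.
Qed.

(* If all weight spaces were lines, the polynomials of degree at most [B] would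
   span a space of dimension [O(B ^ n)], but there are [n + 1] variables. *)
Lemma pencil_exists : exists a f g, pencil a f g.
Proof.
apply: contrapT => nop.
have line a p q : p != 0 -> hom0 a p -> hom0 a q -> exists c, q = c *: p.
  move=> p0 hp hq; apply: not_indep => // ipq.
  by apply: nop; exists a, p, q.
have hl i : {l : seq ('rV[int]_m * A) | {in l, forall x, hom0 x.1 x.2} & 'X_i = \sum_(x <- l) x.2}.
  apply: cid2; have [s [v [pE hv _]]] := homogeneous_decomposition actP 'X_i.
  exists [seq (a, v a) | a <- s]; last by rewrite big_map.
  by move=> x /mapP[a a_s ->]; apply: homogeneous_weak; apply: hv.
pose l i := s2val (hl i).
pose D := (\sum_i \sum_(x <- l i) \sum_j `|x.1 0%R j|)%N.
have lD i x j : x \in l i -> (`|x.1 0%R j| <= D)%N.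
  move=> xl; rewrite /D (bigD1 i) //= (big_rem x) //= (bigD1 j) //=; lia.
pose Fil B (h : unit -> A) := exists l : seq ('rV[int]_m * A),
  [/\ forall x j, x \in l -> (`|x.1 0%R j| <= D * B)%N,
      {in l, forall x, hom0 x.1 x.2} & h tt = \sum_(x <- l) x.2].
(* Free entries of the weight run through the box; torsion entries are set to 0, which does not
   change the character on the identity component. *)
pose wt B (y : {ffun 'I_#|free| -> 'I_(2 * (D * B)).+1}) : 'rV[int]_m :=
  \row_i (if insub i is Some j then (y (enum_rank_in (svalP (j : {i | i \in free})) (sval j)))%:Z - (D * B)%:Z else 0).
(* Under the contradiction hypothesis every weight space is spanned by one element, possibly 0. *)
have gen a : {p : A | hom0 a p & forall q, hom0 a q -> exists c, q = c *: p}.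
  apply: cid2; have [[p [p0 hp]]|np] := EM (exists p, p != 0 /\ hom0 a p).
    by exists p => // q hq; apply: line hp hq.
  exists 0; first by move=> t _; rewrite comp_mpoly0 scaler0.
  move=> q hq; exists 0; rewrite scaler0; apply: contrapT => /eqP q0.
  by apply: np; exists q.
pose w B y (_ : unit) := s2val (gen (wt B y)).
(* The filtration lives on polynomials themselves, viewed as functions on a point; evaluating [P] at
   the variables gives back [P], so the relation found says [P = 0]. *)
have [||||||P P0 hP] := @growth_dependence k unit (fun=> True) A (@mpolyC n.+1 k) Fil _ w
   ((2 * D).+1 ^ n)%N n n.+1 (fun i _ => 'X_i) _ _ _ _ _ _ (leqnn _).
- exists [:: (0, 1)]; split; last by rewrite big_seq1.
    by move=> x j; rewrite inE => /eqP -> /=; rewrite mxE.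
  by move=> x; rewrite inE => /eqP ->; apply: hom0_1.
- exists [:: (0, 1)]; split; last by rewrite big_seq1.
    by move=> x j; rewrite inE => /eqP -> /=; rewrite mxE.
  by move=> x; rewrite inE => /eqP ->; apply: hom0_1.
- move=> B B' f1 f2 [l1 [b1 h1 e1]] [l2 [b2 h2 e2]].
  exists [seq (x.1 + y.1, x.2 * y.2) | x <- l1, y <- l2]; split.
  + move=> z j /allpairsP[[x y] [xl yl ->]] /=; rewrite mxE.
    have := b1 _ j xl; have := b2 _ j yl; rewrite mulnDr /=; lia.
  + by move=> z /allpairsP[[x y] [xl yl ->]] /=; apply: hom0M; [apply: h1 | apply: h2].
  rewrite e1 e2 big_allpairs_dep mulr_suml; apply: eq_bigr => x _.
  by rewrite mulr_sumr.
- move=> B h [l' [bl hl' e]].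
  have key x : x \in l' -> exists y c, x.2 = c *: w B y tt.
    move=> xl; pose y : {ffun 'I_#|free| -> 'I_(2 * (D * B)).+1} :=
      [ffun i => inord (absz (x.1 0 (enum_val i) + (D * B)%:Z))].
    have hx : hom0 (wt B y) x.2.
      apply: hom0_eq (hl' x xl) => i di; rewrite mxE insubT => [|ji].
        by rewrite inE di.
      rewrite /= ffunE enum_rankK_in //.
      move: (x.1 0 i) (bl x i xl) => z hz; rewrite inordK; lia.
    by have [c hc] := s2valP' (gen (wt B y)) _ hx; exists y, c.
  have sumc (l0 : seq ('rV[int]_m * A)) : {subset l0 <= l'} ->
      exists c : _ -> k, \sum_(x <- l0) x.2 = \sum_y (c y)%:MP * w B y tt.
    elim: l0 => [|x l0 IH] sl.
      exists (fun=> 0); rewrite big_nil big1 // => y _; by rewrite mpolyC0 mul0r.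
    have [c hc] := IH (fun z zl => sl z (mem_behead (s := x :: l0) zl)).
    have [y [cy hy]] := key x (sl x (mem_head _ _)).
    exists (fun z => (if z == y then cy else 0) + c z).
    rewrite big_cons hc // hy //.
    under [RHS]eq_bigr do rewrite mpolyCD mulrDl.
    rewrite big_split /=; congr (_ + _).
    rewrite (bigD1 y) //= eqxx big1 ?addr0 ?mul_mpolyC // => z /negbTE ->.
    by rewrite mpolyC0 mul0r.
  by have [c hc] := sumc l' (fun _ => id); exists c => -[] _; rewrite e hc.
- move=> B; rewrite card_ffun !card_ord card_free -expnMn.
  case: (n) => [|r']; first by rewrite !expn0.
  by rewrite leq_exp2r // mulSn mulnS; lia.
- move=> i; exists (l i); split=> [x j xl||].
  + by rewrite muln1; apply: lD xl.
  + exact: (s2valP (hl i)).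
  + exact: (s2valP' (hl i)).
- move/eqP: P0; apply; rewrite -[RHS](hP tt I) -[LHS]comp_mpoly_id.
  apply: eq_bigr => e _; congr (_ * _); apply: mmap1_eq => i.
  by rewrite tnth_mktuple.
Qed.

(** An algebraic relation between the invariants [f / g] and [p / q] of the identity component, in
    bihomogeneous form. Their monomials are multiplied by powers of [F l / G l], whose weights are
    the [n] free coordinates: so many products of bounded degree in [n + 1] variables are dependent,
    and independence of weights isolates a relation in [f], [g], [p], [q]. *)
Lemma pencil_relation a b f g p q : hom0 a f -> hom0 a g -> hom0 b p -> hom0 b q ->
    f != 0 -> g != 0 -> p != 0 -> q != 0 ->
  exists M (c : 'I_M.+1 -> 'I_M.+1 -> k), (exists i j, c i j != 0) /\
    \sum_i \sum_j c i j *: (f ^+ i * g ^+ (M - i) * (p ^+ j * q ^+ (M - j))) = 0.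
Proof.
move=> hf hg hp hq f0 g0 p0 q0.
have gens (l : 'I_#|free|) : {x : (A * A) * ('rV[int]_m * 'rV[int]_m) |
    [/\ x.1.1 != 0, x.1.2 != 0, hom0 x.2.1 x.1.1, hom0 x.2.2 x.1.2 &
     forall j, d j = 0%N -> (x.2.1 - x.2.2) 0 j = (enum_val l == j)%:R]}.
  apply: cid; have [F [G [x [y [F0 G0 hF hG xy]]]]] := weights_generate char_k actP (enum_val l).
  exists ((F, G), (x, y)); split=> //=; try exact: homogeneous_weak.
  by apply: free_weight xy; have := enum_valP l; rewrite inE => /eqP.
pose F l := (sval (gens l)).1.1; pose G l := (sval (gens l)).1.2.
pose wF l := (sval (gens l)).2.1; pose wG l := (sval (gens l)).2.2.
pose D := (msize f + msize g + msize p + msize q + \sum_l (msize (F l) + msize (G l)))%N.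
have [Df Dg Dp Dq] : [/\ msize f <= D.+1, msize g <= D.+1, msize p <= D.+1 & msize q <= D.+1]%N.
  by rewrite /D; split; lia.
have DFG l : (msize (F l) <= D.+1)%N /\ (msize (G l) <= D.+1)%N.
  by rewrite /D (bigD1 l) //=; split; lia.
(* The products have degree at most [(4 + 2 * n) * D * M], from four powers in [w] and [2 * n] in
   [h]. With [M = K ^ (n + 1)] the box has at most [M * (M + 1) ^ (n + 1)] points, fewer than the
   [(M + 1) ^ (n + 2)] products. *)
pose K := ((4 + 2 * n) * D).+1; pose M := (K ^ n.+1)%N.
pose w (x : 'I_M.+1 * 'I_M.+1) : A :=
  f ^+ x.1 * g ^+ (M - x.1) * (p ^+ x.2 * q ^+ (M - x.2)).
pose h (y : {ffun 'I_#|free| -> 'I_M.+1}) : A := \prod_l (F l ^+ y l * G l ^+ (M - y l)).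
have eD p' e : (msize p' <= D.+1)%N -> (e <= M)%N -> (msize (p' ^+ e) <= (M * D).+1)%N.
  move=> p'D eM; apply: leq_trans (msize_exp_bound e p'D) _.
  by rewrite ltnS leq_mul2r eM orbT.
have wB x : (msize (w x) <= (4 * (M * D)).+1)%N.
  apply: (@leq_trans ((M * D + M * D) + (M * D + M * D)).+1); last by lia.
  by apply: msize_mul_bound; apply: msize_mul_bound; apply: eD; rewrite ?leq_subr // -ltnS.
have hB y : (msize (h y) <= (n * (M * D + M * D)).+1)%N.
  have := @msize_prod_bound k n.+1 _ (enum 'I_#|free|) (fun l => F l ^+ y l * G l ^+ (M - y l)) (M * D + M * D).
  rewrite size_enum_ord big_enum => H; apply: leq_trans (H _) _; last by rewrite card_free.
  move=> l.
  by have [FD GD] := DFG l; apply: msize_mul_bound; apply: eD; rewrite ?leq_subr // -ltnS.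
pose v (z : ('I_M.+1 * 'I_M.+1) * {ffun 'I_#|free| -> 'I_M.+1}) := w z.1 * h z.2.
have [||c [[x0 y0] c0] sumc] := @box_dependence k n.+1 _ v ((4 + 2 * n) * D * M)%N.
- move=> z; have -> : ((4 + 2 * n) * D * M = 4 * (M * D) + n * (M * D + M * D))%N by lia.
  exact: msize_mul_bound.
- rewrite !card_prod !card_ord card_box card_free.
  apply: (@leq_ltn_trans ((K * M.+1) ^ n.+1)).
    by rewrite leq_exp2r // /K; lia.
  by rewrite expnMn -/M -mulnA -expnS ltn_pmul2r ?expn_gt0.
have ww x : hom0 (a *+ M + b *+ M) (w x).
  have xe (e : 'I_M.+1) (r : 'rV[int]_m) : r *+ M = r *+ e + r *+ (M - e).
    by rewrite -mulrnDr subnKC // -ltnS.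
  by rewrite (xe x.1 a) (xe x.2 b); apply: hom0M; apply: hom0M; apply: hom0X.
(* All [w x] have the same weight, so the weight of a product depends on [y] alone; its free entries
   are those of [y] plus a constant. *)
pose wy (y : {ffun 'I_#|free| -> 'I_M.+1}) : 'rV[int]_m := a *+ M + b *+ M + \sum_l (wF l *+ (y l : 'I_M.+1) + wG l *+ (M - y l)).
have hy (y : {ffun 'I_#|free| -> 'I_M.+1}) : hom0 (\sum_l (wF l *+ (y l : 'I_M.+1) + wG l *+ (M - y l))) (h y).
  rewrite /h; elim: (index_enum _) => [|l r IH]; first by rewrite !big_nil; apply: hom0_1.
  rewrite !big_cons; apply: hom0M => //.
  by have [_ _ hF hG _] := svalP (gens l); apply: hom0M; apply: hom0X.
have h0 (y : {ffun 'I_#|free| -> 'I_M.+1}) : h y != 0.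
  apply/prodf_neq0 => l _; have [F0 G0 _ _ _] := svalP (gens l).
  by rewrite mulf_neq0 // expf_neq0.
have indy := @homogeneous0_independence k char_k n.+1 m d act _ (index_enum _) wy
  (fun y => (\sum_x c (x, y) *: w x) * h y).
have : (\sum_x c (x, y0) *: w x) * h y0 = 0.
  apply: indy.
  - exact: index_enum_uniq.
  - move=> y y' _ _ /eqP yy'.
    have [l yl] : exists l, y l != y' l.
      apply: contrapT => nl; apply: yy'; apply/ffunP => l.
      by apply/eqP; apply: contrapT => /negP yl; apply: nl; exists l.
    have dl : d (enum_val l) = 0%N by have := enum_valP l; rewrite inE => /eqP.
    exists (enum_val l) => //.
    have wyE z : wy z 0 (enum_val l) =
       (a *+ M + b *+ M + \sum_l wG l *+ M) 0 (enum_val l) + (z l : nat)%:Z.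
      rewrite !mxE -[RHS]addrA; congr (_ + _).
      have -> : \sum_j (wF j *+ z j + wG j *+ (M - z j)) =
         \sum_j wG j *+ M + \sum_j (wF j - wG j) *+ z j.
        rewrite -big_split; apply: eq_bigr => j _ /=.
        have zM : (z j <= M)%N by rewrite -ltnS.
        by rewrite mulrnBl mulrnBr // addrCA addrC -addrA; congr (_ + _); rewrite addrC.
      rewrite mxE; congr (_ + _); rewrite summxE (bigD1 l) //= big1 => [|j jl].
        have [_ _ _ _ e] := svalP (gens l).
        by rewrite -scaler_nat mxE e // eqxx mulr1 addr0 natz.
      have [_ _ _ _ e] := svalP (gens j).
      by rewrite -scaler_nat mxE e // (inj_eq enum_val_inj) (negbTE jl) mulr0.
    rewrite !wyE (inj_eq (addrI _)); apply: contra yl => /eqP[e].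
    by apply/eqP/val_inj.
  - move=> y _; apply: hom0M => //.
    elim: (index_enum _) => [|x r IH].
      by rewrite big_nil => t _; rewrite comp_mpoly0 scaler0.
    by rewrite big_cons; apply: hom0D => //; apply: hom0Z.
  - rewrite -[RHS]sumc; transitivity (\sum_y \sum_x c (x, y) *: v (x, y)).
      by apply: eq_bigr => y _; rewrite mulr_suml; apply: eq_bigr => x _; rewrite -scalerAl.
    by rewrite exchange_big pair_bigA; apply: eq_bigr => -[x y] _.
  - by rewrite mem_index_enum.
move/eqP; rewrite mulf_eq0 (negbTE (h0 _)) orbF => /eqP e.
exists M, (fun i j => c ((i, j), y0)); split; first by exists x0.1, x0.2; case: x0 c0 {e}.
by rewrite pair_bigA -[RHS]e; apply: eq_bigr => -[i j].
Qed.

End Pencil.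

(** * Prime divisors of binary forms *)

Section PrimeDivisors.
Variables (k : closedFieldType) (char_k : [pchar k] =i pred0) (N : nat).
Local Notation A := {mpoly k[N]}.
Implicit Types (p q r : A).

Lemma irreducible_prime p : irreducible_elt p -> prime_elt p.
Proof. by have [_] := factorial_mpoly k N; apply. Qed.

Lemma dividesZ p q (c : k) : c != 0 -> divides p (c *: q) -> divides p q.
Proof.
move=> c0 [r e]; exists (c^-1 *: r).
by rewrite -scalerAl -e scalerA mulVf // scale1r.
Qed.

Lemma divides_scale p q (c : k) : divides p q -> divides p (c *: q).
Proof. by case=> r ->; exists (c *: r); rewrite scalerAl. Qed.

Lemma prime_dividesX p q e : p \isn't a GRing.unit -> prime_elt p ->
  divides p (q ^+ e) -> divides p q.
Proof.
move=> pU pp; elim: e => [[c /esym e]|e IH].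
  by case/negP: pU; apply/unitrP; exists c; rewrite [p * c]mulrC expr0 in e *.
by rewrite exprS => /pp[].
Qed.

Lemma avoid_seq (E : seq k) : exists x, x \notin E.
Proof.
apply: contrapT => nx.
have all_E x : x \in E by apply: contrapT => /negP xE; apply: nx; exists x.
pose s : seq k := [seq j%:R | j <- iota 0 (size E).+1].
have us : uniq s by rewrite map_inj_uniq ?iota_uniq // => x y /(natr_inj char_k).
have := uniq_leq_size us (fun x _ => all_E x).
by rewrite size_map size_iota ltnn.
Qed.

Lemma poly_root_seq (P : {poly k}) : P != 0 -> exists E : seq k, forall x, x \notin E -> P.[x] != 0.
Proof.
move=> P0; have [r hr] := closed_field_poly_normal P.
exists r => x; apply: contra => /eqP Px.
by have : root P x by [apply/eqP]; rewrite hr rootZ ?lead_coef_eq0 // root_prod_XsubC.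
Qed.

(** The homogenization of [P] in degree [M], taken at [p] and [q]; if [P] has smaller degree, the
    defect appears as a power of [q]. *)
Definition binary_form M (P : {poly k}) p q : A :=
  \sum_(j < M.+1) P`_j *: (p ^+ j * q ^+ (M - j)).

Lemma binary_form_XsubC M (P : {poly k}) c p q : (size P <= M.+1)%N ->
  binary_form M.+1 (P * ('X - c%:P)) p q = (p - c *: q) * binary_form M P p q.
Proof.
move=> sP; rewrite mulrBr mulrBl.
have -> : binary_form M.+1 (P * 'X - P * c%:P) p q =
    binary_form M.+1 (P * 'X) p q - c *: binary_form M.+1 P p q.
  rewrite /binary_form scaler_sumr -sumrB; apply: eq_bigr => j _.
  by rewrite coefB coefMC scalerBl scalerA [c * _]mulrC.
congr (_ - _).
  rewrite /binary_form big_ord_recl coefMX eqxx scale0r add0r mulr_sumr.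
  apply: eq_bigr => j _; rewrite coefMX lift0 /= subSS exprS -scalerAr.
  by rewrite mulrA.
rewrite -scalerAl; congr (_ *: _).
rewrite /binary_form big_ord_recr /= [P`_M.+1]nth_default // scale0r addr0 mulr_sumr.
apply: eq_bigr => j _; rewrite -scalerAr subSn; last by rewrite -ltnS.
by congr (_ *: _); rewrite exprS; ring.
Qed.

(** Over an algebraically closed field the form is, up to a scalar, a product of linear forms
    [p - c *: q] and a power of [q]; a prime dividing it divides one of these, and [q] is
    excluded. *)
Lemma prime_divides_form M (P : {poly k}) r p q :
  irreducible_elt r -> ~ divides r q -> P != 0 -> (size P <= M.+1)%N ->
  divides r (binary_form M P p q) -> exists c, divides r (p - c *: q).
Proof.
move=> ir nq; have pr := irreducible_prime ir; have [r0 rU _] := ir.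
elim: M P => [|M IH] P P0 sP.
  rewrite /binary_form big_ord_recl big_ord0 addr0 mulr1 expr0 => /dividesZ h.
  suff /h [c e] : P`_0 != 0 by case/negP: rU; apply/unitrP; exists c; rewrite [r * c]mulrC -e.
  by rewrite -polyC_eq0 -(size1_polyC sP).
have [s1|s1] := eqVneq (size P) 1%N.
  have Pj (j : nat) : (0 < j)%N -> P`_j = 0 by move=> j0; rewrite nth_default // s1.
  rewrite /binary_form big_ord_recl big1 ?addr0 => [|j _]; last by rewrite Pj // scale0r.
  rewrite expr0 mul1r => /dividesZ h.
  have /h /(prime_dividesX rU pr) // : P`_0 != 0.
  by rewrite -polyC_eq0 -size1_polyC // s1.
have [c] := closed_rootP P s1; case/factor_theorem => Q eP.
have Q0 : Q != 0 by move: P0; rewrite eP mulf_eq0 negb_or => /andP[].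
have sQ : (size Q <= M.+1)%N by move: sP; rewrite eP size_Mmonic ?monicXsubC // size_XsubC addn2.
rewrite eP binary_form_XsubC // => /pr[]; first by exists c.
exact: IH.
Qed.

End PrimeDivisors.

Section MinimalPencil.
Variables (k : closedFieldType) (char_k : [pchar k] =i pred0).
Variables (n m : nat) (d : 'I_m -> nat) (act : ('I_m -> k) -> polymap k n.+1).
Hypothesis actP : torus_action d act.
Local Notation free := [set i | d i == 0%N].
Hypothesis card_free : #|free| = n.
Local Notation A := {mpoly k[n.+1]}.
Implicit Types (t u : 'I_m -> k) (p q : A) (a b : 'rV[int]_m).
Local Notation hom := (homogeneous d act).
Local Notation hom0 := (homogeneous0 d act).
Local Notation pencil := (pencil d act).

Variables (w : 'rV[int]_m) (f g : A).
Hypothesis pfg : pencil w f g.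
Hypothesis min_fg : forall a p q, pencil a p q ->
  (maxn (msize f) (msize g) <= maxn (msize p) (msize q))%N.

Let hf : hom0 w f. Proof. by case: pfg. Qed.
Let hg : hom0 w g. Proof. by case: pfg. Qed.
Let ifg : indep f g. Proof. by case: pfg. Qed.
Let f0 : f != 0. Proof. by case: (indep_neq0 ifg). Qed.
Let g0 : g != 0. Proof. by case: (indep_neq0 ifg). Qed.

(** A common factor is semi-invariant by [factor_homogeneous0]; dividing it out would leave a pencil
    of smaller degree. *)
Lemma pencil_coprime p : p \isn't a GRing.unit -> divides p f -> divides p g -> False.
Proof.
move=> pU [f' ef] [g' eg].
have f'0 : f' != 0 by move: f0; rewrite ef mulf_eq0 negb_or => /andP[].
have g'0 : g' != 0 by move: g0; rewrite eg mulf_eq0 negb_or => /andP[].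
have p0 : p != 0 by move: f0; rewrite ef mulf_eq0 negb_or => /andP[].
have [b hp] : exists b, hom0 b p.
  by apply: (factor_homogeneous0 char_k actP (a := w) p0 f'0); rewrite mulrC -ef.
have hf' : hom0 (w - b) f' by apply: (hom0_cancel p0) hp; rewrite -ef.
have hg' : hom0 (w - b) g' by apply: (hom0_cancel p0) hp; rewrite -eg.
have pen : pencil (w - b) f' g'.
  split=> // x y e; apply: ifg; rewrite ef eg.
  by rewrite !scalerAl -mulrDl e mul0r.
have := min_fg pen.
have sp := msize_nonunit p0 pU.
rewrite ef eg !msizeM //.
have := mpolySpred mdeg f'0; have := mpolySpred mdeg g'0; move: sp.
by move: (msize p) (msize f') (msize g') => x y z; lia.
Qed.

Lemma distinct_members p (x y : k) : p \isn't a GRing.unit -> x != y ->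
  divides p (f - x *: g) -> divides p (f - y *: g) -> False.
Proof.
move=> pU xy dx dy; have dg : divides p g.
  apply: (@dividesZ _ _ _ _ (y - x)); first by rewrite subr_eq0 eq_sym.
  have -> : (y - x) *: g = (f - x *: g) - (f - y *: g) by rewrite scalerBl; ring.
  exact: dividesB.
apply: (pencil_coprime pU) => //; rewrite -(subrK (x *: g) f).
by apply: dividesD => //; apply: divides_scale.
Qed.

(** Two unit members would be constants, and a combination of them would contradict independence; so
    at most one parameter is excluded. *)
Lemma generic_nonunit : exists E : seq k, forall x, x \notin E -> f - x *: g \isn't a GRing.unit.
Proof.
have [[x xU]|nx] := EM (exists x, f - x *: g \is a GRing.unit); last first.
  by exists [::] => x _; apply/negP => xU; apply: nx; exists x.
exists [:: x] => y; rewrite inE => yx; apply/negP => yU.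
have fC z : f - z *: g \is a GRing.unit -> f - z *: g = ((f - z *: g)@_0)%:MP by case/andP => /eqP.
move: (fC x xU) (fC y yU); set u := _@_0; set v := _@_0 => eu ev.
have [|/eqP] := @ifg (v - u) (u * y - v * x).
  have -> : (v - u) *: f + (u * y - v * x) *: g = v *: (f - x *: g) - u *: (f - y *: g).
    by rewrite !scalerBl !scalerBr !scalerA; ring.
  by rewrite eu ev -!mul_mpolyC -!mpolyCM mulrC subrr.
rewrite subr_eq0 => /eqP -> /eqP; rewrite -mulrBr mulf_eq0 subr_eq0 (negbTE yx) orbF => /eqP u0.
by have := indep_member x ifg; rewrite eu u0 mpolyC0 eqxx.
Qed.

(* Infinitely many reducible members would have semi-invariant factors of pairwise
   distinct weights, since a coincidence of weights gives a smaller pencil. *)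
Lemma generic_irreducible : exists E : seq k, forall x, x \notin E -> irreducible_elt (f - x *: g).
Proof.
apply: contrapT => noE; have [E0 nuE0] := generic_nonunit.
have bad (E : seq k) : exists x, x \notin E /\ exists p q,
    [/\ p \isn't a GRing.unit, q \isn't a GRing.unit & f - x *: g = p * q].
  have : ~ forall x, x \notin E ++ E0 -> irreducible_elt (f - x *: g).
    by move=> h; apply: noE; exists (E ++ E0).
  case/existsNP => x /not_implyP[]; rewrite mem_cat negb_or => /andP[xE xE0] nirr.
  exists x; split=> //; apply: contrapT => npq; apply: nirr; split.
  - exact: indep_member.
  - exact: nuE0.
  - move=> p q e; have [pU|pU] := boolP (p \is a GRing.unit); first by left.
    by have [qU|qU] := boolP (q \is a GRing.unit); [right | case: npq; exists p, q].
pose D := maxn (msize f) (msize g).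
(* One more than the number of exponents in the box of degree [D], so that the factors chosen for
   these parameters are linearly dependent. *)
have [s [us ss bads]] : exists s : seq k, [/\ uniq s, size s = (D.+1 ^ n.+1).+1 &
    forall x, x \in s -> exists p q,
      [/\ p \isn't a GRing.unit, q \isn't a GRing.unit & f - x *: g = p * q]].
  elim: (_.+1) => [|z [s [us ss bs]]]; first by exists [::].
  have [x [xs hx]] := bad s; exists (x :: s); split=> /=; rewrite ?xs ?ss //.
  by move=> y; rewrite inE => /orP[/eqP ->|/bs].
have hP x : {pb : A * 'rV[int]_m | x \in s ->
    [/\ pb.1 \isn't a GRing.unit, divides pb.1 (f - x *: g), pb.1 != 0,
        hom0 pb.2 pb.1 & (msize pb.1 < D)%N]}.
  apply: cid; have [xs|xs] := boolP (x \in s); last by exists (0, 0).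
  have [p [q [pU qU e]]] := bads x xs.
  have := indep_member x ifg; rewrite e mulf_eq0 negb_or => /andP[p0 q0].
  have hfg : hom0 w (p * q) by rewrite -e; apply: hom0B => //; apply: hom0Z.
  have [b hp] := factor_homogeneous0 char_k actP p0 q0 hfg.
  have dp : divides p (f - x *: g) by exists q; rewrite e mulrC.
  have sp : (msize p < D)%N.
    have : (msize (p * q) <= D)%N.
      by rewrite -e; apply: msize_linear_bound; rewrite /D ?leq_maxl ?leq_maxr.
    rewrite msizeM //; move: (msize_nonunit q0 qU).
    by have := mpolySpred mdeg p0; move: (msize p) (msize q) => x' y'; lia.
  by rewrite -e; exists (p, b) => _; split.
pose P x := (sval (hP x)).1; pose W x := (sval (hP x)).2.
have dist : {in s &, forall x y, x != y -> exists2 i, d i = 0%N & W x 0 i != W y 0 i}.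
  move=> x y xs ys xy; apply: contrapT => nW.
  have [xU dx x0 hx sx] := svalP (hP x) xs; have [yU dy y0 hy sy] := svalP (hP y) ys.
  have {}hy : hom0 (W x) (P y).
    apply: hom0_eq hy => i di; apply/esym/eqP; apply: contrapT => /negP Wi.
    by apply: nW; exists i.
  (* Two independent factors of equal weight would form a pencil of degree below the minimum;
     proportional ones will be a common factor of two members. *)
  have [c e] : exists c, P y = c *: P x.
    apply: not_indep => // ixy; have /min_fg : pencil (W x) (P x) (P y) by [].
    by rewrite leqNgt /= gtn_max sx sy.
  apply: (distinct_members xU xy) => //; apply: divides_trans dy.
  by rewrite -/(P y) e; exists (c%:MP); rewrite mul_mpolyC.
have [||a [i ai] sum0] := @box_dependence k n.+1 'I_(size s) (fun i => P (nth 0 s i)) D.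
- move=> i; have [_ _ _ _] := svalP (hP (nth 0 s i)) (mem_nth 0 (ltn_ord i)).
  by move=> h; apply: leqW; apply: ltnW.
- by rewrite card_ord ss.
have := @homogeneous0_independence k char_k n.+1 m d act _ (index_enum 'I_(size s))
   (fun i => W (nth 0 s i)) (fun i => a i *: P (nth 0 s i)).
move=> /(_ (index_enum_uniq _)) h.
have /eqP : a i *: P (nth 0 s i) = 0.
  apply: h; rewrite ?mem_index_enum //.
    move=> x y _ _ xy; apply: dist; rewrite ?mem_nth //.
    by rewrite nth_uniq.
  move=> x _; apply: hom0Z.
  by have [] := svalP (hP (nth 0 s x)) (mem_nth 0 (ltn_ord x)).
rewrite scaler_eq0 (negbTE ai) /=.
by have [_ _ /negbTE ->] := svalP (hP (nth 0 s i)) (mem_nth 0 (ltn_ord i)).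
Qed.

(** Members are pairwise coprime, so only finitely many irreducible ones divide a nonzero [q]:
    dividing one out lowers the degree. *)
Lemma generic_not_dividing q : q != 0 -> exists E : seq k, forall x, x \notin E ->
  irreducible_elt (f - x *: g) /\ ~ divides (f - x *: g) q.
Proof.
have [E0 hE0] := generic_irreducible.
move: {2}(msize q) (leqnn (msize q)) => z; elim: z q => [|z IH] q sq q0.
  by move: sq; rewrite leqn0 msize_poly_eq0 (negbTE q0).
have [[x [xE [r er]]]|nx] := EM (exists x, x \notin E0 /\ divides (f - x *: g) q); last first.
  by exists E0 => x xE; split; [exact: hE0 | move=> dq; apply: nx; exists x].
have ix := hE0 x xE; have [x0 xU _] := ix.
have r0 : r != 0 by move: q0; rewrite er mulf_eq0 negb_or => /andP[].
have [|E hE] := IH r _ r0.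
  move: sq; rewrite er msizeM //; move: (msize_nonunit x0 xU).
  by have := mpolySpred mdeg r0; move: (msize r) (msize (f - x *: g)) => x' y'; lia.
exists (x :: E) => y; rewrite inE negb_or => /andP[yx yE]; have [iy ny] := hE y yE.
split=> //; rewrite er => /(irreducible_prime iy)[//|dy].
have [_ yU _] := iy; exact: (distinct_members yU yx (divides_refl _) dy).
Qed.

(** Modulo the irreducible member [f - x *: g] one may replace [f] by [x *: g], and the relation
    becomes [g ^+ M] times a binary form in [p] and [q]. The member is prime and does not divide
    [g], so it divides some [p - y *: q]. Geometrically, a generic fibre of [f / g] lies in a fibre
    of [p / q]. *)
Lemma pencil_step a p q (E Bd : seq k) : pencil a p q ->
  exists x y, [/\ x \notin E, y \notin Bd, irreducible_elt (f - x *: g) &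
    divides (f - x *: g) (p - y *: q)].
Proof.
move=> [hp hq ipq]; have [p0 q0] := indep_neq0 ipq.
have [M [c [[i0 [j0 c0]] sum0]]] := pencil_relation char_k actP card_free hf hg hp hq f0 g0 p0 q0.
(* The coefficients of the relation as polynomials in [x]; off the roots of one nonzero [C j0] the
   binary form is nonzero. *)
pose C j : {poly k} := \sum_i c i j *: 'X^i.
have Cj0 : C j0 != 0.
  apply: contraNneq c0 => e; have := congr1 (fun P : {poly k} => P`_i0) e.
  rewrite coef0 coef_sum (bigD1 i0) //= coefZ coefXn eqxx mulr1 big1 ?addr0 => [->//|i ii].
  by rewrite coefZ coefXn eq_sym (inj_eq val_inj) (negbTE ii) mulr0.
have [E1 hE1] := poly_root_seq Cj0.
have [E2 hE2] := generic_not_dividing q0.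
(* Excludes the finitely many members dividing some [p - y *: q] with [y] in [Bd], so that the [y]
   obtained lies outside [Bd]. *)
have [E3 hE3] : exists E3 : seq k, forall x, x \notin E3 -> forall y, y \in Bd ->
    ~ divides (f - x *: g) (p - y *: q).
  elim: Bd => [|y Bd [E3 hE3]]; first by exists [::].
  have [E4 hE4] := generic_not_dividing (indep_member y ipq).
  exists (E4 ++ E3) => x; rewrite mem_cat negb_or => /andP[x4 x3] z.
  by rewrite inE => /orP[/eqP ->|]; [case: (hE4 x x4) | apply: hE3].
have [x] := avoid_seq char_k (E ++ E1 ++ E2 ++ E3).
rewrite !mem_cat !negb_or => /and4P[xE x1 x2 x3].
have [ix nx] := hE2 x x2; have [_ xU _] := ix.
pose P : {poly k} := \poly_(j < M.+1) (C (inord j)).[x].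
have P0 : P != 0.
  apply: contraNneq (hE1 x x1) => e; have := congr1 (fun P : {poly k} => P`_j0) e.
  by rewrite coef0 coef_poly ltn_ord inord_val => ->.
have dvP : divides (f - x *: g) (g ^+ M * binary_form M P p q).
  have -> : g ^+ M * binary_form M P p q =
      \sum_i \sum_j (c i j * x ^+ i) *: (g ^+ M * (p ^+ j * q ^+ (M - j))).
    rewrite exchange_big /binary_form mulr_sumr; apply: eq_bigr => j _ /=.
    rewrite coef_poly ltn_ord inord_val -scalerAr horner_sum scaler_suml.
    by apply: eq_bigr => i _; rewrite hornerZ hornerXn.
  rewrite -[X in divides _ X]subr0 -[X in divides _ (_ - X)]sum0 -sumrB.
  apply: (big_ind (divides (f - x *: g))) => [|u v|i _].
  - by exists 0; rewrite mul0r.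
  - exact: dividesD.
  rewrite -sumrB; apply: (big_ind (divides (f - x *: g))) => [|u v|j _].
  - by exists 0; rewrite mul0r.
  - exact: dividesD.
  have gM : g ^+ M = g ^+ i * g ^+ (M - i) by rewrite -exprD subnKC // -ltnS.
  rewrite gM; set y := p ^+ j * _; set h := g ^+ (M - i).
  have -> : (c i j * x ^+ i) *: (g ^+ i * h * y) - c i j *: (f ^+ i * h * y)
     = (c i j *: (h * y)) * ((x *: g) ^+ i - f ^+ i).
    by rewrite exprZn -!mul_mpolyC mpolyCM; ring.
  by rewrite subrXX; apply: dividesMl; exists (- \sum_(l < i) ((x *: g) ^+ (i.-1 - l) * f ^+ l)); ring.
have pr := irreducible_prime ix.
case/pr: dvP => [/(prime_dividesX xU pr) dg|].
  case: (pencil_coprime xU _ dg).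
  suff : divides (f - x *: g) ((f - x *: g) + x *: g) by rewrite subrK.
  by apply: dividesD; [exact: divides_refl | apply: divides_scale].
case/(prime_divides_form ix nx P0 (size_poly _ _)) => y dy.
exists x, y; split=> //.
by apply/negP => yB; apply: (hE3 x x3 y yB).
Qed.

End MinimalPencil.

Definition is_subfield (K : fieldType) (S : K -> Prop) : Prop :=
  [/\ S 1, forall x y, S x -> S y -> S (x - y), forall x y, S x -> S y -> S (x * y)
    & forall x, S x -> S x^-1].

Section FieldIdentities.
Variable F : fieldType.
Implicit Types a b c x : F.

Lemma div_common a b c : c != 0 -> a / b = (a / c) / (b / c).
Proof. by move=> c0; rewrite invf_div mulrA divfK. Qed.

Lemma mul_div_cross a b x c : b != 0 -> c != 0 -> a * x = (a / b * (x / c)) * (b * c).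
Proof. by move=> b0 c0; rewrite mulf_div divfK // mulf_neq0. Qed.

Lemma moebius_neq1 x c b a r : a != 0 -> b != c -> x - b * a = r * (x - c * a) -> 1 - r != 0.
Proof.
move=> a0 bc e; rewrite subr_eq0; apply: contraNneq bc => r1.
by move: e; rewrite -r1 mul1r => /addrI/oppr_inj/(mulIf a0)/eqP.
Qed.

Lemma moebius_solve x c b a r : a != 0 -> 1 - r != 0 -> x - b * a = r * (x - c * a) ->
  x / a = (b - r * c) / (1 - r).
Proof.
move=> a0 r1 e; apply/eqP; rewrite eqr_div // -subr_eq0.
have -> : x * (1 - r) - (b - r * c) * a = (x - b * a) - r * (x - c * a) by ring.
by rewrite e subrr.
Qed.

End FieldIdentities.

Section Subfield.
Variables (K : fieldType) (S : K -> Prop).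
Hypothesis subS : is_subfield S.

Lemma subfield0 : S 0.
Proof. by case: subS => S1 SB _ _; rewrite -(subrr 1); apply: SB. Qed.

Lemma subfieldN x : S x -> S (- x).
Proof. by case: (subS) => _ SB _ _ Sx; rewrite -sub0r; apply: SB => //; apply: subfield0. Qed.

Lemma subfieldD x y : S x -> S y -> S (x + y).
Proof. by case: (subS) => _ SB _ _ Sx Sy; rewrite -[y]opprK; apply: SB => //; apply: subfieldN. Qed.

Lemma subfieldB x y : S x -> S y -> S (x - y).
Proof. by case: subS => _ SB _ _; apply: SB. Qed.

Lemma subfieldM x y : S x -> S y -> S (x * y).
Proof. by case: subS => _ _ SM _; apply: SM. Qed.

Lemma subfieldV x : S x -> S x^-1.
Proof. by case: subS => _ _ _; apply. Qed.

Lemma subfieldX x n : S x -> S (x ^+ n).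
Proof.
move=> Sx; elim: n => [|n IH]; first by rewrite expr0; case: subS.
by rewrite exprS; apply: subfieldM.
Qed.

Lemma subfield_prod I (r : seq I) (P : pred I) F :
  (forall i, P i -> S (F i)) -> S (\prod_(i <- r | P i) F i).
Proof.
move=> SF; apply: (big_ind S) => //; [by case: subS | exact: subfieldM].
Qed.

Lemma subfield_sum I (r : seq I) (P : pred I) F :
  (forall i, P i -> S (F i)) -> S (\sum_(i <- r | P i) F i).
Proof. by move=> SF; apply: (big_ind S) => //; [exact: subfield0 | exact: subfieldD]. Qed.

End Subfield.

Section StablePencil.
Variables (k : closedFieldType) (char_k : [pchar k] =i pred0).
Variables (n m : nat) (d : 'I_m -> nat) (act : ('I_m -> k) -> polymap k n.+1).
Hypothesis actP : torus_action d act.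
Local Notation free := [set i | d i == 0%N].
Hypothesis card_free : #|free| = n.
Local Notation A := {mpoly k[n.+1]}.
Implicit Types (t u : 'I_m -> k) (p q : A) (a b : 'rV[int]_m).
Local Notation hom := (homogeneous d act).
Local Notation hom0 := (homogeneous0 d act).
Local Notation pencil := (pencil d act).

Lemma act_unit t p : adm d t -> (p \mPo act t \is a GRing.unit) = (p \is a GRing.unit).
Proof.
move=> At; apply/idP/idP => [|pU]; last exact: (rmorph_unit (comp_mpoly (act t))).
by move/(rmorph_unit (comp_mpoly (act (fun i => (t i)^-1)))) => /=; rewrite (act_compK actP).
Qed.

Lemma act_inj t p q : adm d t -> p \mPo act t = q \mPo act t -> p = q.
Proof. by move=> At e; rewrite -(act_compK actP p At) e (act_compK actP). Qed.

Lemma act_irreducible t p : adm d t -> irreducible_elt p -> irreducible_elt (p \mPo act t).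
Proof.
move=> At [p0 pU pI]; split; rewrite ?(act_comp_eq0 actP) ?act_unit //.
move=> a b e; have At' := admV At.
have {}e : p = (a \mPo act (fun i => (t i)^-1)) * (b \mPo act (fun i => (t i)^-1)).
  by rewrite -rmorphM /= -e (act_compK actP).
by have := pI _ _ e; rewrite !act_unit.
Qed.

Lemma act_pencil a p q t : adm d t -> pencil a p q -> pencil a (p \mPo act t) (q \mPo act t).
Proof.
move=> At [hp hq ipq]; split; try exact: hom0_act.
move=> x y; rewrite -!comp_mpolyZ -comp_mpolyD => e; apply: ipq.
by apply: (act_inj At); rewrite e comp_mpoly0.
Qed.

Variables (w : 'rV[int]_m) (f g : A).
Hypothesis pfg : pencil w f g.
Hypothesis min_fg : forall a p q, pencil a p q ->
  (maxn (msize f) (msize g) <= maxn (msize p) (msize q))%N.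

Definition pencil_span (h : A) : Prop := exists x y : k, h = x *: f + y *: g.

Lemma pencil_span_subspace : is_subspace pencil_span.
Proof.
split.
- by exists 0, 0; rewrite !scale0r addr0.
- move=> p q [x [y ->]] [x' [y' ->]]; exists (x + x'), (y + y').
  by rewrite !scalerDl addrACA.
- by move=> c p [x [y ->]]; exists (c * x), (c * y); rewrite scalerDr !scalerA.
Qed.

Lemma associate_irreducible p q : irreducible_elt p -> irreducible_elt q -> divides p q ->
  exists c : k, q = c *: p.
Proof.
move=> [_ pU _] [_ _ qI] [r e]; case: (qI _ _ e) => [rU|]; last by rewrite (negbTE pU).
have /andP[/eqP rC _] := rU; exists (r@_0); by rewrite e {1}rC mul_mpolyC.
Qed.

(* A translate of the generic member is again irreducible, hence it is
   proportional to the generic member dividing it. *)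
Lemma pencil_stable t : adm d t ->
  pencil_span (f \mPo act t) /\ pencil_span (g \mPo act t).
Proof.
move=> At; have [E hE] := generic_irreducible char_k actP card_free pfg min_fg.
have key (Bd : seq k) : exists y, y \notin Bd /\ pencil_span ((f - y *: g) \mPo act t).
  have [x [y [_ yB ix dxy]]] :=
    pencil_step char_k actP card_free pfg min_fg [::] (E ++ Bd) (act_pencil At pfg).
  move: yB; rewrite mem_cat negb_or => /andP[yE yB]; exists y; split=> //.
  have [|c ->] := associate_irreducible ix (act_irreducible At (hE y yE)).
    by rewrite comp_mpolyB comp_mpolyZ.
  by exists c, (- (c * x)); rewrite scalerBr scalerA scaleNr.
have [_ WD WZ] := pencil_span_subspace.
(* Two members with distinct parameters span the pencil, so their translates suffice. *)
have [x [_ Wx]] := key [::]; have [y [yx Wy]] := key [:: x].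
have Wg : pencil_span (g \mPo act t).
  have {}yx : y - x != 0 by rewrite subr_eq0; rewrite inE in yx.
  rewrite -[g \mPo _]scale1r -(mulVf yx) -scalerA; apply: (WZ).
  have -> : (y - x) *: (g \mPo act t) = (f - x *: g) \mPo act t + -1 *: ((f - y *: g) \mPo act t).
    by rewrite !comp_mpolyB !comp_mpolyZ scaleN1r scalerBl; ring.
  by apply: (WD) => //; apply: (WZ).
split=> //; rewrite -[f](subrK (x *: g)) comp_mpolyD comp_mpolyZ.
by apply: (WD) => //; apply: (WZ).
Qed.

(** The components of [f] and [g] stay in their two-dimensional span; if no two were independent
    they would all lie on one line, and so would [f] and [g]. *)
Lemma homogeneous_pair : exists a b p q,
  [/\ hom a p, hom b q, indep p q, pencil_span p & pencil_span q].
Proof.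
have [hf hg ifg] := pfg; have [f0 g0] := indep_neq0 ifg.
have [s [v [fE hv Wv]]] := homogeneous_decomposition actP f.
have [s' [v' [gE hv' Wv']]] := homogeneous_decomposition actP g.
have sW := pencil_span_subspace.
have {}Wv := Wv _ sW (fun t At => (pencil_stable At).1).
have {}Wv' := Wv' _ sW (fun t At => (pencil_stable At).2).
apply: contrapT => npq.
have [a0 a0s va0] : exists2 a0, a0 \in s & v a0 != 0.
  apply: contrapT => nv; move: f0; rewrite fE big_seq big1 ?eqxx // => a a_s.
  by apply/eqP; apply: contrapT => /negP va; apply: nv; exists a.
have line b q : hom b q -> pencil_span q -> exists c, q = c *: v a0.
  move=> hq Wq; apply: not_indep => // ipq.
  by apply: npq; exists a0, b, (v a0), q; split=> //; [apply: hv | apply: Wv].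
have linesum (r : seq 'rV[int]_m) (z : 'rV[int]_m -> A) :
    {in r, forall a, hom a (z a)} -> {in r, forall a, pencil_span (z a)} ->
    exists c, \sum_(a <- r) z a = c *: v a0.
  elim: r => [|a r IH] hr Wr; first by exists 0; rewrite big_nil scale0r.
  have [||c e] := IH.
  - by move=> b br; apply: hr; rewrite inE br orbT.
  - by move=> b br; apply: Wr; rewrite inE br orbT.
  have [c' e'] := line a (z a) (hr a (mem_head _ _)) (Wr a (mem_head _ _)).
  by exists (c' + c); rewrite big_cons e e' scalerDl.
have [c ec] := linesum s v hv Wv; have [c' ec'] := linesum s' v' hv' Wv'.
have [|/eqP c'0 /eqP] := @ifg c' (- c).
  by rewrite fE gE ec ec' !scalerA -scalerDl mulNr mulrC subrr scale0r.
by move=> _; move/eqP: g0; apply; rewrite gE ec' (eqP c'0) scale0r.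
Qed.

(* Induction on the degree of [p] and [q]: divide out two generic members of the
   pencil spanned by [f] and [g]. *)
Lemma pencil_generates (S : {fraction A} -> Prop) : is_subfield S ->
  (forall c : k, S (c%:MP%:F)) -> S (f%:F / g%:F) ->
  forall a p q, hom0 a p -> hom0 a q -> q != 0 -> S (p%:F / q%:F).
Proof.
move=> subS SC Sfg.
have F0 p : (p%:F == 0 :> {fraction A}) = (p == 0) by exact: tofrac_eq0.
have FZ (c : k) p : (c *: p)%:F = c%:MP%:F * p%:F :> {fraction A} by rewrite -mul_mpolyC tofracM.
move=> a p q; move: {2}(maxn _ _) (leqnn (maxn (msize p) (msize q))) => z.
elim: z a p q => [|z IH] a p q.
  by rewrite geq_max !leqn0 !msize_poly_eq0 => /andP[_ ->].
move=> sz hp hq q0; have [ipq|npq] := EM (indep q p); last first.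
  have [c ->] := not_indep q0 npq; rewrite FZ mulfK ?F0 //.
have {ipq} ppq : pencil a p q.
  by split=> // x y e; have [|-> ->] := ipq y x; rewrite 1?addrC.
have step E Bd := pencil_step char_k actP card_free pfg min_fg E Bd ppq.
have [x [b [_ _ ix [p1 e1]]]] := step [::] [::].
(* Avoiding [b] makes [c] different from [b], so that [p / q] can be recovered from the ratio of the
   two members. *)
have [y [c [_ cb iy [q1 e2]]]] := step [::] [:: b].
have {}cb : b - c != 0 by rewrite subr_eq0 eq_sym; rewrite inE in cb.
have [hf hg ifg] := pfg; have [f0 g0] := indep_neq0 ifg; have [_ _ ipq] := ppq.
have hx : hom0 w (f - x *: g) by apply: hom0B => //; apply: hom0Z.
have hy : hom0 w (f - y *: g) by apply: hom0B => //; apply: hom0Z.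
have [x0 xU _] := ix; have [y0 yU _] := iy.
have bound h1 (x' y' : k) : h1 != 0 -> f - y' *: g \isn't a GRing.unit -> f - y' *: g != 0 ->
    p - x' *: q = h1 * (f - y' *: g) -> (msize h1 <= z)%N.
  move=> h10 U U0 e; apply: (msize_cofactor h10 U0 U); rewrite -e.
  by apply: msize_linear_bound; move: sz; rewrite geq_max => /andP[].
have p10 : p1 != 0 by have := indep_member b ipq; rewrite e1 mulf_eq0 negb_or => /andP[].
have q10 : q1 != 0 by have := indep_member c ipq; rewrite e2 mulf_eq0 negb_or => /andP[].
have S1 : S (p1%:F / q1%:F).
  apply: (IH (a - w)) => //.
  - by rewrite geq_max (bound _ _ _ p10 xU x0 e1) (bound _ _ _ q10 yU y0 e2).
  - by apply: (hom0_cancel x0) hx; rewrite -e1; apply: hom0B => //; apply: hom0Z.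
  - by apply: (hom0_cancel y0) hy; rewrite -e2; apply: hom0B => //; apply: hom0Z.
have gF : g%:F != 0 :> {fraction A} by rewrite F0.
have Smem z' : S ((f - z' *: g)%:F / g%:F).
  rewrite tofracB FZ mulrBl mulfK //; case: (subS) => _ SB _ _; exact: SB.
have Sm : S ((f - x *: g)%:F / (f - y *: g)%:F).
  by rewrite (div_common _ _ gF); apply: subfieldM => //; apply: subfieldV.
have [pF qF] : p%:F - b%:MP%:F * q%:F = p1%:F * (f - x *: g)%:F /\
   p%:F - c%:MP%:F * q%:F = q1%:F * (f - y *: g)%:F :> {fraction A}.
  by rewrite -!FZ -!tofracB -!tofracM e1 e2.
(* The ratio of [p - b *: q] to [p - c *: q]: its first factor is in [S] by induction, its second
   because [f / g] is, and [p / q] is a linear fractional function of it. *)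
pose r : {fraction A} := p1%:F / q1%:F * ((f - x *: g)%:F / (f - y *: g)%:F).
have Sr : S r by apply: subfieldM.
have rE : p%:F - b%:MP%:F * q%:F = r * (p%:F - c%:MP%:F * q%:F).
  by rewrite pF qF; apply: mul_div_cross; rewrite F0.
have bc : b%:MP%:F != c%:MP%:F :> {fraction A}.
  by rewrite tofrac_eq -subr_eq0 -mpolyCB mpolyC_eq0.
have qF0 : q%:F != 0 :> {fraction A} by rewrite F0.
have r1 : 1 - r != 0 := moebius_neq1 qF0 bc rE.
rewrite (moebius_solve qF0 r1 rE).
apply: subfieldM => //; last first.
  by apply: subfieldV => //; case: (subS) => S1' SB _ _; apply: SB.
case: (subS) => _ SB SM _; apply: SB => //; exact: SM.
Qed.

End StablePencil.

(** * Rational maps *)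

Lemma fraction_repr (R : idomainType) (f : {fraction R}) :
  f = (\n_(repr f))%:F / (\d_(repr f))%:F.
Proof.
have d0 := denom_ratioP (repr f).
have dF : (\d_(repr f))%:F != 0 :> {fraction R} by rewrite tofrac_eq0.
apply: (mulIf dF); rewrite divfK // -{1}[f]reprK; unlock FracField.tofrac.
rewrite -[LHS]FracField.pi_mul; apply/eqmodP => /=; rewrite FracField.equivfE /FracField.mulf.
by rewrite !numden_Ratio ?oner_neq0 ?mulr1 // mulrC.
Qed.

Section CrossMultiplication.
Variable F : fieldType.
Implicit Types a b c e : F.

Lemma eq_div_cross a b c e : b != 0 -> e != 0 -> a / b = c / e -> c * b = a * e.
Proof. by move=> b0 e0 /eqP; rewrite eqr_div // => /eqP. Qed.

Lemma cross_eq_div a b c e : b != 0 -> e != 0 -> a * e = c * b -> a / b = c / e.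
Proof. by move=> b0 e0 /eqP; rewrite -eqr_div // => /eqP. Qed.

Lemma div_sub_cross a b c e : b != 0 -> e != 0 ->
  a / b - c / e = (a * e - c * b) / (b * e).
Proof. by move=> b0 e0; rewrite -mulNr addf_div // mulNr. Qed.

End CrossMultiplication.

Section Pullback.
Variables (k : closedFieldType) (n : nat).
Local Notation A := {mpoly k[n]}.
Local Notation K := {fraction A}.
Local Notation ratmap := (ratmap k n).
Implicit Types (g h l : ratmap) (p q : A) (x y : K).

Definition const_frac (c : k) : K := (c%:MP : A)%:F.

Definition poly_pullback_mor h : {rmorphism A -> K} :=
  mmap (@FracField.tofrac A \o @mpolyC n k) (tnth h).

Lemma poly_pullbackE h p : poly_pullback h p = poly_pullback_mor h p.
Proof. by []. Qed.

Lemma poly_pullbackC h c : poly_pullback h c%:MP = const_frac c.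
Proof. by rewrite poly_pullbackE /poly_pullback_mor /= mmapC. Qed.

Lemma poly_pullbackX h i : poly_pullback h 'X_i = tnth h i.
Proof. by rewrite poly_pullbackE /poly_pullback_mor /= mmapX mmap1U. Qed.

Section Dominant.
Variables (h : ratmap) (dom_h : dominant h).

Lemma poly_pullback_eq0 p : (poly_pullback h p == 0) = (p == 0).
Proof.
apply/eqP/eqP => [|->]; first exact: dom_h.
by rewrite poly_pullbackE rmorph0.
Qed.

Lemma pullback_div p q : q != 0 ->
  pullback h (p%:F / q%:F) = poly_pullback h p / poly_pullback h q.
Proof.
move=> q0; rewrite /pullback; set f := p%:F / q%:F.
have d0 := denom_ratioP (repr f).
have e : \n_(repr f) * q = p * \d_(repr f).
  apply/eqP; rewrite -tofrac_eq !tofracM; apply/eqP.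
  have qF : q%:F != 0 :> K by rewrite tofrac_eq0.
  have dF : (\d_(repr f))%:F != 0 :> K by rewrite tofrac_eq0.
  exact: eq_div_cross qF dF (fraction_repr f).
have qP : poly_pullback h q != 0 by rewrite poly_pullback_eq0.
have dP : poly_pullback h (\d_(repr f)) != 0 by rewrite poly_pullback_eq0.
have eP : poly_pullback_mor h (\n_(repr f)) * poly_pullback_mor h q =
    poly_pullback_mor h p * poly_pullback_mor h (\d_(repr f)).
  by rewrite -[LHS]rmorphM -[RHS]rmorphM e.
exact: (@cross_eq_div K _ _ _ _ dP qP eP).
Qed.

Lemma pullback_poly p : pullback h p%:F = poly_pullback h p.
Proof.
rewrite -[p%:F]divr1 -tofrac1 pullback_div ?oner_neq0 //.
by rewrite !poly_pullbackE rmorph1 divr1.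
Qed.

Lemma pullback_zmod : zmod_morphism (pullback h).
Proof.
move=> x y; rewrite {1}(fraction_repr x) {1}(fraction_repr y).
have dx := denom_ratioP (repr x); have dy := denom_ratioP (repr y).
rewrite div_sub_cross ?tofrac_eq0 // -!tofracM -tofracB pullback_div ?mulf_neq0 //.
rewrite [RHS]div_sub_cross ?poly_pullback_eq0 //.
by rewrite !poly_pullbackE rmorphB !rmorphM.
Qed.

Lemma pullback_monoid : monoid_morphism (pullback h).
Proof.
split; first by rewrite -tofrac1 pullback_poly poly_pullbackE rmorph1.
move=> x y; rewrite {1}(fraction_repr x) {1}(fraction_repr y).
have dx := denom_ratioP (repr x); have dy := denom_ratioP (repr y).
rewrite mulf_div -!tofracM pullback_div ?mulf_neq0 // /pullback !poly_pullbackE !rmorphM.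
by rewrite mulf_div.
Qed.

(** The dominance proof is an argument so that the ring morphism structure is attached to pullbacks
    along dominant maps only. *)
Definition pullback_mor of dominant h := pullback h.

HB.instance Definition _ := GRing.isZmodMorphism.Build K K (pullback_mor dom_h) pullback_zmod.
HB.instance Definition _ := GRing.isMonoidMorphism.Build K K (pullback_mor dom_h) pullback_monoid.

Lemma pullbackE x : pullback h x = (pullback_mor dom_h : {rmorphism K -> K}) x.
Proof. by []. Qed.

Lemma pullbackC c : pullback h (const_frac c) = const_frac c.
Proof. by rewrite pullback_poly poly_pullbackC. Qed.

Lemma pullbackX i : pullback h ('X_i)%:F = tnth h i.
Proof. by rewrite pullback_poly poly_pullbackX. Qed.

Lemma pullbackM x y : pullback h (x * y) = pullback h x * pullback h y.
Proof. by rewrite !pullbackE rmorphM. Qed.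

Lemma pullback_inj : injective (pullback h).
Proof. exact: (fmorph_inj (pullback_mor dom_h)). Qed.

End Dominant.

Lemma rmorph_fraction (s1 s2 : {rmorphism K -> K}) :
  (forall c, s1 (const_frac c) = s2 (const_frac c)) ->
  (forall i, s1 ('X_i)%:F = s2 ('X_i)%:F) -> s1 =1 s2.
Proof.
move=> sC sX.
have sp p : s1 p%:F = s2 p%:F.
  exact: (@rmorph_mpoly n k K (s1 \o @FracField.tofrac A) (s2 \o @FracField.tofrac A) sC sX p).
by move=> x; rewrite (fraction_repr x) !fmorph_div /= !sp.
Qed.

Lemma pullback_poly_comp g h p : dominant g -> dominant h ->
  pullback h (poly_pullback g p) = poly_pullback (ratmap_comp g h) p.
Proof.
move=> dg dh; rewrite pullbackE !poly_pullbackE.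
apply: (@rmorph_mpoly n k K (pullback_mor dh \o poly_pullback_mor g)
   (poly_pullback_mor (ratmap_comp g h))) => [c|i] /=.
  by rewrite -!poly_pullbackE !poly_pullbackC; apply: pullbackC.
by rewrite -!poly_pullbackE !poly_pullbackX tnth_mktuple.
Qed.

Lemma dominant_comp g h : dominant g -> dominant h -> dominant (ratmap_comp g h).
Proof.
move=> dg dh p; rewrite -pullback_poly_comp // => e; apply: dg.
by apply: (pullback_inj dh); rewrite e (pullbackE dh) rmorph0.
Qed.

Lemma pullback_comp g h x : dominant g -> dominant h ->
  pullback (ratmap_comp g h) x = pullback h (pullback g x).
Proof.
move=> dg dh; rewrite (pullbackE (dominant_comp dg dh)) (pullbackE dh) (pullbackE dg).
apply: (rmorph_fraction (s1 := pullback_mor (dominant_comp dg dh))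
   (s2 := pullback_mor dh \o pullback_mor dg)) => [c|i] /=.
  by rewrite /pullback_mor !pullbackC //; apply: dominant_comp.
by rewrite /pullback_mor !pullbackX ?tnth_mktuple //; apply: dominant_comp.
Qed.

Lemma ratmap_compA g h l : dominant g -> dominant h -> dominant l ->
  ratmap_comp (ratmap_comp g h) l = ratmap_comp g (ratmap_comp h l).
Proof.
move=> dg dh dl; apply: eq_from_tnth => i; rewrite !tnth_mktuple.
by rewrite pullback_comp.
Qed.

Lemma ratmap_idE i : tnth (ratmap_id k n) i = ('X_i)%:F.
Proof. by rewrite !tnth_mktuple. Qed.

Lemma poly_pullback_of (a : polymap k n) p : poly_pullback (ratmap_of a) p = (p \mPo a)%:F.
Proof.
rewrite poly_pullbackE.
apply: (@rmorph_mpoly n k K (poly_pullback_mor (ratmap_of a)) (@FracField.tofrac A \o comp_mpoly a)) => [c|i] /=.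
  by rewrite -poly_pullbackE poly_pullbackC comp_mpolyC.
by rewrite -poly_pullbackE poly_pullbackX comp_mpolyXU -tnth_nth tnth_mktuple.
Qed.

Lemma dominant_aut (a : polymap k n) : poly_aut a -> dominant (ratmap_of a).
Proof.
case=> b [ab ba] p; rewrite poly_pullback_of => /eqP; rewrite tofrac_eq0 => /eqP e.
have : (p \mPo a) \mPo b = p.
  rewrite -[RHS]comp_mpoly_id -/(polymap_id k n) -ab.
  apply: (@rmorph_mpoly n k A (comp_mpoly b \o comp_mpoly a) (comp_mpoly (polymap_comp a b))) => [c|i] /=.
    by rewrite !comp_mpolyC.
  by rewrite !comp_mpolyXU -!tnth_nth tnth_mktuple.
by rewrite e comp_mpoly0.
Qed.

Lemma dominant_id : dominant (ratmap_id k n).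
Proof.
apply: dominant_aut; exists (polymap_id k n).
by split; apply: eq_from_tnth => i; rewrite !tnth_mktuple comp_mpolyXU -tnth_nth tnth_mktuple.
Qed.

Lemma pullback_id x : pullback (ratmap_id k n) x = x.
Proof.
rewrite (pullbackE dominant_id).
apply: (rmorph_fraction (s1 := pullback_mor dominant_id) (s2 := idfun)) => [c|i] /=.
  by rewrite /pullback_mor pullbackC //; apply: dominant_id.
by rewrite /pullback_mor pullbackX ?ratmap_idE //; apply: dominant_id.
Qed.

Lemma ratmap_1comp g : dominant g -> ratmap_comp (ratmap_id k n) g = g.
Proof. by move=> dg; apply: eq_from_tnth => i; rewrite tnth_mktuple ratmap_idE pullbackX. Qed.

Lemma ratmap_of_comp (a b : polymap k n) : poly_aut a -> poly_aut b ->
  ratmap_of (polymap_comp a b) = ratmap_comp (ratmap_of a) (ratmap_of b).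
Proof.
move=> pa pb; apply: eq_from_tnth => i; rewrite !tnth_mktuple.
by rewrite (pullback_poly (dominant_aut pb)) poly_pullback_of.
Qed.

Lemma ratmap_of_inj : injective (@ratmap_of k n).
Proof.
move=> a b ab; apply: eq_from_tnth => i; apply/eqP; rewrite -tofrac_eq; apply/eqP.
by have := congr1 (fun f => tnth f i) ab; rewrite !tnth_mktuple.
Qed.

(** The comorphism of a dominant map is injective; once it reaches all coordinates, their preimages
    are the components of the inverse. *)
Lemma cremona_inverse_of_onto g : dominant g ->
  (forall i, exists y, pullback g y = ('X_i)%:F) -> exists h, cremona_inverse g h.
Proof.
move=> dg onto; pose y i := sval (cid (onto i)).
have hy i : pullback g (y i) = ('X_i)%:F by rewrite /y; case: (cid _).
pose h : ratmap := [tuple y i | i < n].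
have hgK p : pullback g (poly_pullback h p) = p%:F.
  rewrite (pullbackE dg) poly_pullbackE.
  apply: (@rmorph_mpoly n k K (pullback_mor dg \o poly_pullback_mor h) (@FracField.tofrac A)) => [c|i] /=.
    by rewrite -poly_pullbackE poly_pullbackC; apply: pullbackC.
  by rewrite -poly_pullbackE poly_pullbackX tnth_mktuple; apply: hy.
have dh : dominant h.
  by move=> p e; apply/eqP; rewrite -tofrac_eq0 -hgK e (pullbackE dg) rmorph0.
have ghK x : pullback g (pullback h x) = x.
  rewrite (pullbackE dg) (pullbackE dh).
  apply: (rmorph_fraction (s1 := pullback_mor dg \o pullback_mor dh) (s2 := idfun)) => [c|i] /=.
    by rewrite /pullback_mor !pullbackC.
  by rewrite /pullback_mor (pullbackX dh) tnth_mktuple hy.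
exists h; split=> //; apply: eq_from_tnth => i; rewrite tnth_mktuple ratmap_idE.
  by apply: (pullback_inj dg); rewrite ghK pullbackX.
by rewrite tnth_mktuple hy.
Qed.

Lemma cremona_inverse_sym g h : cremona_inverse g h -> cremona_inverse h g.
Proof. by case. Qed.

Lemma cremona_inverse_pullback g h x : cremona_inverse g h -> pullback h (pullback g x) = x.
Proof. by case=> dg dh gh _; rewrite -pullback_comp // gh pullback_id. Qed.

Lemma cremona_inverse_comp g h g' h' : cremona_inverse g h -> cremona_inverse g' h' ->
  cremona_inverse (ratmap_comp g' g) (ratmap_comp h h').
Proof.
move=> [dg dh gh hg] [dg' dh' gh' hg'].
split; try exact: dominant_comp.
- rewrite ratmap_compA //; last exact: dominant_comp.
  by rewrite -(ratmap_compA dg dh dh') gh ratmap_1comp.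
- rewrite ratmap_compA //; last exact: dominant_comp.
  by rewrite -(ratmap_compA dh' dg' dg) hg' ratmap_1comp.
Qed.

Lemma cremona_conjugateK g h (a : ratmap) : cremona_inverse g h -> dominant a ->
  ratmap_comp (ratmap_comp h (ratmap_comp (ratmap_comp g a) h)) g = a.
Proof.
move=> gh da; have [dg dh egh ehg] := gh; have dga := dominant_comp dg da.
apply: eq_from_tnth => i; rewrite 2!tnth_mktuple pullback_comp // pullback_comp //.
have -> : pullback g (tnth h i) = ('X_i)%:F by rewrite -ratmap_idE -ehg tnth_mktuple.
by rewrite pullbackX // (cremona_inverse_pullback _ (cremona_inverse_sym gh)).
Qed.

Section Conjugacy.
Variables (H1 H2 H3 : polymap k n -> Prop).
Hypotheses (aut1 : forall a, H1 a -> poly_aut a) (aut2 : forall a, H2 a -> poly_aut a).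

Lemma cremona_conj_sym : cremona_conj H1 H2 -> cremona_conj H2 H1.
Proof.
move=> [g [h [gh hc]]]; exists h, g; split; first exact: cremona_inverse_sym.
have [dg dh egh ehg] := gh.
have back (a : ratmap) (da : dominant a) := cremona_conjugateK gh da.
move=> f; split.
  move=> [b Hb ->]; have [_ /(_ (ex_intro2 _ _ b Hb erefl)) [a Ha e]] := hc (ratmap_of b).
  by exists a => //; rewrite e back //; apply/dominant_aut/aut1.
move=> [a Ha ->].
have [/(_ (ex_intro2 _ _ a Ha erefl)) [b Hb e] _] := hc (ratmap_comp (ratmap_comp g (ratmap_of a)) h).
by exists b => //; rewrite -e back //; apply/dominant_aut/aut1.
Qed.

Lemma cremona_conj_trans : cremona_conj H1 H2 -> cremona_conj H2 H3 -> cremona_conj H1 H3.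
Proof.
move=> [g [h [gh hc]]] [g' [h' [gh' hc']]].
exists (ratmap_comp g' g), (ratmap_comp h h'); split; first exact: cremona_inverse_comp.
have [dg dh _ _] := gh; have [dg' dh' _ _] := gh'.
have assoc (a : ratmap) : dominant a ->
    ratmap_comp (ratmap_comp (ratmap_comp g' g) a) (ratmap_comp h h') =
    ratmap_comp (ratmap_comp g' (ratmap_comp (ratmap_comp g a) h)) h'.
  move=> da; have dga := dominant_comp dg da; have dgah := dominant_comp dga dh.
  have dgg := dominant_comp dg' dg; have dhh := dominant_comp dh dh'.
  apply: eq_from_tnth => i; rewrite !tnth_mktuple.
  by rewrite !pullback_comp.
move=> f; split.
  move=> [a Ha ->]; rewrite assoc; last exact/dominant_aut/aut1.
  have [/(_ (ex_intro2 _ _ a Ha erefl)) [b Hb ->] _] := hc (ratmap_comp (ratmap_comp g (ratmap_of a)) h).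
  by apply/hc'; exists b.
move=> /hc' [b Hb ->].
have [_ /(_ (ex_intro2 _ _ b Hb erefl)) [a Ha ->]] := hc (ratmap_of b).
by exists a => //; rewrite assoc //; apply/dominant_aut/aut1.
Qed.

End Conjugacy.
End Pullback.

(** * Normal form of the action *)

Section CoordinateChange.
Variables (k : closedFieldType) (G : alg_group k) (m : nat) (d : 'I_m -> nat).
Variables (phi : ('I_m -> k) -> 'M[k]_(ag_size G)) (psi : 'M[k]_(ag_size G) -> 'I_m -> k).
Hypothesis coordG : coordinates (G := G) d phi psi.
Implicit Types (t : 'I_m -> k).

Lemma coord_1 : phi (fun=> 1) = 1%:M.
Proof.
have A1 := @adm1 k m d; have U := ag_unit (coord_phi coordG A1).
apply: (can_inj (mulKmx U)); rewrite mulmx1 -(coord_phiM coordG) //.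
by congr phi; apply: funext => i; rewrite mulr1.
Qed.

Lemma coord_psiM g h : G g -> G h -> psi (g *m h) = fun i => psi g i * psi h i.
Proof.
move=> Gg Gh; have Ag := coord_psi coordG Gg; have Ah := coord_psi coordG Gh.
rewrite -{1}(coord_psiK coordG Gg) -{1}(coord_psiK coordG Gh) -(coord_phiM coordG) //.
by rewrite (coord_phiK coordG) //; apply: admM.
Qed.

Lemma coord_psiV g : G g -> psi (invmx g) = fun i => (psi g i)^-1.
Proof.
move=> Gg; have Gi := ag_inv Gg; apply: funext => i.
have nz : psi g i != 0 by have [] := coord_psi coordG Gg i.
apply: (mulIf nz); rewrite mulVf //.
have := congr1 (fun f => f i) (coord_psiM Gi Gg); rewrite mulVmx ?(ag_unit Gg) // => <-.
by rewrite -coord_1 (coord_phiK coordG) //; apply: adm1.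
Qed.

Lemma coord_chr_regular a : regular (G := G) (fun g => chr (psi g) a).
Proof.
apply: regular_prod => j _; case: (a 0 j) => e; first exact/regularX/(coord_regular coordG).
have [p hp] := coord_regular coordG j.
have : regular (G := G) (fun g => p.@[gl_coords (invmx g) ord0]).
  by apply: regular_meval => i; apply: regular_inv_coords.
move/(regularX e.+1); apply: eq_regular => g Gg.
by rewrite -hp ?coord_psiV ?NegzE ?exprVn //; apply: ag_inv.
Qed.

(** Rows of [E] are the new coordinate characters in terms of the old ones, rows of [C] the old in
    terms of the new. The second hypothesis says that the relations between the new characters are
    exactly those of [adm d']. *)
Lemma coordinates_change r (d' : 'I_r -> nat) (E : 'M[int]_(r, m)) (C : 'M[int]_(m, r)) :
  (forall t, adm d t -> forall j, chr t (row j (C *m E)) = t j) ->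
  (forall b : 'rV[int]_r, (forall t, adm d t -> chr t (b *m E) = 1) <->
     forall i, ((d' i)%:Z %| b 0%R i)%Z) ->
  coordinates (G := G) d' (fun z => phi (fun j => chr z (row j C)))
    (fun g i => chr (psi g) (row i E)).
Proof.
move=> CE rel.
pose zE t : 'I_r -> k := fun i => chr t (row i E).
pose tC z : 'I_m -> k := fun j => chr z (row j C).
have zE_adm t : adm d t -> adm d' (zE t).
  move=> At i; have nt := adm_torus At; split; first exact: chr_neq0.
  rewrite exprnP -chrZ // rowE scalemxAl.
  apply: (iffRL (rel _)) => // j; rewrite !mxE eqxx /=.
  by case: eqP => [->|_]; rewrite ?mulr1 ?mulr0 ?dvdz0.
have chr_rel z (b : 'rV[int]_r) : adm d' z -> (forall i, ((d' i)%:Z %| b 0%R i)%Z) -> chr z b = 1.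
  move=> Az hb; rewrite /chr big1 // => i _; have /dvdzP[q ->] := hb i.
  by have [_ e] := Az i; rewrite mulrC -exprz_exp -exprnP e exp1rz.
have CE_chr t a : adm d t -> chr t (a *m (C *m E)) = chr t a.
  move=> At; have nt := adm_torus At; rewrite -chr_mulmx //.
  by apply: eq_chr => j; apply: CE.
have tC_adm z : adm d' z -> adm d (tC z).
  move=> Az j; have nz := adm_torus Az; split; first exact: chr_neq0.
  rewrite exprnP -chrZ //; apply: chr_rel => //; apply/rel => t At.
  rewrite -scalemxAl chrZ; last exact: adm_torus At.
  by rewrite -row_mul CE // -exprnP; have [_] := At j.
have tCK t : adm d t -> tC (zE t) = t.
  move=> At; apply: funext => j; rewrite /tC /zE chr_mulmx; last exact: adm_torus At.
  by rewrite -row_mul CE.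
have zEK z : adm d' z -> zE (tC z) = z.
  move=> Az; have nz := adm_torus Az; apply: funext => i; rewrite /zE /tC chr_mulmx //.
  rewrite -[RHS](chr_delta z); apply: (mulIf (chr_neq0 (- delta_mx 0 i) nz)).
  rewrite -!chrD // subrr chr0; apply: chr_rel => //; apply/rel => t At.
  have nt := adm_torus At; rewrite mulmxBl -rowE -mulmxA chrB // CE_chr //.
  by rewrite mulfV ?chr_neq0.
split.
- by move=> z Az; apply/(coord_phi coordG)/tC_adm.
- by move=> g Gg; apply/zE_adm/(coord_psi coordG).
- by move=> z Az; rewrite (coord_phiK coordG (tC_adm z Az)); apply: zEK.
- move=> g Gg; have := tCK _ (coord_psi coordG Gg); rewrite /tC /zE => ->.
  exact: (coord_psiK coordG).
- move=> z u Az Au; rewrite -(coord_phiM coordG (tC_adm z Az) (tC_adm u Au)).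
  by congr phi; apply: funext => j; rewrite chrM.
- move=> j; apply: (@laurent_subst k k^o m (adm d) r (adm d') C (fun t => gl_coords (phi t) ord0 j)).
  + by move=> z; apply: adm_torus.
  + by move=> z; apply: tC_adm.
  + exact: (coord_laurent coordG).
- by move=> i; apply: coord_chr_regular.
Qed.

End CoordinateChange.

Section AlgebraicAction.
Variables (k : closedFieldType) (char_k : [pchar k] =i pred0) (N : nat).
Variable H : alg_subgroup k N.
Variables (m : nat) (d : 'I_m -> nat).
Variables (phi : ('I_m -> k) -> 'M[k]_(ag_size (as_group H))).
Variables (psi : 'M[k]_(ag_size (as_group H)) -> 'I_m -> k).
Hypothesis coordH : coordinates (G := as_group H) d phi psi.

Lemma as_act1 : @as_act k N H 1%:M = polymap_id k N.
Proof.
have G1 := ag_1 (as_group H); have [b [ab _]] := as_aut G1.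
have := as_mul G1 G1; rewrite mulmx1 => e.
rewrite -[RHS]ab [X in _ = polymap_comp X b]e.
apply: eq_from_tnth => i; rewrite !tnth_mktuple -comp_mpolyA ab.
by rewrite comp_mpoly_id.
Qed.

Lemma algebraic_torus_action : torus_action d (fun t => @as_act k N H (phi t)).
Proof.
split.
- move=> t u At Au; rewrite (coord_phiM coordH) // as_mul //; exact: (coord_phi coordH).
- by rewrite (coord_1 coordH) as_act1.
- move=> t At e; have A1 := @adm1 k m d.
  rewrite -(coord_phiK coordH At) -(coord_phiK coordH A1); congr psi.
  apply: (@as_inj k N H); try exact: (coord_phi coordH).
  by rewrite e (coord_1 coordH) as_act1.
- move=> i; have [F hF] := @as_morph k N H i.
  (* The group coordinates enter [F] as constants and the space coordinates as variables; equality
     with the components of the action then follows from equality of values. *)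
  pose h t j : {mpoly k[N]} := match split j with
    | inl a => (gl_coords (phi t) ord0 a)%:MP
    | inr b => 'X_b end.
  suff Lh : laurent (adm d) (fun t => mmap (@mpolyC N k) (h t) F).
    apply: eq_laurent Lh => t At; apply/eqP; rewrite -subr_eq0; apply/eqP/(mpoly_vanish char_k) => x _.
    rewrite mevalB; apply/eqP; rewrite subr_eq0; apply/eqP.
    have := hF (phi t) (\row_j x j) (coord_phi coordH At).
    have -> : (tnth (@as_act k N H (phi t)) i).@[(\row_j x j) ord0] = (tnth (@as_act k N H (phi t)) i).@[x].
      by apply: meval_eq => j; rewrite mxE.
    move=> ->.
    apply: (@rmorph_mpoly _ k k (meval x \o mmap (@mpolyC N k) (h t))
      (meval (row_mx (gl_coords (phi t)) (\row_j x j) ord0))) => [c|j] /=.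
      by rewrite mmapC !mevalC.
    rewrite mmapX mmap1U mevalXU mxE /h; case: (split j) => l; first by rewrite mevalC.
    by rewrite mevalXU mxE.
  apply: laurent_mmap => [|j]; first by move=> t; apply: adm_torus.
  rewrite /h; case: (split j) => l; last exact: laurent_const.
  have [s hs] := coord_laurent coordH l.
  exists [seq (x.1, x.2%:MP) | x <- s] => t At; rewrite hs // big_map rmorph_sum.
  apply: eq_bigr => x _; rewrite /GRing.scale /= mpolyCM.
  by rewrite mul_mpolyC.
Qed.

End AlgebraicAction.

Lemma mul_div_cancel (F : fieldType) (u v x y : F) : v != 0 -> u * v * x / (v * y) = u * (x / y).
Proof. by move=> v0; rewrite [u * v]mulrC -[v * u * x]mulrA -mulf_div mulfV // mul1r mulrA. Qed.

Lemma mul_div_insert (F : fieldType) (x y z : F) : y != 0 -> z != 0 -> x = (x * y / z) * (z / y).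
Proof. by move=> y0 z0; rewrite mulrA divfK // mulfK. Qed.

Lemma div_powers (F : fieldType) (x y : F) i j :
  x ^+ i * y ^+ j / (y ^+ i * x ^+ j) = (x / y) ^+ i / (x / y) ^+ j.
Proof. by rewrite !expr_div_n invf_div mulf_div. Qed.

Lemma moebius_inverse (R : comNzRingType) (s a b a' b' x y : R) :
  s * (a' * x + b' * y) = a * x + b * y -> (a' * s - a) * x = (b - s * b') * y.
Proof.
move=> h; apply/eqP; rewrite -subr_eq0.
have -> : (a' * s - a) * x - (b - s * b') * y = s * (a' * x + b' * y) - (a * x + b * y) by ring.
by rewrite h subrr.
Qed.

Lemma ord_max_prod (F : fieldType) n (x : 'I_n.+1 -> F) :
  \prod_i x i = (\prod_l x (lift ord_max l)) * x ord_max.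
Proof.
rewrite big_ord_recr /=; congr (_ * _); apply: eq_bigr => l _.
by congr x; apply: val_inj; rewrite /= /bump leqNgt ltn_ord.
Qed.

Section FractionModule.
Variables (k : closedFieldType) (n : nat).

(** A copy of the function field that carries its structure of vector space over [k], for use in
    [dedekind_independence]. *)
Definition fraction_module := {fraction {mpoly k[n]}}.
HB.instance Definition _ := GRing.Zmodule.on fraction_module.

Definition fraction_scale (c : k) (x : fraction_module) : fraction_module :=
  @const_frac k n c * (x : {fraction {mpoly k[n]}}).

Lemma const_fracM a b : @const_frac k n (a * b) = const_frac n a * const_frac n b.
Proof. by rewrite /const_frac mpolyCM tofracM. Qed.

Lemma const_fracD a b : @const_frac k n (a + b) = const_frac n a + const_frac n b.
Proof. by rewrite /const_frac mpolyCD tofracD. Qed.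

Lemma const_frac1 : @const_frac k n 1 = 1.
Proof. by rewrite /const_frac mpolyC1 tofrac1. Qed.

Lemma const_frac_eq0 c : (@const_frac k n c == 0) = (c == 0).
Proof. by rewrite tofrac_eq0 mpolyC_eq0. Qed.

Lemma fraction_scaleA a b x : fraction_scale a (fraction_scale b x) = fraction_scale (a * b) x.
Proof. by rewrite /fraction_scale const_fracM mulrA. Qed.

Lemma fraction_scale1 : left_id 1 fraction_scale.
Proof. by move=> x; rewrite /fraction_scale const_frac1 mul1r. Qed.

Lemma fraction_scaleDr : right_distributive fraction_scale +%R.
Proof. by move=> a x y; rewrite /fraction_scale mulrDr. Qed.

Lemma fraction_scaleDl x : {morph fraction_scale^~ x : a b / a + b}.
Proof. by move=> a b; rewrite /fraction_scale const_fracD mulrDl. Qed.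

HB.instance Definition _ := GRing.Zmodule_isLmodule.Build k fraction_module
  fraction_scaleA fraction_scale1 fraction_scaleDr fraction_scaleDl.

Lemma algebraic_constant (R : {poly k}) (s : {fraction {mpoly k[n]}}) : R != 0 ->
  \sum_(i < size R) const_frac n R`_i * s ^+ i = 0 -> exists c, s = const_frac n c.
Proof.
move=> R0; pose cst : {rmorphism k -> {fraction {mpoly k[n]}}} :=
  @FracField.tofrac {mpoly k[n]} \o @mpolyC n k.
have -> : \sum_(i < size R) const_frac n R`_i * s ^+ i = (map_poly cst R).[s].
  by rewrite horner_coef size_map_poly; apply: eq_bigr => i _; rewrite coef_map.
have [r ->] := closed_field_poly_normal R.
rewrite map_polyZ hornerZ => /eqP; rewrite mulf_eq0 fmorph_eq0 lead_coef_eq0 (negbTE R0) /=.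
rewrite rmorph_prod horner_prod prodf_seq_eq0 => /hasP[c _ /=].
by rewrite rmorphB /= map_polyX map_polyC hornerXsubC subr_eq0 => /eqP ->; exists c.
Qed.

End FractionModule.

(** * Generators of the function field on which the group acts diagonally *)

Section SemiInvariants.
Variables (k : closedFieldType) (char_k : [pchar k] =i pred0).
Variables (n m : nat) (d : 'I_m -> nat) (act : ('I_m -> k) -> polymap k n.+1).
Hypothesis actP : torus_action d act.
Local Notation free := [set i | d i == 0%N].
Hypothesis card_free : #|free| = n.
Local Notation A := {mpoly k[n.+1]}.
Local Notation K := {fraction A}.
Local Notation cst := (@const_frac k n.+1).
Implicit Types (t u : 'I_m -> k) (p q : A) (a b : 'rV[int]_m).
Local Notation hom := (homogeneous d act).
Local Notation hom0 := (homogeneous0 d act).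

Lemma act_aut t : adm d t -> poly_aut (act t).
Proof.
move=> At; have Ai := admV At; exists (act (fun i => (t i)^-1)).
rewrite -!(act_mul actP) //; split; rewrite -(act_one actP); congr act; apply: funext => i.
  by rewrite mulfV //; have [] := At i.
by rewrite mulVf //; have [] := At i.
Qed.

Definition translate t (x : K) : K := pullback (ratmap_of (act t)) x.

Lemma translateM t x y : adm d t -> translate t (x * y) = translate t x * translate t y.
Proof. by move=> At; apply/pullbackM/dominant_aut/act_aut. Qed.

Lemma translate_mor t : adm d t -> {s : {rmorphism K -> K} | s =1 translate t}.
Proof. by move=> At; exists (pullback_mor (dominant_aut (act_aut At))). Qed.

Lemma translateC t c : adm d t -> translate t (cst c) = cst c.
Proof. by move=> At; apply/pullbackC/dominant_aut/act_aut. Qed.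

Definition semi_invariant a (x : K) : Prop :=
  forall t, adm d t -> translate t x = cst (chr t a) * x.

Lemma semi_invariant_div a b p q : q != 0 -> hom a p -> hom b q ->
  semi_invariant (a - b) (p%:F / q%:F).
Proof.
move=> q0 hp hq t At; have nt := adm_torus At; have [s hs] := translate_mor At.
have tp r : translate t r%:F = (r \mPo act t)%:F.
  rewrite /translate (pullback_poly (dominant_aut (act_aut At))).
  exact: poly_pullback_of.
rewrite -hs fmorph_div !hs !tp hp // hq // -!mul_mpolyC !tofracM.
rewrite -[chr t a](divfK (chr_neq0 b nt)) -chrB // mpolyCM tofracM.
by apply: mul_div_cancel; rewrite const_frac_eq0 chr_neq0.
Qed.

Lemma semi_invariant_prod (I : Type) (r : seq I) (P : pred I) (x : I -> K) (w : I -> 'rV[int]_m) :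
  (forall i, P i -> semi_invariant (w i) (x i)) ->
  semi_invariant (\sum_(i <- r | P i) w i) (\prod_(i <- r | P i) x i).
Proof.
move=> hx t At; have nt := adm_torus At.
elim: r => [|i r IH].
  rewrite !big_nil chr0 const_frac1 mul1r; have [s hs] := translate_mor At.
  by rewrite -hs rmorph1.
rewrite !big_cons; case: ifP => // Pi.
by rewrite translateM // IH hx // chrD // const_fracM mulrACA.
Qed.

Lemma semi_invariantX a x e : semi_invariant a x -> semi_invariant (a *+ e) (x ^+ e).
Proof.
move=> hx; have := @semi_invariant_prod _ (index_enum 'I_e) xpredT (fun=> x) (fun=> a) (fun _ _ => hx).
by rewrite prodr_const sumr_const card_ord.
Qed.

Lemma semi_invariant_const a x c : semi_invariant a x -> semi_invariant a (cst c * x).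
Proof.
by move=> hx t At; rewrite translateM // translateC // hx // mulrCA.
Qed.

Definition semi_invariant0 a (x : K) : Prop :=
  forall t, connected_pt d t -> translate t x = cst (chr t a) * x.

Lemma semi_invariant0_sum a (I : Type) (r : seq I) (P : pred I) (x : I -> K) :
  (forall i, P i -> semi_invariant0 a (x i)) -> semi_invariant0 a (\sum_(i <- r | P i) x i).
Proof.
move=> hx t Tt; have [At _] := Tt; have [s hs] := translate_mor At.
rewrite -hs rmorph_sum mulr_sumr; apply: eq_bigr => i Pi /=.
by rewrite hs hx.
Qed.

Lemma semi_invariant0_independence (I : eqType) (s : seq I) (w : I -> 'rV[int]_m) (v : I -> K) :
  uniq s ->
  {in s &, forall x y, x != y -> exists2 i, d i = 0%N & w x 0 i != w y 0 i} ->
  {in s, forall x, semi_invariant0 (w x) (v x)} ->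
  \sum_(x <- s) v x = 0 -> {in s, forall x, v x = 0}.
Proof.
move=> us dist hv sum0.
have H := @dedekind_independence k (fraction_module k n.+1) (fun z => z = 0) ('I_m -> k)
   (fun t u i => t i * u i) (connected_pt d) (fun=> 1) I (fun x t => chr t (w x))
   (@zero_subspace k _) (fun t u => @connected_ptM k m d t u) (@connected_pt1 k m d)
   (fun x t u _ _ => chrM t u (w x)) (fun x => chr1 k (w x)) s v us.
apply: H.
- move=> x y xs ys xy; have [i di wi] := dist x y xs ys xy.
  have n2 : 2%:R != 0 :> k by apply: natr_neq0.
  exists (one_param i 2%:R); first exact: one_param_connected.
  by rewrite !chr_one_param; apply: contra wi => /eqP/(exprz2_inj char_k) ->.
- move=> t Tt; have [At _] := Tt; have [sg hs] := translate_mor At.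
  have := congr1 sg sum0; rewrite rmorph0 => e.
  rewrite -[RHS]e rmorph_sum /=.
  by rewrite big_seq [RHS]big_seq; apply: eq_bigr => x xs; rewrite hs hv.
Qed.

Definition free_index (l : 'I_n) : 'I_m := enum_val (cast_ord (esym card_free) l).

Lemma free_index_free l : d (free_index l) = 0%N.
Proof. by have := enum_valP (cast_ord (esym card_free) l); rewrite inE => /eqP. Qed.

Lemma free_index_inj : injective free_index.
Proof. by move=> x y /enum_val_inj/cast_ord_inj. Qed.

Lemma free_index_onto j : d j = 0%N -> exists l, free_index l = j.
Proof.
move=> dj; have jf : j \in free by rewrite inE dj.
exists (cast_ord card_free (enum_rank_in jf j)).
by rewrite /free_index cast_ordK enum_rankK_in.
Qed.

(* [y] consists of an invariant [s] of the connected component and of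
   semi-invariants whose weights are the free coordinates of the torus. *)
Record semi_invariant_coordinates (y : ratmap k n.+1) (es : 'rV[int]_m) : Prop := {
  sic_free : forall l, semi_invariant (delta_mx 0 (free_index l)) (tnth y (lift ord_max l));
  sic_free_neq0 : forall l, tnth y (lift ord_max l) != 0;
  sic_invariant : semi_invariant es (tnth y ord_max);
  sic_weight : forall j, d j = 0%N -> es 0 j = 0;
  sic_nonconst : forall c, tnth y ord_max != cst c;
  sic_generate : forall S, is_subfield S -> (forall c, S (cst c)) ->
    (forall i, S (tnth y i)) -> forall x, S x }.

(** A relation [P] between the components of [y] splits according to weights of the identity
    component. The free components have independent weights and the last one has weight 0, so each
    part is a monomial times a polynomial in the last component, which is transcendental because it
    is not constant. *)
Lemma sic_dominant y es : semi_invariant_coordinates y es -> dominant y.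
Proof.
move=> [yfree yfree0 ymax esw nonc _] P e; apply/eqP; apply: contrapT => /negP P0.
have [m0 m0P] : exists m0, m0 \in msupp P.
  by exists (mlead P); apply: mlead_supp.
pose c (g : 'X_{1..n.+1}) : 'X_{1..n} := [multinom g (lift ord_max l) | l < n].
pose F (g : 'X_{1..n.+1}) : K := cst P@_g * \prod_i tnth y i ^+ g i.
pose s := undup (map c (msupp P)).
pose v g : K := \sum_(h <- msupp P | c h == g) F h.
have FE g : F g = (\prod_l tnth y (lift ord_max l) ^+ c g l) * (cst P@_g * tnth y ord_max ^+ g ord_max).
  rewrite /F ord_max_prod mulrCA; congr (_ * _).
  by apply: eq_bigr => l _; rewrite mnmE.
pose w (g : 'X_{1..n}) : 'rV[int]_m := \sum_l delta_mx 0 (free_index l) *+ g l.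
have wE g l : w g 0 (free_index l) = (g l : nat)%:Z.
  rewrite /w summxE (bigD1 l) //= big1 ?addr0 => [|j jl].
    by rewrite -scaler_nat !mxE !eqxx mulr1 natz.
  by rewrite -scaler_nat !mxE (inj_eq free_index_inj) [l == j]eq_sym (negbTE jl) andbF mulr0.
have semiF g : semi_invariant0 (w (c g)) (F g).
  move=> t Tt; have [At _] := Tt.
  have -> : chr t (w (c g)) = chr t (w (c g) + es *+ g ord_max).
    apply: connected_chr_eq Tt => i di.
    by rewrite !mxE -scaler_nat mxE esw // mulr0 addr0.
  rewrite FE.
  have h1 : semi_invariant (w (c g)) (\prod_l tnth y (lift ord_max l) ^+ c g l).
    by apply: semi_invariant_prod => l _; apply: semi_invariantX.
  have h2 := semi_invariant_const P@_g (semi_invariantX (g ord_max) ymax).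
  rewrite translateM // h1 // h2 // chrD ?const_fracM; last exact: adm_torus At.
  by rewrite mulrACA.
have v0 : {in s, forall g, v g = 0}.
  apply: (semi_invariant0_independence (w := w)).
  - exact: undup_uniq.
  - move=> g h _ _ gh.
    have [l gl] : exists l, g l != h l.
      apply: contrapT => nl; move/eqP: gh; apply; apply/mnmP => l.
      by apply/eqP; apply: contrapT => /negP gl; apply: nl; exists l.
    exists (free_index l); first exact: free_index_free.
    by rewrite !wE; apply: contra gl => /eqP[->].
  - by move=> g _; apply: semi_invariant0_sum => h /eqP <-; apply: semiF.
  - rewrite -[RHS]e /poly_pullback /mmap.
    transitivity (\sum_(g <- s) \sum_(h <- msupp P) if c h == g then F h else 0).
      by apply: eq_bigr => g _; rewrite /v big_mkcond.
    rewrite exchange_big big_seq [RHS]big_seq; apply: eq_bigr => h hP /=.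
    rewrite (bigD1_seq (c h)) ?undup_uniq ?mem_undup ?map_f //= eqxx big1 ?addr0 // => g.
    by rewrite eq_sym => /negbTE ->.
have : v (c m0) = 0 by apply: v0; rewrite mem_undup map_f.
rewrite /v; under eq_bigr => h /eqP hc do rewrite FE hc.
have prod0 : \prod_l tnth y (lift ord_max l) ^+ c m0 l != 0.
  by apply/prodf_neq0 => l _; apply: expf_neq0.
rewrite -mulr_sumr => /eqP; rewrite mulf_eq0 (negbTE prod0) /= => /eqP sum0.
(* The part of [P] with the same free exponents as [m0], as a polynomial in the last component; its
   coefficient at [m0] is not zero. *)
pose R : {poly k} := \sum_(h <- msupp P | c h == c m0) P@_h *: 'X^(h ord_max).
have Rm0 : R`_(m0 ord_max) = P@_m0.
  rewrite /R coef_sum big_mkcond (bigD1_seq m0) ?msupp_uniq //= eqxx coefZ coefXn eqxx mulr1.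
  rewrite big1 ?addr0 // => h hm0; case: eqP => // ch; rewrite coefZ coefXn.
  case: eqP => [em|_]; last by rewrite mulr0.
  case/eqP: hm0; apply/mnmP => i; case: (unliftP ord_max i) => [l ->|-> //].
  by have := congr1 (fun g : 'X_{1..n} => g l) ch; rewrite !mnmE.
have R0 : R != 0.
  apply: contraTneq m0P => eR; rewrite mcoeff_msupp -Rm0 eR coef0.
  by rewrite eqxx.
have [] := algebraic_constant (s := tnth y ord_max) R0; last first.
  by move=> z /eqP; rewrite (negbTE (nonc z)).
have -> : \sum_(i < size R) const_frac n.+1 R`_i * tnth y ord_max ^+ i =
    (map_poly (@FracField.tofrac A \o @mpolyC n.+1 k) R).[tnth y ord_max].
  by rewrite horner_coef size_map_poly; apply: eq_bigr => i _; rewrite coef_map.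
rewrite /R rmorph_sum horner_sum -[RHS]sum0; apply: eq_bigr => h _.
by rewrite /= linearZ /= map_polyXn hornerZ hornerXn.
Qed.

(** The image of [pullback y] is a subfield containing the constants and the components of [y],
    hence everything. *)
Lemma sic_inverse y es : semi_invariant_coordinates y es -> exists h, cremona_inverse y h.
Proof.
move=> sic; have dy := sic_dominant sic; apply: cremona_inverse_of_onto => // i.
pose S (z : K) := exists u : K, pullback y u = z; rewrite -/(S _).
apply: (sic_generate sic) => [|c|j].
- split.
  + by exists 1; rewrite (pullbackE dy) rmorph1.
  + by move=> _ _ [u <-] [v <-]; exists (u - v); rewrite !(pullbackE dy) rmorphB.
  + by move=> _ _ [u <-] [v <-]; exists (u * v); rewrite !(pullbackE dy) rmorphM.
  + by move=> _ [u <-]; exists u^-1; rewrite !(pullbackE dy) fmorphV.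
- by exists (cst c); apply: pullbackC.
- by exists ('X_j)%:F; apply: pullbackX.
Qed.

Lemma eq_semi_invariant a b x : (forall t, adm d t -> chr t a = chr t b) ->
  semi_invariant a x -> semi_invariant b x.
Proof. by move=> ab hx t At; rewrite hx // ab. Qed.

Lemma minimal_pencil_exists : exists w f g, pencil d act w f g /\
  forall a p q, pencil d act a p q -> (maxn (msize f) (msize g) <= maxn (msize p) (msize q))%N.
Proof.
have exN : exists M, `[< exists w f g, pencil d act w f g /\ maxn (msize f) (msize g) = M >].
  have [w [f [g h]]] := pencil_exists actP card_free.
  by exists (maxn (msize f) (msize g)); apply/asboolP; exists w, f, g.
case: (ex_minnP exN) => M /asboolP[w [f [g [h hM]]]] Mmin; exists w, f, g; split=> // a p q h'.
by rewrite hM; apply: Mmin; apply/asboolP; exists a, p, q.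
Qed.

(** Independence of [p] and [q] makes the linear fractional substitution invertible, so [f / g] is a
    rational function of [p / q]. *)
Lemma pencil_ratio_field (S : K -> Prop) (x y x' y' : k) (f g p q : A) :
  is_subfield S -> (forall c, S (cst c)) -> indep p q -> g != 0 ->
  p = x *: f + y *: g -> q = x' *: f + y' *: g -> S (p%:F / q%:F) -> S (f%:F / g%:F).
Proof.
move=> subS SC ipq g0 ep eq Ss; have [p0 q0] := indep_neq0 ipq.
set s : K := _ / _ in Ss.
have FZ (c : k) (r : A) : (c *: r)%:F = cst c * r%:F by rewrite -mul_mpolyC tofracM.
have gF : g%:F != 0 :> K by rewrite tofrac_eq0.
have qF : q%:F != 0 :> K by rewrite tofrac_eq0.
have e : (cst x' * s - cst x) * f%:F = (cst y - s * cst y') * g%:F.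
  by apply: moebius_inverse; rewrite -!FZ -!tofracD -ep -eq /s divfK.
have den0 : cst x' * s - cst x != 0.
  apply/eqP => den0.
  have h : x' *: p - x *: q = 0.
    apply/eqP; rewrite -tofrac_eq0 tofracB !FZ -[p%:F](divfK qF) mulrA -mulrBl.
    by rewrite -/s den0 mul0r.
  have [|x'0 /eqP] := ipq x' (- x); first by rewrite scaleNr.
  rewrite oppr_eq0 => /eqP x0; have [|y'0 /eqP] := ipq y' (- y).
    by rewrite ep eq x0 x'0 !scale0r !add0r !scalerA -scalerDl mulNr mulrC subrr scale0r.
  rewrite oppr_eq0 => /eqP y0.
  by move: p0; rewrite ep x0 y0 !scale0r addr0 eqxx.
rewrite mulrC in e; rewrite (cross_eq_div gF den0 e).
have SB := subfieldB subS.
by apply: (subfieldM subS); [|apply: (subfieldV subS)]; apply: (SB) => //; apply: (subfieldM subS).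
Qed.

Lemma sic_exists : exists y es, semi_invariant_coordinates y es.
Proof.
have [w [f [g [pfg min_fg]]]] := minimal_pencil_exists.
have [a [b [p [q [hp hq ipq [x [y ep]] [x' [y' eq]]]]]]] :=
  homogeneous_pair char_k actP card_free pfg min_fg.
have [p0 q0] := indep_neq0 ipq; have [hf hg ifg] := pfg; have [f0 g0] := indep_neq0 ifg.
have gens' (l : 'I_n) : {z : (A * A) * ('rV[int]_m * 'rV[int]_m) |
  [/\ z.1.1 != 0, z.1.2 != 0, hom z.2.1 z.1.1, hom z.2.2 z.1.2 &
     forall t, adm d t -> chr t (z.2.1 - z.2.2) = t (free_index l)]}.
  apply: cid; have [F [G [u [v h]]]] := weights_generate char_k actP (free_index l).
  by exists ((F, G), (u, v)).
pose F l := (sval (gens' l)).1.1; pose G l := (sval (gens' l)).1.2.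
pose u l := (sval (gens' l)).2.1; pose v l := (sval (gens' l)).2.2.
have F0 l : F l != 0 by have [] := svalP (gens' l).
have G0 l : G l != 0 by have [] := svalP (gens' l).
have hF l : hom (u l) (F l) by have [] := svalP (gens' l).
have hG l : hom (v l) (G l) by have [] := svalP (gens' l).
have uv l t : adm d t -> chr t (u l - v l) = t (free_index l) by have [_ _ _ _] := svalP (gens' l); apply.
have uvE l l' : (u l - v l) 0 (free_index l') = (l == l')%:R.
  rewrite (free_weight char_k (free_index_free l) (uv l) (free_index_free l')).
  by rewrite (inj_eq free_index_inj).
pose s : K := p%:F / q%:F.
pose yy : ratmap k n.+1 := [tuple if unlift ord_max i is Some l then (F l)%:F / (G l)%:F else s | i < n.+1].
have yl l : tnth yy (lift ord_max l) = (F l)%:F / (G l)%:F by rewrite tnth_mktuple liftK.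
have ym : tnth yy ord_max = s by rewrite tnth_mktuple unlift_none.
have Wp : hom0 w p by rewrite ep; apply: hom0D; apply: hom0Z.
have Wq : hom0 w q by rewrite eq; apply: hom0D; apply: hom0Z.
exists yy, (a - b); split.
- move=> l; rewrite yl; apply: eq_semi_invariant (semi_invariant_div (G0 l) (hF l) (hG l)) => t At.
  by rewrite uv // chr_delta.
- by move=> l; rewrite yl mulf_neq0 ?invr_neq0 ?tofrac_eq0.
- by rewrite ym; apply: semi_invariant_div.
- move=> j dj; rewrite !mxE.
  rewrite (homogeneous0_weight char_k dj (homogeneous_weak hp) Wp p0).
  by rewrite (homogeneous0_weight char_k dj (homogeneous_weak hq) Wq q0) subrr.
- move=> c; rewrite ym; apply/eqP => e; have qF : q%:F != 0 :> K by rewrite tofrac_eq0.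
  have [|/eqP] := ipq 1 (- c); last by rewrite oner_eq0.
  apply/eqP; rewrite scale1r scaleNr -tofrac_eq0 tofracB -mul_mpolyC tofracM -/(cst c) -e.
  by rewrite /s divfK // subrr.
move=> S subS SC Sy.
have Sfg : S (f%:F / g%:F).
  by apply: (pencil_ratio_field subS SC ipq g0 ep eq); rewrite -/s -ym.
have gen := pencil_generates char_k actP card_free pfg min_fg subS SC Sfg.
(* The weight of [r] on the identity component is cancelled by powers of the ratios [F l / G l],
   with positive and negative exponents kept apart so that [D] and [Q] are polynomials; the
   resulting invariant lies in [S] by [gen]. *)
have Shom c r : hom c r -> S r%:F.
  move=> hr; pose e l := c 0 (free_index l).
  pose pos l := if (0 <= e l) then absz (e l) else 0%N.
  pose neg l := if (0 <= e l) then 0%N else absz (e l).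
  have pn l : (pos l)%:Z - (neg l)%:Z = e l by rewrite /pos /neg; case: ifP; lia.
  pose D : A := \prod_l (G l ^+ pos l * F l ^+ neg l).
  pose Q : A := \prod_l (F l ^+ pos l * G l ^+ neg l).
  have D0 : D != 0 by apply/prodf_neq0 => l _; rewrite mulf_neq0 ?expf_neq0.
  have Q0 : Q != 0 by apply/prodf_neq0 => l _; rewrite mulf_neq0 ?expf_neq0.
  pose wD := \sum_l (v l *+ pos l + u l *+ neg l).
  pose wQ := \sum_l (u l *+ pos l + v l *+ neg l).
  have prod_hom (z : 'I_n -> A) (wz : 'I_n -> 'rV[int]_m) : (forall l, hom (wz l) (z l)) ->
      hom (\sum_l wz l) (\prod_l z l).
    move=> hz; elim: (index_enum _) => [|l r' IH]; first by rewrite !big_nil; apply: hom_1.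
    by rewrite !big_cons; apply: homM.
  have hD : hom wD D by apply: prod_hom => l; apply: homM; apply: homX.
  have hQ : hom wQ Q by apply: prod_hom => l; apply: homM; apply: homX.
  have SPQ : S ((r * D)%:F / Q%:F).
    apply: (gen (c + wD)) => //; first by apply: homogeneous_weak; apply: homM.
    apply: hom0_eq (homogeneous_weak hQ) => j dj; have [l0 <-] := free_index_onto dj.
    have -> : wQ = wD + \sum_l (u l - v l) *~ e l.
      rewrite -big_split; apply: eq_bigr => l _ /=; rewrite -pn mulrzBr -!pmulrn !mulrnBl.
      rewrite -!scaler_nat; apply/rowP => z; rewrite !mxE; ring.
    rewrite [RHS]mxE addrC mxE; congr (_ + _).
    rewrite summxE (bigD1 l0) //= big1 ?addr0 => [|l ll0].
      by rewrite -scaler_int mxE uvE eqxx mulr1 intz.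
    by rewrite -scaler_int mxE uvE (negbTE ll0) mulr0.
  have rD : r%:F = ((r * D)%:F / Q%:F) * (Q%:F / D%:F) :> K.
    have DF : D%:F != 0 :> K by rewrite tofrac_eq0.
    have QF : Q%:F != 0 :> K by rewrite tofrac_eq0.
    rewrite (tofracM r D); exact: (mul_div_insert (r%:F) DF QF).
  rewrite rD; apply: (subfieldM subS) => //.
  rewrite !rmorph_prod -prodf_div; apply: subfield_prod => // l _.
  rewrite !rmorphM !rmorphXn /= div_powers -yl.
  apply: (subfieldM subS); first exact: (subfieldX subS).
  by apply/(subfieldV subS)/(subfieldX subS).
have Spoly r : S r%:F.
  have [r' [z [-> hz _]]] := homogeneous_decomposition actP r.
  rewrite rmorph_sum big_seq; apply: (subfield_sum subS) => c cr /=.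
  by apply: Shom; apply: hz.
move=> z; rewrite (fraction_repr z); apply: (subfieldM subS) => //.
exact: (subfieldV subS).
Qed.

End SemiInvariants.

(** Makes [adm (last_exponent e)] the kernel of the e-th power of the last coordinate, the full
    torus if [e = 0]. *)
Definition last_exponent n (e : nat) (i : 'I_n.+1) : nat := if i == ord_max then e else 0%N.

(** * Kernels of powers of the last coordinate and their torsion *)

Section LastExponentGroup.
Variables (k : closedFieldType) (char_k : [pchar k] =i pred0) (n : nat).
Implicit Types z u : 'I_n.+1 -> k.

Lemma adm_lastP e z : adm (last_exponent e) z <-> torus_pt z /\ z ord_max ^+ e = 1.
Proof.
split=> [Az|[nz ze] i].
  by split; [exact: adm_torus Az | have [_] := Az ord_max; rewrite /last_exponent eqxx].
by rewrite /last_exponent; split=> //; case: eqP => [->//|_]; rewrite expr0.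
Qed.

(* The [N]-torsion of the source has [N ^ (n + 1)] elements when [N] divides [e];
   so it fills the [N]-torsion of the torus, and [e'] kills the last coordinate. *)
Lemma torsion_dvdn (e e' N : nat) (theta : ('I_n.+1 -> k) -> 'I_n.+1 -> k) :
  (forall z, adm (last_exponent e) z -> adm (last_exponent e') (theta z)) ->
  (forall z u, adm (last_exponent e) z -> adm (last_exponent e) u ->
     theta (fun i => z i * u i) = fun i => theta z i * theta u i) ->
  (forall z u, adm (last_exponent e) z -> adm (last_exponent e) u -> theta z = theta u -> z = u) ->
  (0 < N)%N -> (N %| e)%N -> (N %| e')%N.
Proof.
move=> th_adm thM th_inj N0 Ne.
have [x xN] := prim_root_exists char_k N0.
have x0 : x != 0 by rewrite (prim_root_eq0 xN) -lt0n.
(* The torsion points of order dividing [N], enumerated by exponents of a primitive root; they lie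
   in the source because [N] divides [e]. *)
pose z (g : {ffun 'I_n.+1 -> 'I_N}) : 'I_n.+1 -> k := fun i => x ^+ g i.
have zN g i : z g i ^+ N = 1 by rewrite /z exprAC (prim_expr_order xN) expr1n.
have Az g : adm (last_exponent e) (z g).
  apply/adm_lastP; split=> [i|]; first by rewrite expf_neq0.
  by have /dvdnP[q ->] := Ne; rewrite mulnC exprM zN expr1n.
have A1 := @adm1 k n.+1 (last_exponent e).
have th1 : theta (fun=> 1) = fun=> 1.
  have e1 := thM _ _ A1 A1; apply: funext => i.
  have nz : theta (fun=> 1) i != 0 by have [] := th_adm _ A1 i.
  have := congr1 (fun f => f i) e1; rewrite /=.
  have -> : (fun=> 1 * 1) = (fun=> 1) :> ('I_n.+1 -> k) by apply: funext => j; rewrite mulr1.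
  by move=> h; apply: (mulIf nz); rewrite mul1r -h.
have thX u j : adm (last_exponent e) u ->
    adm (last_exponent e) (fun i => u i ^+ j) /\ theta (fun i => u i ^+ j) = fun i => theta u i ^+ j.
  move=> Au; elim: j => [|j [Aj IH]].
    by split=> //; rewrite th1.
  have eS : (fun i => u i ^+ j.+1) = (fun i => u i * u i ^+ j) by apply: funext => i; rewrite exprS.
  split; first by rewrite eS; apply: admM.
  by rewrite eS thM // IH; apply: funext => i; rewrite exprS.
have thN g i : theta (z g) i ^+ N = 1.
  have [_ h] := thX _ N (Az g); have := congr1 (fun f => f i) h; rewrite /= => <-.
  have -> : (fun i => z g i ^+ N) = fun=> 1 by apply: funext => j; apply: zN.
  by rewrite th1.
pose r g : {ffun 'I_n.+1 -> 'I_N} := [ffun i => sval (prim_rootP xN (thN g i))].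
have rE g i : theta (z g) i = x ^+ r g i.
  by rewrite ffunE; exact: (svalP (prim_rootP xN (thN g i))).
have r_inj : injective r.
  move=> g h gh; have : z g = z h.
    by apply: th_inj => //; apply: funext => i; rewrite !rE gh.
  move=> zgh; apply/ffunP => i; apply: val_inj.
  have /eqP := congr1 (fun f => f i) zgh; rewrite /z (eq_prim_root_expr xN).
  by rewrite !modn_small ?ltn_ord // => /eqP.
have r_bij := injF_bij r_inj.
case: r_bij => r' _ rK.
have [N1|N1] := eqVneq N 1%N; first by rewrite N1 dvd1n.
have N2 : (1 < N)%N by lia.
(* The point with all coordinates equal to the primitive root [x]; being an image, it satisfies
   [x ^+ e' = 1]. *)
pose g1 : {ffun 'I_n.+1 -> 'I_N} := [ffun=> Ordinal N2].
have /adm_lastP[_] := th_adm _ (Az (r' g1)).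
by rewrite rE rK ffunE expr1 => /eqP; rewrite -(prim_order_dvd xN).
Qed.

(** The value 0 is covered: it is the only number divisible by all positive integers. *)
Lemma dvdn_all_eq (a b : nat) : (forall N, (0 < N)%N -> (N %| a)%N -> (N %| b)%N) ->
  (forall N, (0 < N)%N -> (N %| b)%N -> (N %| a)%N) -> a = b.
Proof.
have zero (x : nat) : (forall N, (0 < N)%N -> (N %| x)%N) -> x = 0%N.
  by move=> h; case: x h => // x h; have := h x.+2 isT => /dvdn_leq; rewrite ltnn => /(_ isT).
move=> ab ba; have [a0|a0] := posnP a.
  by rewrite a0; apply/esym/zero => N N0; apply: ab => //; rewrite a0 dvdn0.
have [b0|b0] := posnP b.
  by rewrite b0; apply/zero => N N0; apply: ba => //; rewrite b0 dvdn0.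
by apply/eqP; rewrite eqn_dvd; apply/andP; split; [apply: ab | apply: ba].
Qed.

Definition diag_map z : polymap k n.+1 := [tuple z i *: 'X_i | i < n.+1].

Lemma eps_diag_map z : eps (diag_map z) = z ord_max.
Proof. by rewrite /eps tnth_mktuple mcoeffZ mcoeffX eqxx mulr1. Qed.

Lemma diag_map_inj : injective diag_map.
Proof.
move=> z u zu; apply: funext => i.
have := congr1 (fun a : polymap k n.+1 => (tnth a i)@_U_(i)) zu.
by rewrite !tnth_mktuple !mcoeffZ mcoeffX eqxx !mulr1.
Qed.

Lemma diag_map_comp z u : polymap_comp (diag_map z) (diag_map u) = diag_map (fun i => z i * u i).
Proof.
apply: eq_from_tnth => i; rewrite !tnth_mktuple comp_mpolyZ comp_mpolyXU -tnth_nth.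
by rewrite tnth_mktuple scalerA.
Qed.

Lemma diag_map1 : diag_map (fun=> 1) = polymap_id k n.+1.
Proof. by apply: eq_from_tnth => i; rewrite !tnth_mktuple scale1r. Qed.

Lemma diag_map_aut z : torus_pt z -> poly_aut (diag_map z).
Proof.
move=> nz; exists (diag_map (fun i => (z i)^-1)); rewrite !diag_map_comp -diag_map1.
by split; congr diag_map; apply: funext => i; rewrite ?mulfV ?mulVf.
Qed.

Lemma expz_eq1 (x : k) (d : int) : (x ^ d == 1) = (x ^+ absz d == 1).
Proof. by case: d => [j|j] //; rewrite NegzE -exprnN invr_eq1. Qed.

Lemma ker_eps_powP (d : int) (a : polymap k n.+1) :
  ker_eps_pow d a <-> exists2 z, adm (last_exponent (absz d)) z & a = diag_map z.
Proof.
split=> [[[z nz ->]] /eqP|[z /adm_lastP[nz ze] ->]].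
  rewrite -/(diag_map z) eps_diag_map expz_eq1 => /eqP ze.
  by exists z => //; apply/adm_lastP.
split; first by exists z.
by apply/eqP; rewrite eps_diag_map expz_eq1 ze.
Qed.

Lemma ker_eps_aut (d : int) (a : polymap k n.+1) : ker_eps_pow d a -> poly_aut a.
Proof. by case/ker_eps_powP => z /adm_torus nz ->; apply: diag_map_aut. Qed.

(** Conjugation gives an injective homomorphism of abstract groups between the kernels, which is
    what [torsion_dvdn] takes. *)
Lemma ker_conj_dvdn (d d' : int) (N : nat) :
  cremona_conj (@ker_eps_pow k n d) (@ker_eps_pow k n d') ->
  (0 < N)%N -> (N %| absz d)%N -> (N %| absz d')%N.
Proof.
move=> [g [h [gh hc]]].
pose conj (a : ratmap k n.+1) := ratmap_comp (ratmap_comp g a) h.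
have [dg dh egh ehg] := gh.
have img z : {u | adm (last_exponent (absz d)) z ->
    adm (last_exponent (absz d')) u /\ conj (ratmap_of (diag_map z)) = ratmap_of (diag_map u)}.
  apply: cid; have [Az|nAz] := EM (adm (last_exponent (absz d)) z); last by exists z.
  have [/(_ _)[]] := hc (conj (ratmap_of (diag_map z))).
    by exists (diag_map z) => //; apply/ker_eps_powP; exists z.
  by move=> b /ker_eps_powP[u Au ->] e _; exists u.
pose theta z := sval (img z).
have dom z : adm (last_exponent (absz d)) z -> dominant (ratmap_of (diag_map z)).
  by move=> Az; apply/dominant_aut/diag_map_aut/(adm_torus Az).
have conjM a b : dominant a -> dominant b ->
    conj (ratmap_comp a b) = ratmap_comp (conj a) (conj b).
  move=> da db.
  have conjE c x : dominant c -> pullback (conj c) x = pullback h (pullback c (pullback g x)).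
    move=> dc; have dgc := dominant_comp dg dc.
    by rewrite (pullback_comp _ dgc dh) (pullback_comp _ dg dc).
  have conj_tnth c i : tnth (conj c) i = pullback h (pullback c (tnth g i)).
    by rewrite 2!tnth_mktuple.
  apply: eq_from_tnth => i; rewrite conj_tnth [RHS]tnth_mktuple (conjE _ _ db) conj_tnth.
  rewrite (cremona_inverse_pullback _ (cremona_inverse_sym gh)).
  by rewrite (pullback_comp _ da db).
have conj_inj a b : dominant a -> dominant b -> conj a = conj b -> a = b.
  by move=> da db e; rewrite -(cremona_conjugateK gh da) -/(conj a) e cremona_conjugateK.
apply: (@torsion_dvdn _ _ _ theta).
- by move=> z Az; have [] := svalP (img z) Az.
- move=> z u Az Au; have [Atz ez] := svalP (img z) Az; have [Atu eu] := svalP (img u) Au.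
  have Azu := admM Az Au; have [Atzu ezu] := svalP (img _) Azu.
  apply: diag_map_inj; apply: ratmap_of_inj; rewrite -ezu -diag_map_comp.
  rewrite ratmap_of_comp ?conjM; [|exact: dom..|exact/diag_map_aut/adm_torus/Az|exact/diag_map_aut/adm_torus/Au].
  rewrite ez eu -ratmap_of_comp ?diag_map_comp //; exact/diag_map_aut/adm_torus.
- move=> z u Az Au e; have [Atz ez] := svalP (img z) Az; have [Atu eu] := svalP (img u) Au.
  apply: diag_map_inj; apply: ratmap_of_inj; apply: conj_inj; try exact: dom.
  by rewrite ez eu -/(theta z) -/(theta u) e.
Qed.

End LastExponentGroup.

(** * Diagonalization of the group and the theorem *)

Section NormalForm.
Variables (k : closedFieldType) (char_k : [pchar k] =i pred0) (n : nat).

(** The exponent [e] is the order of the character [es], finite because [es] involves torsion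
    coordinates only. *)
Lemma weight_exponent m (d : 'I_m -> nat) (es : 'rV[int]_m) :
  (forall j, d j = 0%N -> es 0 j = 0) ->
  exists e, [/\ (0 < e)%N, forall t : 'I_m -> k, adm d t -> chr t es ^+ e = 1 &
    forall b : int, (forall t : 'I_m -> k, adm d t -> chr t es ^ b = 1) -> (e%:Z %| b)%Z].
Proof.
move=> es0.
pose Q e := [&& (0 < e)%N & `[< forall t : 'I_m -> k, adm d t -> chr t es ^+ e = 1 >]].
have exQ : exists e, Q e.
  pose M := (\prod_(j | d j != 0%N) d j)%N; exists M; apply/andP; split.
    by apply: prodn_cond_gt0 => j; rewrite lt0n.
  apply/asboolP => t At; rewrite /chr -prodrXl big1 // => j _.
  have [dj|dj] := eqVneq (d j) 0%N; first by rewrite es0 // expr0z expr1n.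
  have [t0 t1] := At j.
  have /dvdnP[q ->] : (d j %| M)%N by rewrite /M (bigD1 j) //= dvdn_mulr.
  have h : (t j ^ es 0 j) ^+ d j = 1.
    by rewrite exprnP exprz_exp mulrC -exprz_exp -exprnP t1 exp1rz.
  by rewrite mulnC exprM h expr1n.
case: (ex_minnP exQ) => e /andP[e0 /asboolP he] emin; exists e; split=> // b hb.
have ez : e%:Z != 0 by rewrite -lt0n.
apply/dvdz_mod0P; apply: contrapT => /eqP r0.
have r_ge := modz_ge0 b ez; have r_lt := ltz_mod b ez.
have : (e <= absz (b %% e%:Z)%Z)%N.
  apply: emin; apply/andP; split; first by rewrite absz_gt0.
  apply/asboolP => t At; have nt := chr_neq0 es (adm_torus At).
  rewrite exprnP; have -> : (absz (b %% e%:Z)%Z : int) = (b %% e%:Z)%Z by lia.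
  have := hb t At; rewrite {1}(divz_eq b e%:Z) expfzDr // [_ * e%:Z]mulrC -exprz_exp.
  by rewrite -exprnP he // exp1rz mul1r.
lia.
Qed.

Lemma normal_form (H : alg_subgroup k n.+1) : diagonalizable_of_dim H n ->
  exists e phi psi (y h : ratmap k n.+1),
    [/\ coordinates (G := as_group H) (@last_exponent n e) phi psi, cremona_inverse y h &
     forall x, as_group H x -> forall i,
       pullback (ratmap_of (as_act x)) (tnth y i) = const_frac n.+1 (psi x i) * tnth y i].
Proof.
case=> diagH dimH; have [m [d [phi [psi coordH]]]] := diagonalizable_coordinates diagH.
have actP := algebraic_torus_action char_k coordH.
have card_free := alg_dim_coordinates char_k coordH dimH.
have [y [es sic]] := sic_exists char_k actP card_free.
have [h yh] := sic_inverse char_k actP sic.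
have [yfree _ ymax esw _ gen] := sic.
have [e [e0 he emin]] := weight_exponent esw.
pose fr := free_index card_free.
have fr_free l : d (fr l) = 0%N by exact: free_index_free.
(* The weights of the components of [y], row by row. *)
pose E : 'M[int]_(n.+1, m) :=
  \matrix_i (if unlift ord_max i is Some l then delta_mx 0 (fr l) else es).
have E_free l : row (lift ord_max l) E = delta_mx 0 (fr l) by rewrite rowK liftK.
have E_max : row ord_max E = es by rewrite rowK unlift_none.
have y_semi i : semi_invariant d (fun t => as_act (phi t)) (row i E) (tnth y i).
  case: (unliftP ord_max i) => [l ->|->]; first by rewrite E_free; apply: yfree.
  by rewrite E_max.
have chrE (t : 'I_m -> k) (b : 'rV[int]_n.+1) : torus_pt t ->
    chr t (b *m E) = (\prod_l t (fr l) ^ b 0 (lift ord_max l)) * chr t es ^ b 0 ord_max.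
  move=> nt; rewrite -chr_mulmx // /chr ord_max_prod E_max; congr (_ * _).
  by apply: eq_bigr => l _; rewrite E_free -/(chr _ _) chr_delta.
(* The torsion part of [t]; on it only the last weight [es] survives. *)
pose t0 (t : 'I_m -> k) : 'I_m -> k := fun j => if d j == 0%N then 1 else t j.
have t0_adm (t : 'I_m -> k) : adm d t -> adm d (t0 t).
  move=> At j; rewrite /t0; case: ifP => _; last exact: At.
  by rewrite oner_neq0 expr1n.
have t0_es (t : 'I_m -> k) : chr (t0 t) es = chr t es.
  apply: eq_bigr => j _; rewrite /t0; case: eqP => // dj.
  by rewrite esw // !expr0z.
have t0E (t : 'I_m -> k) b : adm d t -> chr (t0 t) (b *m E) = chr t es ^ b 0 ord_max.
  move=> At; rewrite chrE ?t0_es; last exact/adm_torus/t0_adm.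
  by rewrite big1 ?mul1r // => l _; rewrite /t0 fr_free exp1rz.
(* A point on which all weights of [y] are trivial fixes generators of the function field, so it is
   trivial by faithfulness, and by [lattice_full] the weights generate all characters. On torsion
   parts only powers of [es] remain; hence each torsion coordinate is a power of [chr t es], and the
   torsion is cyclic. *)
have torsion j : {c : int | d j != 0%N -> forall t : 'I_m -> k, adm d t -> chr t es ^ c = t j}.
  apply: cid; have [dj|dj] := eqVneq (d j) 0%N; first by exists 0.
  pose L (a : 'rV[int]_m) := exists b : 'rV[int]_n.+1, forall t : 'I_m -> k, adm d t ->
    chr t a = chr t (b *m E).
  have LL : is_lattice L.
    split; first by exists 0 => t _; rewrite mul0mx.
    move=> u v [b hb] [c hc]; exists (b - c) => t At; have nt := adm_torus At.
    by rewrite mulmxBl !chrB // hb // hc.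
  have [|t At tL|b hb] := lattice_full char_k (d := d) LL _ _ (delta_mx 0 j).
  - move=> l; exists 0 => t At; have nt := adm_torus At.
    by rewrite mul0mx chr0 chrZ // chr_delta -exprnP; have [_] := At l.
  - have fixy i : translate (fun t => as_act (phi t)) t (tnth y i) = tnth y i.
      rewrite y_semi // (tL (row i E)) ?const_frac1 ?mul1r //.
      by exists (delta_mx 0 i) => u _; rewrite -rowE.
    have [s hs] := translate_mor actP At.
    have fix_all x : translate (fun t => as_act (phi t)) t x = x.
      apply: (gen (fun x => translate (fun t => as_act (phi t)) t x = x)) => //.
      + split=> [|u v|u v|u]; rewrite -!hs; first exact: rmorph1.
        * by move=> eu ev; rewrite rmorphB eu ev.
        * by move=> eu ev; rewrite rmorphM eu ev.
        * by move=> eu; rewrite fmorphV eu.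
      + by move=> c; apply: (translateC actP).
    apply: (act_faithful actP At); apply: eq_from_tnth => i; apply/eqP.
    rewrite -tofrac_eq tnth_mktuple -[X in _ == X]fix_all /translate.
    by rewrite (pullbackX (dominant_aut (act_aut actP At))) tnth_mktuple.
  - exists (b 0 ord_max) => _ t At; rewrite -t0E // -hb; last exact: t0_adm.
    by rewrite chr_delta /t0 (negbTE dj).
(* The default [ord_max] is reached only for torsion indices [j], where [C] does not consult
   [fr_inv]. *)
pose fr_inv j : 'I_n.+1 := if [pick l | fr l == j] is Some l then lift ord_max l else ord_max.
have fr_invK j : d j = 0%N -> exists2 l, fr_inv j = lift ord_max l & fr l = j.
  move=> dj; rewrite /fr_inv; case: pickP => [l /eqP|no]; first by exists l.
  by have [l fl] := free_index_onto card_free dj; have := no l; rewrite /fr fl eqxx.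
pose C : 'M[int]_(m, n.+1) :=
  \matrix_j (if d j == 0%N then delta_mx 0 (fr_inv j) else sval (torsion j) *: delta_mx 0 ord_max).
have CE (t : 'I_m -> k) : adm d t -> forall j, chr t (row j (C *m E)) = t j.
  move=> At j; have nt := adm_torus At; rewrite row_mul rowK; case: ifP => dj.
    have [l -> frl] := fr_invK j (eqP dj).
    by rewrite -rowE E_free chr_delta frl.
  rewrite -scalemxAl -rowE E_max chrZ //.
  by apply: (svalP (torsion j)) => //; rewrite dj.
(* Tested on one-parameter subgroups, a relation has no free exponents; tested on torsion parts, its
   last exponent is a multiple of [e]. *)
have rel (b : 'rV[int]_n.+1) : (forall t : 'I_m -> k, adm d t -> chr t (b *m E) = 1) <->
     forall i, ((@last_exponent n e i)%:Z %| b 0%R i)%Z.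
  split=> [hb i|hb t At].
    case: (unliftP ord_max i) => [l ->|->].
      rewrite /last_exponent eq_sym (negbTE (neq_lift _ _)) dvd0z; apply/eqP.
      have n2 : 2%:R != 0 :> k by apply: natr_neq0.
      have [Ao _] := one_param_connected (k := k) (fr_free l) n2.
      apply: (exprz2_inj char_k); rewrite expr0z; apply: etrans (hb _ Ao).
      rewrite chrE; last exact: adm_torus Ao.
      rewrite chr_one_param esw // expr0z.
      rewrite exp1rz mulr1 (bigD1 l) //= /one_param eqxx big1 ?mulr1 // => l' ll'.
      by rewrite (inj_eq (@free_index_inj _ _ _ card_free)) (negbTE ll') exp1rz.
    rewrite /last_exponent eqxx; apply: emin => t At.
    by rewrite -t0E // hb //; apply: t0_adm.
  have nt := adm_torus At; rewrite chrE // big1 => [|l _].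
    have := hb ord_max; rewrite /last_exponent eqxx => /dvdzP[q ->].
    by rewrite mul1r mulrC -exprz_exp -exprnP he // exp1rz.
  have := hb (lift ord_max l); rewrite /last_exponent eq_sym (negbTE (neq_lift _ _)) dvd0z.
  by move=> /eqP ->; rewrite expr0z.
have coord' := coordinates_change coordH CE rel.
exists e, (fun z => phi (fun j => chr z (row j C))), (fun g i => chr (psi g) (row i E)), y, h.
split=> // x Gx i; have := y_semi i _ (coord_psi coordH Gx).
by rewrite /translate (coord_psiK coordH Gx).
Qed.

Lemma as_set_aut (H : alg_subgroup k n.+1) a : as_set H a -> poly_aut a.
Proof. by case=> g Gg ->; apply: as_aut. Qed.

Lemma normal_form_conj (H : alg_subgroup k n.+1) e phi psi (y h : ratmap k n.+1) :
  coordinates (G := as_group H) (@last_exponent n e) phi psi -> cremona_inverse y h ->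
  (forall x, as_group H x -> forall i,
     pullback (ratmap_of (as_act x)) (tnth y i) = const_frac n.+1 (psi x i) * tnth y i) ->
  cremona_conj (as_set H) (@ker_eps_pow k n e%:Z).
Proof.
move=> coordH yh semi; have [dy dh _ _] := yh; exists y, h; split=> //.
have conjE x : as_group H x ->
    ratmap_comp (ratmap_comp y (ratmap_of (as_act x))) h = ratmap_of (diag_map (psi x)).
  move=> Gx; have da := dominant_aut (as_aut Gx).
  apply: eq_from_tnth => i; rewrite 2!tnth_mktuple semi // pullbackM // pullbackC //.
  have -> : pullback h (tnth y i) = ('X_i)%:F.
    by rewrite -(pullbackX dy) (cremona_inverse_pullback _ yh).
  by rewrite !tnth_mktuple -mul_mpolyC tofracM.
move=> f; split.
  move=> [_ [x Gx ->] ->]; exists (diag_map (psi x)); last exact: conjE.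
  by apply/ker_eps_powP; exists (psi x) => //; apply: (coord_psi coordH).
move=> [_ /ker_eps_powP[z Az ->] ->]; exists (as_act (phi z)).
  by exists (phi z) => //; apply: (coord_phi coordH).
by rewrite conjE ?(coord_phiK coordH) //; apply: (coord_phi coordH).
Qed.

Lemma coordinates_morphism (G1 G2 : alg_group k) m (d : 'I_m -> nat) phi1 psi1 phi2 psi2 :
  coordinates (G := G1) d phi1 psi1 -> coordinates (G := G2) d phi2 psi2 ->
  alg_morphism (G1 := G1) (G2 := G2) (fun g => phi2 (psi1 g)).
Proof.
move=> c1 c2; split.
- by move=> g Gg; apply/(coord_phi c2)/(coord_psi c1).
- move=> g h Gg Gh; rewrite (coord_psiM c1) // (coord_phiM c2) //; exact: (coord_psi c1).
- move=> i j; have [l hl] := coord_laurent c2 (lshift 1 (mxvec_index i j)).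
  have R : regular (G := G1) (fun g => \sum_(x <- l) chr (psi1 g) x.1 * x.2).
    apply: regular_sum => x _; apply: regularM; last exact: regular_const.
    exact: (coord_chr_regular c1).
  have [p hp] := R; exists p => g Gg; rewrite -hp // -[RHS](hl _ (coord_psi c1 Gg)).
  by rewrite /gl_coords row_mxEl mxvecE.
Qed.

Lemma coordinates_isomorphic (G1 G2 : alg_group k) m (d : 'I_m -> nat) phi1 psi1 phi2 psi2 :
  coordinates (G := G1) d phi1 psi1 -> coordinates (G := G2) d phi2 psi2 ->
  alg_isomorphic G1 G2.
Proof.
move=> c1 c2; exists (fun g => phi2 (psi1 g)), (fun g => phi1 (psi2 g)); split.
- exact: (coordinates_morphism c1 c2).
- exact: (coordinates_morphism c2 c1).
- by move=> g Gg; rewrite (coord_phiK c2) ?(coord_psiK c1) //; apply: (coord_psi c1).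
- by move=> g Gg; rewrite (coord_phiK c1) ?(coord_psiK c2) //; apply: (coord_psi c2).
Qed.

Lemma isomorphic_dvdn (G1 G2 : alg_group k) e1 e2 phi1 psi1 phi2 psi2 N :
  coordinates (G := G1) (@last_exponent n e1) phi1 psi1 ->
  coordinates (G := G2) (@last_exponent n e2) phi2 psi2 ->
  alg_isomorphic G1 G2 -> (0 < N)%N -> (N %| e1)%N -> (N %| e2)%N.
Proof.
move=> c1 c2 [f [f' [[fG fM _] _ f'K _]]].
apply: (@torsion_dvdn k char_k n _ _ _ (fun z => psi2 (f (phi1 z)))).
- by move=> z Az; apply/(coord_psi c2)/fG/(coord_phi c1).
- move=> z u Az Au; have Gz := coord_phi c1 Az; have Gu := coord_phi c1 Au.
  by rewrite (coord_phiM c1) // fM // (coord_psiM c2) //; apply: fG.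
- move=> z u Az Au e; have Gz := coord_phi c1 Az; have Gu := coord_phi c1 Au.
  rewrite -(coord_phiK c1 Az) -(coord_phiK c1 Au); congr psi1.
  by rewrite -(f'K _ Gz) -(f'K _ Gu) -(coord_psiK c2 (fG _ Gz)) -(coord_psiK c2 (fG _ Gu)) e.
Qed.

Lemma alg_isomorphic_sym (G1 G2 : alg_group k) : alg_isomorphic G1 G2 -> alg_isomorphic G2 G1.
Proof. by case=> f [f' [mf mf' ff' f'f]]; exists f', f. Qed.

Lemma ker_conj_eq (d d' : int) :
  cremona_conj (@ker_eps_pow k n d) (@ker_eps_pow k n d') -> absz d = absz d'.
Proof.
move=> c; apply: dvdn_all_eq => N N0; first exact: (ker_conj_dvdn char_k c N0).
apply: (ker_conj_dvdn char_k _ N0); apply: cremona_conj_sym c => a; exact: ker_eps_aut.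
Qed.

End NormalForm.

Theorem theorem17 (k : closedFieldType) (char_k : [pchar k] =i pred0) (n : nat) :
  (forall H1 H2 : alg_subgroup k n.+1,
      diagonalizable_of_dim H1 n -> diagonalizable_of_dim H2 n ->
      (cremona_conj (as_set H1) (as_set H2) <->
       alg_isomorphic (as_group H1) (as_group H2)))
  /\
  (forall H : alg_subgroup k n.+1,
      diagonalizable_of_dim H n ->
      exists d : int,
        cremona_conj (as_set H) (ker_eps_pow d) /\
        forall d' : int,
          cremona_conj (as_set H) (ker_eps_pow d') ->
          forall a : polymap k n.+1, ker_eps_pow d' a <-> ker_eps_pow d a).
Proof.
split=> [H1 H2 D1 D2|H D].
  have [e1 [phi1 [psi1 [y1 [h1 [c1 yh1 semi1]]]]]] := normal_form char_k D1.
  have [e2 [phi2 [psi2 [y2 [h2 [c2 yh2 semi2]]]]]] := normal_form char_k D2.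
  have conj1 := normal_form_conj c1 yh1 semi1; have conj2 := normal_form_conj c2 yh2 semi2.
  split=> [conj|iso].
    have e12 : e1 = e2.
      apply: (@ker_conj_eq k char_k n e1%:Z e2%:Z).
      apply: cremona_conj_trans conj2; first exact: ker_eps_aut.
      apply: cremona_conj_trans conj; first exact: ker_eps_aut.
      by apply: cremona_conj_sym conj1; apply: as_set_aut.
    by move: c1; rewrite e12 => c1; apply: coordinates_isomorphic c1 c2.
  have e12 : e1 = e2.
    apply: dvdn_all_eq => N N0; first exact: (isomorphic_dvdn char_k c1 c2 iso N0).
    exact: (isomorphic_dvdn char_k c2 c1 (alg_isomorphic_sym iso) N0).
  rewrite e12 in conj1.
  apply: cremona_conj_trans conj1 _; first exact: as_set_aut.
  by apply: cremona_conj_sym conj2; apply: as_set_aut.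
have [e [phi [psi [y [h [c yh semi]]]]]] := normal_form char_k D.
have conj := normal_form_conj c yh semi.
exists e%:Z; split=> // d' conj' a.
(* The sign of [d'] does not affect the kernel: the subgroup is unique although the integer is
   determined only up to sign. *)
have -> : e%:Z = absz d' :> int.
  congr Posz; apply: (@ker_conj_eq k char_k n e%:Z d').
  apply: cremona_conj_trans conj'; first exact: ker_eps_aut.
  by apply: cremona_conj_sym conj; apply: as_set_aut.
by rewrite !ker_eps_powP absz_id.
Qed.
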